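(* Let $p>n$ and let $M>0$ be independent of $\varepsilon$. There exists $\kappa_M>0$ (independent of $\varepsilon$) such that for all $v_\varepsilon\in\mathcal{F}_\varepsilon^M$ it holds everywhere in $\Omega_\varepsilon$ that $$\det(\nabla v_\varepsilon)\ge\kappa_M .$$ In particular, for $\varepsilon$ small enough and with the extension operator $E_\varepsilon$ described in the context, for all $v_\varepsilon\in\mathcal{F}_\varepsilon^M$ it holds everywhere in $\Omega$ that $$\det(\nabla E_\varepsilon v_\varepsilon)\ge\frac{\kappa_M}{2}.$$
   Context: Geometry. Let $n\ge 2$, $a,b\in\mathbb{Z}^n$ with $a_i<b_i$ for all $i$, and let $\Omega=\prod_{i=1}^n(a_i,b_i)\subset\mathbb{R}^n$. The parameter $\varepsilon>0$ runs through a sequence tending to $0$ with $\varepsilon^{-1}\in\mathbb{N}$. Let $Y=(0,1)^n$ and let $Y_s\subset Y$ be a connected subdomain whose opposite faces match: $(\partial Y_s\cap\{x_i=0\})+e_i=\partial Y_s\cap\{x_i=1\}$ for $i=1,\dots,n$. Let $\Gamma=\partial Y_s\setminus\partial Y$, assumed to be a Lipschitz boundary. Put $K_\varepsilon=\{k\in\mathbb{Z}^n:\varepsilon(Y+k)\subset\Omega\}$, $\Omega_\varepsilon=\mathrm{int}\big(\bigcup_{k\in K_\varepsilon}\varepsilon(\overline{Y_s}+k)\big)$ and $\Gamma_\varepsilon=\partial\Omega_\varepsilon\setminus\partial\Omega$. It is assumed that $\Omega_\varepsilon$ is connected and $\Gamma_\varepsilon$ is a Lipschitz boundary; hence $|\partial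 Y_s\cap\{x_i=0\}|>0$ for all $i$. The set $\Omega\setminus\Omega_\varepsilon$ may be connected or disconnected. Let $\Gamma^D,\Gamma^N\subset\partial\Omega$ with $\Gamma^D\cap\Gamma^N=\emptyset$, $\overline{\Gamma^D}\cup\overline{\Gamma^N}=\partial\Omega$, $|\Gamma^D|>0$, and such that for every $\varepsilon$ both sets can be decomposed into micro-faces $\varepsilon\big(S((0,1)^{n-1}\times\{0\})+k\big)$ with rotations $S\in\mathbb{R}^{n\times n}$ and $k\in\mathbb{Z}^n$. Set $\Gamma_\varepsilon^D=\mathrm{int}(\partial\Omega_\varepsilon\cap\Gamma^D)$ (interior relative to the boundary). Energies (with constants $c_0,C_0>0$; $GL^+(n)=\{F\in\mathbb{R}^{n\times n}:\det F>0\}$). $W_\varepsilon(x,F)=W(x/\varepsilon,F)$, where $W:\mathbb{R}^n\times GL^+(n)\to[0,\infty)$ is $Y$-periodic in the first variable, continuous, continuously differentiable in $F$ with $\partial_FW$ continuous, and $W(y,F)\ge c_0(|F|^2+\det(F)^{-q})-C_0$ for all $y,F$, with some $q\ge\frac{pn}{p-n}$. $H_\varepsilon(x,G)=H(x/\varepsilon,G)$, where $H:\mathbb{R}^n\times\mathbb{R}^{n\times n\times n}\to[0,\infty)$ is $Y$-periodic in the first variable, continuous, convex and continuously differentiable in $G$ with $\partial_GH$ continuous, and $c_0|G|^p\le H(y,G)\le C_0(1+|G|^p)$, $|\partial_GH(y,G)|\le C_0|G|^{p-1}$. $\mathcal{Y}_{\mathrm{id},\varepsilon}=\{v\in W^{2,p}(\Omega_\varepsilon)^n: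 v=\mathrm{id}\text{ on }\Gamma_\varepsilon^D,\ \det(\nabla v)>0\text{ in }\Omega_\varepsilon\}$ with $\mathrm{id}(x)=x$; for $v\in\mathcal{Y}_{\mathrm{id},\varepsilon}$ the mechanical energy is $\mathcal{M}_\varepsilon(v)=\int_{\Omega_\varepsilon}W_\varepsilon(\nabla v)+H_\varepsilon(\nabla^2v)\,dx$; $\mathcal{F}_\varepsilon^M=\{v\in\mathcal{Y}_{\mathrm{id},\varepsilon}:\mathcal{M}_\varepsilon(v)\le M\}$. Extension operator. $E_\varepsilon$ is a linear operator with $E_\varepsilon v=v$ on $\Omega_\varepsilon$, mapping $W^{2,p}(\Omega_\varepsilon)\to W^{2,p}(\Omega)$ and $W^{1,s}(\Omega_\varepsilon)\to W^{1,s}(\Omega)$ for all $s\in[1,\infty)$ (applied componentwise), with, for $C$ independent of $\varepsilon$: $\|E_\varepsilon u\|_{L^p(\Omega)}\le C(\|u\|_{L^p(\Omega_\varepsilon)}+\varepsilon\|\nabla u\|_{L^p(\Omega_\varepsilon)})$, $\|\nabla E_\varepsilon u\|_{L^p(\Omega)}\le C\|\nabla u\|_{L^p(\Omega_\varepsilon)}$, $\|\nabla^2E_\varepsilon u\|_{L^p(\Omega)}\le C\|\nabla^2u\|_{L^p(\Omega_\varepsilon)}$ for $u\in W^{2,p}(\Omega_\varepsilon)$, and $\|E_\varepsilon v\|_{L^s(\Omega)}\le C\|v\|_{W^{1,s}(\Omega_\varepsilon)}$, $\|\nabla E_\varepsilon v\|_{L^s(\Omega)}\le C\|\nabla v\|_{L^s(\Omega_\varepsilon)}$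 for $v\in W^{1,s}(\Omega_\varepsilon)$. *)

(* Defs.v *)
From HB Require Import structures.
From mathcomp Require Import all_boot all_order all_algebra.
From mathcomp Require Import all_classical all_reals all_analysis.
Set Implicit Arguments.
Unset Strict Implicit.
Unset Printing Implicit Defensive.
Import Order.TTheory GRing.Theory Num.Theory.
Import numFieldNormedType.Exports.
Local Open Scope classical_set_scope.
Local Open Scope ring_scope.

(* The sigma-algebra on 'rV[R]_n generated by the coordinates, i.e. the Borel
   sigma-algebra of R^n. *)
Section rV_measurable.
Context {R : realType} {n : nat}.

Let coord (i : 'I_n) (x : 'rV[R]_n) : measurableTypeR R := x 0 i.

Let rV_set0 : g_sigma_preimage coord set0.
Proof. exact: sigma_algebra0. Qed.

Let rV_setC A : g_sigma_preimage coord A -> g_sigma_preimage coord (~` A).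
Proof. exact: sigma_algebraC. Qed.

Let rV_bigcup (F : (set 'rV[R]_n)^nat) :
  (forall i, g_sigma_preimage coord (F i)) ->
  g_sigma_preimage coord (\bigcup_i F i).
Proof. exact: sigma_algebra_bigcup. Qed.

HB.instance Definition _ := @isMeasurable.Build
  (measure_tuple_display default_measure_display) ('rV[R]_n)
  (g_sigma_preimage coord)  rV_set0 rV_setC rV_bigcup.
End rV_measurable.

Lemma measurable_coord (R : realType) n (i : 'I_n) :
  measurable_fun setT (fun x : 'rV[R]_n => x 0 i : measurableTypeR R).
Proof.
move=> _ Y mY; rewrite setTI; apply: sub_sigma_algebra => /=.
rewrite -bigcup_seq/=; exists i => /=; first by rewrite mem_index_enum.
by exists Y => //; rewrite setTI.
Qed.

Lemma measurable_fun_rV (R : realType) n d (T : measurableType d)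
    (f : T -> 'rV[R]_n) :
  (forall i, measurable_fun setT (fun x => f x 0 i : measurableTypeR R)) ->
  measurable_fun setT f.
Proof.
move=> mf _ A mA; rewrite setTI.
pose G : set (set 'rV[R]_n) := [set B | measurable (f @^-1` B)].
suff : G A by [].
move: A mA; apply: smallest_sub.
  split.
  - by rewrite /G/= preimage_set0.
  - by move=> B GB; rewrite /G/= setTD preimage_setC; exact: measurableC.
  - by move=> F GF; rewrite /G/= preimage_bigcup; apply: bigcupT_measurable => k; exact: GF.
move=> B; rewrite -bigcup_seq => -[i _] [C mC <-{B}].
rewrite /G /= setTI; have := mf i measurableT C mC; rewrite setTI; exact.
Qed.

Definition rV_cons (R : realType) n (z : measurableTypeR R * 'rV[R]_n) :
  'rV[R]_n.+1 := row_mx (const_mx z.1 : 'rV_1) z.2.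

Definition rV_uncons (R : realType) n (x : 'rV[R]_n.+1) :
  measurableTypeR R * 'rV[R]_n := (x 0 0, \row_i x 0 (lift 0 i)).

Lemma rV_consE (R : realType) n (z : measurableTypeR R * 'rV[R]_n) i :
  rV_cons z 0 i = oapp (z.2 0) z.1 (unlift 0 i).
Proof.
case: (unliftP 0 i) => [j ->|->] /=.
  rewrite (_ : lift 0 j = rshift 1 j); last exact/val_inj.
  exact: (row_mxEr (const_mx z.1 : 'rV_1) z.2 0 j).
rewrite (_ : 0 = lshift n (0 : 'I_1)); last exact/val_inj.
by rewrite [LHS](row_mxEl (const_mx z.1 : 'rV_1) z.2) mxE.
Qed.

Lemma rV_consK (R : realType) n : cancel (@rV_cons R n) (@rV_uncons R n).
Proof.
move=> [t y]; rewrite /rV_uncons; congr pair.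
  by rewrite rV_consE unlift_none.
by apply/rowP => i; rewrite mxE rV_consE liftK.
Qed.

Lemma rV_unconsK (R : realType) n : cancel (@rV_uncons R n) (@rV_cons R n).
Proof.
move=> x; apply/rowP => i; rewrite rV_consE.
by case: (unliftP 0 i) => [j ->|->]; rewrite /= ?mxE.
Qed.

Lemma measurable_rV_cons (R : realType) n : measurable_fun setT (@rV_cons R n).
Proof.
apply: measurable_fun_rV => i; under eq_fun do rewrite rV_consE.
case: (unliftP 0 i) => [j _|_] /=; last exact: measurable_fst.
exact: (measurableT_comp (measurable_coord _)).
Qed.

Lemma measurable_rV_uncons (R : realType) n :
  measurable_fun setT (@rV_uncons R n).
Proof.
apply/measurable_fun_pairP; split; first exact: measurable_coord.
apply: measurable_fun_rV => i /=.
under eq_fun do rewrite mxE; exact: measurable_coord.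
Qed.

Section lebesgue_cons.
Context {R : realType} {n : nat}.
Variable mu : {sigma_finite_measure set 'rV[R]_n -> \bar R}.

Definition leb_cons : set 'rV[R]_n.+1 -> \bar R :=
  pushforward ((@lebesgue_measure R) \x mu)%E (@rV_cons R n).


Let leb_cons0 : leb_cons set0 = 0%E.
Proof. by rewrite /leb_cons /pushforward preimage_set0 measure0. Qed.

Let leb_cons_ge0 A : (0 <= leb_cons A)%E.
Proof. exact: (measure_ge0 ((@lebesgue_measure R) \x mu)%E). Qed.

Let leb_cons_sigma_additive : semi_sigma_additive leb_cons.
Proof.
have mc := @measurable_rV_cons R n.
move=> F mF tF mUF; rewrite /leb_cons /pushforward preimage_bigcup.
apply: measure_semi_sigma_additive.
- by move=> k; rewrite -[X in measurable X]setTI; exact: mc.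
- apply/trivIsetP => /= i j _ _ ij; rewrite -preimage_setI.
  by move/trivIsetP : tF => /(_ _ _ _ _ ij) ->//; rewrite preimage_set0.
- by rewrite -preimage_bigcup -[X in measurable X]setTI; exact: mc.
Qed.

HB.instance Definition _ := isMeasure.Build _ _ _ leb_cons
  leb_cons0 leb_cons_ge0 leb_cons_sigma_additive.

Let leb_cons_sigma_finite : sigma_finite setT leb_cons.
Proof.
pose l : {sigma_finite_measure set (measurableTypeR R) -> \bar R} :=
  @lebesgue_measure R.
have /sigma_finiteP[F [TF ndF Foo]] := sigma_finiteT l.
have /sigma_finiteP[G [TG ndG Goo]] := sigma_finiteT mu.
exists (fun k => @rV_uncons R n @^-1` (F k `*` G k)).
  rewrite -preimage_bigcup (_ : \bigcup_k _ = setT) ?preimage_setT//.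
  apply/seteqP; split=> // -[x y] _.
  have : (setT : set (measurableTypeR R)) x by [].
  have : (setT : set 'rV[R]_n) y by [].
  rewrite TF TG => -[i _ Gi] [j _ Fj]; exists (maxn i j) => //; split.
    by move: Fj; exact/subsetPset/ndF/leq_maxr.
  by move: Gi; exact/subsetPset/ndG/leq_maxl.
move=> k; have [mF F_fin] := Foo k; have [mG G_fin] := Goo k; split.
  rewrite -[X in measurable X]setTI; apply: measurable_rV_uncons => //.
  exact: measurableX.
rewrite /leb_cons /pushforward -comp_preimage.
rewrite (_ : _ \o _ = id); last by apply/funext => z /=; rewrite rV_consK.
by rewrite preimage_id product_measure1E// lte_mul_pinfty// ge0_fin_numE.
Qed.

HB.instance Definition _ := Measure_isSigmaFinite.Build _ _ _ leb_cons
  leb_cons_sigma_finite.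
End lebesgue_cons.

(* n-dimensional Lebesgue measure on Borel sets: the n-fold product of the
   one-dimensional one (lemma leb_box below gives its values on boxes). *)
Fixpoint leb (R : realType) (n : nat) :
    {sigma_finite_measure set 'rV[R]_n -> \bar R} :=
  match n with
  | 0 => [the {sigma_finite_measure set 'rV[R]_0 -> \bar R} of
            \d_ (0 : 'rV[R]_0)]
  | m.+1 => [the {sigma_finite_measure set 'rV[R]_m.+1 -> \bar R} of
               leb_cons (leb R m)]
  end.
Arguments leb {R n}.

Lemma measurable_rV_box (R : realType) n (a b : 'rV[R]_n) :
  measurable [set x : 'rV[R]_n | forall i, a 0 i < x 0 i < b 0 i].
Proof.
rewrite (_ : mkset _ = \bigcap_(i in [set: 'I_n])
    ((fun x : 'rV[R]_n => x 0 i : measurableTypeR R) @^-1` `]a 0 i, b 0 i[)).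
  apply: fin_bigcap_measurable => // i _; rewrite -[X in measurable X]setTI.
  exact: measurable_coord.
by apply/seteqP; split=> x h i; [move=> _|]; have := h i;
  rewrite /= in_itv//=; exact.
Qed.

Lemma leb_box (R : realType) n (a b : 'rV[R]_n) :
  (forall i, a 0 i <= b 0 i) ->
  leb [set x : 'rV[R]_n | forall i, a 0 i < x 0 i < b 0 i] =
  (\prod_(i < n) (b 0 i - a 0 i))%:E.
Proof.
elim: n a b => [|n IH] a b ab /=.
  by rewrite big_ord0 diracE mem_set// => -[].
rewrite /leb_cons /pushforward.
rewrite [X in (_ \x _)%E X](_ : _ = `]a 0 0, b 0 0[%classic `*`
  [set y : 'rV[R]_n | forall i, (\row_j a 0 (lift 0 j)) 0 i < y 0 i <
     (\row_j b 0 (lift 0 j)) 0 i]); last first.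
  apply/seteqP; split=> -[t y] /=.
    move=> h; split; first by have := h 0; rewrite rV_consE unlift_none/= in_itv.
    by move=> i; have := h (lift 0 i); rewrite rV_consE liftK/= !mxE.
  rewrite /= in_itv/= => -[h0 h] i; rewrite rV_consE.
  by case: (unliftP 0 i) => [j ->|->] //=; have := h j; rewrite !mxE.
rewrite product_measure1E//=; last first.
  exact: measurable_rV_box.
rewrite IH; last by move=> i; rewrite !mxE.
rewrite lebesgue_measure_itv/= lte_fin big_ord_recl.
under eq_bigr do rewrite !mxE.
case: ltP => [_|ba]; first by rewrite -EFinD -EFinM.
by rewrite mul0e (@le_anti _ _ (a 0 0) (b 0 0)) ?subrr ?mul0r// ab ba.
Qed.

Section euclidean.
Context {R : realType}.

(* Euclidean (Frobenius) norm; the norm `|A| of the library is the sup norm. *)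
Definition frob m n (A : 'M[R]_(m, n)) : R :=
  Num.sqrt (\sum_i \sum_j A i j ^+ 2).

Definition dotv n (x y : 'rV[R]_n) : R := (x *m y^T) 0 0.

(* Matrix of the partial derivatives of a scalar function of a matrix. *)
Definition mxgrad m n (f : 'M[R]_(m, n) -> R) (A : 'M[R]_(m, n)) :
  'M[R]_(m, n) := \matrix_(i, j) 'D_(delta_mx i j) f A.

Definition boundary n (A : set 'rV[R]_n) : set 'rV[R]_n :=
  closure A `\` interior A.

(* Near each point of S, the set U is, in suitable Cartesian coordinates (with
   vertical direction the unit vector e), the part lying strictly above the
   graph of a Lipschitz function. *)
Definition lipschitz_boundary n (U S : set 'rV[R]_n) : Prop :=
  forall x0, S x0 ->
    exists (e : 'rV[R]_n) (g : 'rV[R]_n -> R) (r : R),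
      [/\ dotv e e = 1, lipschitz g, 0 < r &
        forall y, `|y - x0| < r ->
          (U y <-> g (y - dotv y e *: e) < dotv y e)].

End euclidean.

Section sobolev.
Context {R : realType} {n : nat}.
Implicit Types (U S : set 'rV[R]_n) (u g phi : 'rV[R]_n -> R) (p s : R).

Definition pderiv (i : 'I_n) u : 'rV[R]_n -> R :=
  fun x => 'D_(delta_mx 0 i) u x.

Definition smooth phi : Prop :=
  forall (l : seq 'I_n) x, differentiable (foldr pderiv phi l) x.

Definition test_function U phi : Prop :=
  smooth phi /\
  exists K, [/\ compact K, K `<=` U & forall x, ~ K x -> phi x = 0].

Definition loc_integrable U u : Prop :=
  measurable_fun U u /\
  forall K, compact K -> K `<=` U ->
    (\int[leb]_(x in K) `|u x|%:E < +oo)%E.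

(* g is a weak i-th partial derivative of u in U. *)
Definition weak_pderiv U (i : 'I_n) u g : Prop :=
  [/\ loc_integrable U u, loc_integrable U g &
    forall phi, test_function U phi ->
      \int[leb]_(x in U) (u x * pderiv i phi x) =
      - \int[leb]_(x in U) (g x * phi x)].

(* A chosen weak i-th partial derivative; it is determined up to a.e. equality
   in U, and it is junk when there is none. *)
Definition wD U (i : 'I_n) u : 'rV[R]_n -> R :=
  xget (fun=> 0) [set g | weak_pderiv U i u g].

Definition wgrad U u x : 'rV[R]_n := \row_i wD U i u x.

Definition whess U u x : 'M[R]_n := \matrix_(i, j) wD U j (wD U i u) x.

Definition Lpnorm p U u : \bar R := 'N[leb]_(p%:E)[EFin \o (u \_ U)].

Definition memLp p U u : Prop :=
  measurable_fun U u /\ (Lpnorm p U u < +oo)%E.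

Definition W1 s U u : Prop :=
  memLp s U u /\
  forall i, weak_pderiv U i u (wD U i u) /\ memLp s U (wD U i u).

Definition W2 p U u : Prop :=
  W1 p U u /\ forall i, W1 p U (wD U i u).

Definition W1norm s U u : \bar R :=
  (Lpnorm s U u + Lpnorm s U (fun x => frob (wgrad U u x)))%E.

Implicit Types (v : 'rV[R]_n -> 'rV[R]_n).

Definition coordf v (i : 'I_n) : 'rV[R]_n -> R := fun x => v x 0 i.

Definition vgrad U v x : 'M[R]_n := \matrix_(i, j) wD U j (coordf v i) x.

(* A third-order tensor G is stored as the n x (n * n) matrix whose i-th row is
   mxvec of the matrix (G i j k)_(j, k). *)
Definition vhess U v x : 'M[R]_(n, n * n) :=
  \matrix_(i < n) mxvec (whess U (coordf v i) x).

(* P holds at every point of U for the gradient of v: Sobolev functions are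
   defined a.e., so the pointwise assertion is about the continuous
   representative of the weak gradient (it exists, and is unique on an open U,
   for v in W^{2,p} with p > n). *)
Definition grad_everywhere U v (P : 'M[R]_n -> Prop) : Prop :=
  exists G : 'rV[R]_n -> 'M[R]_n,
    [/\ {within U, continuous G},
        forall i j, weak_pderiv U j (coordf v i) (fun x => G x i j) &
        forall x, U x -> P (G x)].

(* v = f on the part S of the boundary of U, in the sense of the continuous
   representative of v up to S. *)
Definition equal_on_boundary U S v (f : 'rV[R]_n -> 'rV[R]_n) : Prop :=
  exists w : 'rV[R]_n -> 'rV[R]_n,
    [/\ {within U `|` S, continuous w},
        {ae leb, forall x, U x -> w x = v x} &
        forall x, S x -> w x = f x].

End sobolev.

Section geometry.
Context {R : realType} {n : nat}.
Implicit Types (a b k : 'rV[int]_n) (A U Ys : set 'rV[R]_n) (eps : R).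

Definition box a b : set 'rV[R]_n :=
  [set x | forall i, (a 0 i)%:~R < x 0 i < (b 0 i)%:~R].

Definition unit_cell : set 'rV[R]_n := [set x | forall i, 0 < x 0 i < 1].

(* eps (A + k) *)
Definition scaled_copy eps k A : set 'rV[R]_n :=
  [set eps *: (y + map_mx intr k) | y in A].

Definition cells U eps : set 'rV[int]_n :=
  [set k | scaled_copy eps k unit_cell `<=` U].

Definition perforated U Ys eps : set 'rV[R]_n :=
  interior (\bigcup_(k in cells U eps) scaled_copy eps k (closure Ys)).

Definition rotation (S : 'M[R]_n) : Prop := S *m S^T = 1%:M /\ \det S = 1.

(* (0,1)^(n-1) x {0} *)
Definition reference_face : set 'rV[R]_n :=
  [set y | forall i : 'I_n,
     if val i == n.-1 then y 0 i = 0 else 0 < y 0 i < 1].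

Definition microface eps (S : 'M[R]_n) k : set 'rV[R]_n :=
  scaled_copy eps k [set y *m S^T | y in reference_face].

(* A is the union of pairwise disjoint (relatively open) micro-faces, up to
   points of the relative boundaries of these faces. *)
Definition decomposed eps A : Prop :=
  exists P : set (set 'rV[R]_n),
    [/\ forall F, P F -> exists S k, rotation S /\ F = microface eps S k,
        trivIset P id,
        \bigcup_(F in P) F `<=` A &
        A `<=` \bigcup_(F in P) closure F].

(* Surface measure of a subset A of the boundary of box a b: the sum over the
   faces of the box of the (n-1)-dimensional outer Lebesgue measure of the part
   of A in that face. *)
Definition surface_measure a b A : \bar R :=
  let face i c : set 'rV[R]_n.-1 :=
    [set col' i x | x in A `&` [set x | x 0 i = c]] in
  (\sum_(i < n) (mu_ext leb (face i (a 0 i)%:~R) +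
                 mu_ext leb (face i (b 0 i)%:~R)))%E.

(* Interior of boundary U `&` GD relative to boundary U. *)
Definition dirichlet_part U (GD : set 'rV[R]_n) : set 'rV[R]_n :=
  [set x | (boundary U `&` GD) x /\
           within (boundary U) (nbhs x) (boundary U `&` GD)].

Record reference_cell Ys : Prop := {
  cell_open : open Ys ;
  cell_nonempty : Ys !=set0 ;
  cell_connected : connected Ys ;
  cell_sub : Ys `<=` unit_cell ;
  cell_matching : forall i : 'I_n,
    [set x + delta_mx 0 i | x in boundary Ys `&` [set x | x 0 i = 0]] =
    boundary Ys `&` [set x | x 0 i = 1] ;
  cell_lipschitz : lipschitz_boundary Ys (boundary Ys `\` boundary unit_cell)
}.

Record perforated_domain U Ys eps : Prop := {
  perforated_connected : connected (perforated U Ys eps) ;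
  perforated_lipschitz : lipschitz_boundary (perforated U Ys eps)
    (boundary (perforated U Ys eps) `\` boundary U)
}.

Record boundary_splitting a b (eps : nat -> R) (GD GN : set 'rV[R]_n) :
    Prop := {
  splitting_subD : GD `<=` boundary (box a b) ;
  splitting_subN : GN `<=` boundary (box a b) ;
  splitting_disjoint : GD `&` GN = set0 ;
  splitting_cover : closure GD `|` closure GN = boundary (box a b) ;
  splitting_pos : (0 < surface_measure a b GD)%E ;
  splitting_microD : forall j : nat, decomposed (eps j) GD ;
  splitting_microN : forall j : nat, decomposed (eps j) GN
}.

End geometry.

Section energies.
Context {R : realType} {n : nat}.
Variables (c0 C0 p q : R).

Definition GLp : set ('rV[R]_n * 'M[R]_n) := [set z | 0 < \det z.2].

(* W is only meaningful at matrices of positive determinant. *)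
Record elastic_energy (W : 'rV[R]_n -> 'M[R]_n -> R) : Prop := {
  elastic_ge0 : forall y F, 0 < \det F -> 0 <= W y F ;
  elastic_periodic : forall y F i,
    0 < \det F -> W (y + delta_mx 0 i) F = W y F ;
  elastic_continuous :
    {within GLp, continuous (fun z : 'rV[R]_n * 'M[R]_n => W z.1 z.2)} ;
  elastic_differentiable : forall y (F : 'M[R]_n), 0 < \det F -> differentiable (W y) F ;
  elastic_C1 : {within GLp,
    continuous (fun z : 'rV[R]_n * 'M[R]_n => mxgrad (W z.1) z.2)} ;
  elastic_coercive : forall y F, 0 < \det F ->
    c0 * (frob F ^+ 2 + (\det F) `^ (- q)) - C0 <= W y F
}.

Record hyperstress_energy (H : 'rV[R]_n -> 'M[R]_(n, n * n) -> R) :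
    Prop := {
  hyper_ge0 : forall y G, 0 <= H y G ;
  hyper_periodic : forall y G i, H (y + delta_mx 0 i) G = H y G ;
  hyper_continuous :
    continuous (fun z : 'rV[R]_n * 'M[R]_(n, n * n) => H z.1 z.2) ;
  hyper_convex : forall y, convex_function setT (H y) ;
  hyper_differentiable : forall y (G : 'M[R]_(n, n * n)), differentiable (H y) G ;
  hyper_C1 : continuous
    (fun z : 'rV[R]_n * 'M[R]_(n, n * n) => mxgrad (H z.1) z.2) ;
  hyper_lower : forall y G, c0 * frob G `^ p <= H y G ;
  hyper_upper : forall y G, H y G <= C0 * (1 + frob G `^ p) ;
  hyper_gradient : forall y G,
    frob (mxgrad (H y) G) <= C0 * frob G `^ (p - 1)
}.

Variables (W : 'rV[R]_n -> 'M[R]_n -> R).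
Variables (H : 'rV[R]_n -> 'M[R]_(n, n * n) -> R).

(* Extension of W by +oo off positive determinants. The weak gradient of an
   admissible deformation has positive determinant a.e., so this only prevents
   junk values on a null set. *)
Definition elastic_density y F : \bar R :=
  if 0 < \det F then (W y F)%:E else +oo%E.

Definition mechanical_energy (eps : R) (U : set 'rV[R]_n)
    (v : 'rV[R]_n -> 'rV[R]_n) : \bar R :=
  (\int[leb]_(x in U) (elastic_density (eps^-1 *: x) (vgrad U v x) +
                       (H (eps^-1 *: x) (vhess U v x))%:E))%E.

Definition admissible (U GD : set 'rV[R]_n) (v : 'rV[R]_n -> 'rV[R]_n) :
    Prop :=
  [/\ forall i, W2 p U (coordf v i),
      equal_on_boundary U (dirichlet_part U GD) v id &
      grad_everywhere U v (fun F => 0 < \det F)].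

Definition energy_sublevel (M eps : R) (U GD : set 'rV[R]_n)
    (v : 'rV[R]_n -> 'rV[R]_n) : Prop :=
  admissible U GD v /\ (mechanical_energy eps U v <= M%:E)%E.

End energies.

Section extension.
Context {R : realType} {n : nat}.

(* E k is an operator on classes of functions modulo a.e. equality, from the
   k-th set U k to V. *)
Record extension_operator (p : R) (eps : nat -> R) (U : nat -> set 'rV[R]_n)
    (V : set 'rV[R]_n) (E : nat -> ('rV[R]_n -> R) -> 'rV[R]_n -> R) :
    Prop := {
  ext_ae : forall k s u w, 1 <= s -> W1 s (U k) u -> W1 s (U k) w ->
    {ae leb, forall x, U k x -> u x = w x} ->
    {ae leb, forall x, V x -> E k u x = E k w x} ;
  ext_linear : forall k s u w c, 1 <= s -> W1 s (U k) u -> W1 s (U k) w ->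
    {ae leb, forall x, V x ->
       E k (fun z => c * u z + w z) x = c * E k u x + E k w x} ;
  ext_extends : forall k s u, 1 <= s -> W1 s (U k) u ->
    {ae leb, forall x, U k x -> E k u x = u x} ;
  ext_W2 : forall k u, W2 p (U k) u -> W2 p V (E k u) ;
  ext_W1 : forall k s u, 1 <= s -> W1 s (U k) u -> W1 s V (E k u) ;
  ext_W2_bounds : exists C : R, forall k u, W2 p (U k) u ->
    [/\ (Lpnorm p V (E k u) <=
           C%:E * (Lpnorm p (U k) u +
                   (eps k)%:E *
                   Lpnorm p (U k) (fun x => frob (wgrad (U k) u x))))%E,
        (Lpnorm p V (fun x => frob (wgrad V (E k u) x)) <=
           C%:E * Lpnorm p (U k) (fun x => frob (wgrad (U k) u x)))%E &
        (Lpnorm p V (fun x => frob (whess V (E k u) x)) <=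
           C%:E * Lpnorm p (U k) (fun x => frob (whess (U k) u x)))%E] ;
  ext_W1_bounds : forall s, 1 <= s -> exists C : R, forall k u,
    W1 s (U k) u ->
    (Lpnorm s V (E k u) <= C%:E * W1norm s (U k) u)%E /\
    (Lpnorm s V (fun x => frob (wgrad V (E k u) x)) <=
       C%:E * Lpnorm s (U k) (fun x => frob (wgrad (U k) u x)))%E
}.

Definition extend_componentwise (E : ('rV[R]_n -> R) -> 'rV[R]_n -> R)
    (v : 'rV[R]_n -> 'rV[R]_n) : 'rV[R]_n -> 'rV[R]_n :=
  fun x => \row_i E (coordf v i) x.

End extension.

(* Main.v *)
(* Let e = 1 - n/p. The energy controls the Hessian of v, hence that of E v on
   the whole box, and Morrey's inequality on the box makes the gradient of E v
   e-Hoelder with a constant independent of eps. The energy also bounds this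
   gradient at some point, hence everywhere, so its determinant is uniformly
   e-Hoelder. If det (grad v) is small at a point x of Omega_eps, it is therefore
   at most of order r^e on the annuli r/2 < |y - x| < r for many dyadic radii r,
   and since q e >= n each of these annuli contributes a fixed amount to the
   integral of det^-q, in contradiction with the energy bound. The bound on the
   whole box follows because every point of it is within eps of Omega_eps.

   The annuli must meet Omega_eps in a set of measure at least c r^n. This comes
   from the extension operator itself: applied to a cutoff function equal to 1
   at x and to 0 at a point of Omega_eps at distance r, which exists because
   Omega_eps is connected, it yields a function whose gradient cannot be small,
   by Morrey's inequality.

   Morrey's inequality is proved by duality, without mollification: averages of u
   against product densities prod_i F_i'(x_i), with F_i a smooth step from 0 to
   1, are compared by expanding the difference of two such products into partial
   derivatives of test functions. *)
Require Import Defs.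
From mathcomp Require Import all_boot all_order all_algebra.
From mathcomp Require Import all_classical all_reals all_analysis.
From mathcomp Require Import perm measurable_realfun ring lra.
Set Implicit Arguments.
Unset Strict Implicit.
Unset Printing Implicit Defensive.
Import Order.TTheory GRing.Theory Num.Theory.
Import numFieldNormedType.Exports.
Local Open Scope classical_set_scope.
Local Open Scope ring_scope.

(** * Smooth steps on the real line *)

(** Coercivity acts inside Omega_eps only: nothing is known about the sign of the determinant of the
    extension in the holes, so the contributions of det^-q have to be collected in Omega_eps. A
    lower bound, uniform in eps, for the measure of Omega_eps near each of its points is therefore
    indispensable.

    The two exponents match as follows. At scale t, a product density has factors of size 1/t.
    Exchanging one factor leaves n - 1 of them, and Hölder's inequality on a box of side comparable
    to t contributes t^(n (1 - 1/p)); together this is t^(1 - n/p) = t^e. The condition q >= p n /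
    (p - n) says exactly that q e >= n, so that (r^e)^-q r^n >= 1 for r <= 1.

    Weak gradients are arbitrary members of their classes, and the extension operator acts on
    classes. Each pointwise claim thus goes through continuous representatives: on an open set, two
    continuous functions that agree almost everywhere agree everywhere. The representative is built
    as the limit of averages at dyadic scales; that it equals the given function almost everywhere
    is then proved by testing on boxes cut into small cells. *)

Section smooth1.
Context {R : realType}.
Implicit Types (f g : R -> R) (x : R) (k : nat).

(** The derivative is carried as a witness, so that closure under products and composition is an
    induction on k using only the one-step rules. *)
Fixpoint Ck k f : Prop :=
  if k is k'.+1 then exists2 g, (forall x, is_derive x 1 f (g x)) & Ck k' g
  else True.

Definition smooth1 f : Prop := forall k, Ck k f.

Lemma CkW k f : Ck k.+1 f -> Ck k f.
Proof. by elim: k f => [//|k IH] f [g fg /IH Cg]; exists g. Qed.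

Lemma Ck_cst k (c : R) : Ck k (cst c).
Proof.
by elim: k c => [//|k IH] c; exists (cst 0) => // x; exact: is_derive_cst.
Qed.

Lemma Ck_id k : Ck k id.
Proof.
case: k => [//|k]; exists (cst 1) => [x|]; first exact: is_derive_id.
exact: Ck_cst.
Qed.

Lemma CkD k f g : Ck k f -> Ck k g -> Ck k (f + g).
Proof.
elim: k f g => [//|k IH] f g [f' ff Cf] [g' gg Cg]; exists (f' + g').
  by move=> x; exact: is_deriveD.
exact: IH.
Qed.

Lemma CkM k f g : Ck k f -> Ck k g -> Ck k (f * g).
Proof.
elim: k f g => [//|k IH] f g [f' ff Cf] [g' gg Cg].
exists (f * g' + g * f').
  by move=> x; exact: is_deriveM.
by apply: CkD; apply: IH => //; apply: CkW; [exists f'|exists g'].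
Qed.

Lemma Ck_comp k f g : Ck k f -> Ck k g -> Ck k (f \o g).
Proof.
elim: k f g => [//|k IH] f g [f' ff Cf] [g' gg Cg].
exists ((f' \o g) * g').
  by move=> x; exact: is_derive1_comp.
by apply: CkM => //; apply: IH => //; apply: CkW; exists g'.
Qed.

Lemma smooth1_cst (c : R) : smooth1 (cst c).
Proof. by move=> k; exact: Ck_cst. Qed.

Lemma smooth1_id : smooth1 id.
Proof. by move=> k; exact: Ck_id. Qed.

Lemma smooth1D f g : smooth1 f -> smooth1 g -> smooth1 (f + g).
Proof. by move=> sf sg k; exact: CkD. Qed.

Lemma smooth1M f g : smooth1 f -> smooth1 g -> smooth1 (f * g).
Proof. by move=> sf sg k; exact: CkM. Qed.

Lemma smooth1_comp f g : smooth1 f -> smooth1 g -> smooth1 (f \o g).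
Proof. by move=> sf sg k; exact: Ck_comp. Qed.

Lemma smooth1_affine f (a b : R) :
  smooth1 f -> smooth1 (fun x => f (a * x + b)).
Proof.
move=> sf; rewrite (_ : (fun x => _) = f \o (cst a * id + cst b))//.
apply: smooth1_comp => //; apply: smooth1D; last exact: smooth1_cst.
by apply: smooth1M; [exact: smooth1_cst|exact: smooth1_id].
Qed.

Lemma smooth1Z f (a : R) : smooth1 f -> smooth1 (fun x => a * f x).
Proof. by move=> sf; exact: (smooth1M (smooth1_cst a) sf). Qed.

Lemma smooth1B f g : smooth1 f -> smooth1 g -> smooth1 (fun x => f x - g x).
Proof.
move=> sf sg; rewrite (_ : (fun x => _) = f + (fun x => -1 * g x)).
  by apply: smooth1D => //; exact: smooth1Z.
  by apply/funext => x; rewrite -[in LHS]mulN1r.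
Qed.

Lemma smooth1_is_derive f x : smooth1 f -> is_derive x 1 f ((derive1 f) x).
Proof.
move=> /(_ 1%N)[g fg _]; apply: DeriveDef; first by have [] := fg x.
by rewrite derive1E.
Qed.

Lemma smooth1_deriv f : smooth1 f -> smooth1 (derive1 f).
Proof.
move=> sf k; have [g fg Cg] := sf k.+1.
rewrite (_ : (derive1 f) = g)//; apply/funext => x.
by rewrite derive1E; have [_ ->] := fg x.
Qed.

Lemma smooth1_continuous f : smooth1 f -> continuous f.
Proof.
move=> sf x; apply: differentiable_continuous; apply/derivable1_diffP.
by have [] := smooth1_is_derive x sf.
Qed.

(** The flat function exp(-1/x), together with the powers of 1/x that differentiation creates: the
    span of the family is stable under derivation. *)
Definition flat (m : nat) x : R :=
  if 0 < x then (x^-1) ^+ m * expR (- x^-1) else 0.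

Lemma flat_ge0 m x : 0 <= flat m x.
Proof.
rewrite /flat; case: ifPn => // x0.
by rewrite mulr_ge0 ?expR_ge0// exprn_ge0// invr_ge0 ltW.
Qed.

(** One term of the exponential series, exp(y) >= y^(m+2) / (m+2)! with y = 1/x. A quadratic bound
    is what makes the derivative at 0 exist and vanish. *)
Lemma flat_le m x : flat m x <= (m.+2)`!%:R * x ^+ 2.
Proof.
rewrite /flat; case: ifPn => [x0|_]; last by rewrite mulr_ge0// sqr_ge0.
rewrite expRN; have y0 : 0 < x^-1 by rewrite invr_gt0.
have := @expR_ge1Dxn R x^-1 m.+1 (ltW y0).
set y := x^-1 in y0 *; have -> : x ^+ 2 = (y ^+ 2)^-1 by rewrite -exprVn invrK.
move=> h; have {}h : y ^+ m.+2 / (m.+2)`!%:R <= expR y by lra.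
have {}h : y ^+ m.+2 <= (m.+2)`!%:R * expR y.
  by rewrite mulrC -ler_pdivrMr// ltr0n fact_gt0.
rewrite ler_pdivrMr ?expR_gt0// -mulrA [_^-1 * _]mulrC mulrA.
by rewrite ler_pdivlMr ?exprn_gt0// -exprD addn2.
Qed.

Lemma is_derive_flat m x :
  is_derive x 1 (flat m) (flat m.+2 x - m%:R * flat m.+1 x).
Proof.
have [x0|x0|->] := ltgtP x 0.
- have -> : flat m.+2 x - m%:R * flat m.+1 x = 0.
    by rewrite /flat ltNge ltW//= mulr0 subrr.
  have Hd : is_derive x 1 (cst (0:R)) 0 by exact: is_derive_cst.
  apply: near_eq_is_derive Hd; near=> y; rewrite /flat; case: ifPn => // y0.
  have : y < 0 by near: y; exact: lt_nbhsl.
  by rewrite ltNge ltW.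
- have xn0 : x != 0 by rewrite gt_eqF.
  pose h y : R := (y^-1) ^+ m * expR (- y^-1).
  have Hd : is_derive x 1 h (flat m.+2 x - m%:R * flat m.+1 x).
    have inv : is_derive x 1 (fun y : R => y^-1) (- x ^- 2).
      rewrite (_ : - x ^- 2 = - (id x) ^- 2 *: 1); last first.
        by rewrite [RHS]mulr1.
      exact: is_deriveV.
    rewrite (_ : h = ((fun y => y^-1) ^+ m) * (expR \o (- (fun y => y^-1)))) //; last first.
      by apply/funext => y; rewrite /h !fctE.
    apply: is_derive_eq.
    rewrite /flat x0 !fctE /GRing.scale/=.
    case: m {h} => [|m]; rewrite ?mul0r ?expr0/= !exprS; first field => //.
    by field.
  apply: near_eq_is_derive Hd; near=> y; rewrite /flat ifT//; near: y; exact: lt_nbhsr.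
- have -> : flat m.+2 0 - m%:R * flat m.+1 0 = 0.
    by rewrite /flat ltxx mulr0 subrr.
  have f0 : flat m 0 = 0 by rewrite /flat ltxx.
  suff H : h^-1 *: (flat m (h *: 1 + 0) - flat m 0) @[h --> 0^'] --> (0:R).
    by apply: DeriveDef; [exact: (cvgP _ H)|exact: cvg_lim H].
  pose C : R := (m.+2)`!%:R.
  have C0 : (fun h : R => C * `|h|) @ (0:R)^' --> (0:R).
    have h : (fun h : R => `|h|) @ (0:R)^' --> `|0 : R|.
      by apply: cvg_trans (@norm_continuous _ R (0:R)); apply: cvg_app; exact: nbhs_dnbhs.
    by have := cvgMl_tmp h (a := C); rewrite normr0 mulr0; apply.
  apply: (@squeeze_cvgr _ _ _ _ (fun h => - (C * `|h|)) (fun h => C * `|h|)).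
  + near=> h; rewrite -ler_norml f0 subr0 addr0 [h *: 1]mulr1 normrZ.
    rewrite (ger0_norm (flat_ge0 _ _)) normfV ler_pdivrMl; last first.
      by rewrite normr_gt0; near: h; exact: nbhs_dnbhs_neq.
    rewrite mulrCA -expr2 real_normK ?num_real//; exact: flat_le.
  + by have := cvgN C0; rewrite oppr0; apply.
  + exact: C0.
Unshelve. all: by end_near. Qed.

Lemma smooth1_flat m : smooth1 (flat m).
Proof.
move=> k; elim: k m => [//|k IH] m.
exists (fun x => flat m.+2 x - m%:R * flat m.+1 x); first exact: is_derive_flat.
rewrite (_ : (fun x => _) = flat m.+2 + (cst (- m%:R) * flat m.+1)).
  by apply: CkD => //; apply: CkM => //; exact: Ck_cst.
by apply/funext => x; rewrite -mulNr.
Qed.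

Lemma derive1_affine f (a b : R) x : smooth1 f ->
  derive1 (fun x => f (a * x + b)) x = a * derive1 f (a * x + b).
Proof.
move=> sf; have h : is_derive x 1 (fun x : R => a * x + b) a.
  rewrite (_ : (fun x => _) = cst a * id + cst b)//.
  by apply: is_derive_eq; rewrite !fctE /GRing.scale/=; ring.
have := @is_derive1_comp _ _ (fun x => a * x + b) x _ _ (smooth1_is_derive (a * x + b) sf) h.
by move=> [_ dE]; rewrite derive1E mulrC -dE.
Qed.

Lemma derive1_near_cst f (c : R) x :
  (\forall y \near x, f y = c) -> derive1 f x = 0.
Proof.
move=> fc; rewrite derive1E.
have Hd : is_derive x 1 (cst c) (0:R) by exact: is_derive_cst.
suff [_ ->] : is_derive x 1 f 0 by [].
by apply: near_eq_is_derive Hd; near do symmetry.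
Unshelve. all: by end_near. Qed.

Lemma bounded_cst_tails f (a b c d : R) : continuous f ->
  (forall x, x < a -> f x = c) -> (forall x, b < x -> f x = d) ->
  exists2 K : R, 0 < K & forall x, `|f x| <= K.
Proof.
move=> cf fa fb; have [ab|ab] := leP a b; last first.
  have c0 := normr_ge0 c; have d0 := normr_ge0 d.
  exists (1 + `|c| + `|d|) => [|x]; first by lra.
  have [xa|xa] := ltP x a; first by rewrite fa//; lra.
  by rewrite fb ?(lt_le_trans ab xa)//; lra.
have cnf : {within `[a, b], continuous (fun x => `|f x|)}.
  apply: continuous_subspaceT => x; apply: cvg_norm; exact: cf.
have [m _ mM] := EVT_max ab cnf.
have c0 := normr_ge0 c; have d0 := normr_ge0 d; have m0 := normr_ge0 (f m).
exists (1 + `|c| + `|d| + `|f m|) => [|x]; first by lra.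
have [xa|xa] := ltP x a; first by rewrite fa//; lra.
have [xb|xb] := ltP b x; first by rewrite fb//; lra.
have /mM : x \in `[a, b]%R by rewrite in_itv/= xa.
by move=> *; lra.
Qed.

(** Nesting replaces the usual quotient of flat functions: the inner difference is nonpositive for x
    <= 0 and constant for x >= 1. *)
Let smallstep x : R := flat 0 (flat 0 1 - flat 0 (1 - x)).

Let smooth1_smallstep : smooth1 smallstep.
Proof.
rewrite (_ : smallstep = flat 0 \o (cst (flat 0 1) +
    cst (-1) * (fun x => flat 0 (-1 * x + 1)))); last first.
  by apply/funext => x; rewrite /smallstep /= !fctE !mulN1r (addrC 1).
apply: smooth1_comp; first exact: smooth1_flat.
apply: smooth1D; first exact: smooth1_cst.
apply: smooth1M; first exact: smooth1_cst.
exact/smooth1_affine/smooth1_flat.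
Qed.

Let smallstep0 x : x <= 0 -> smallstep x = 0.
Proof.
move=> x0; rewrite /smallstep {1}/flat ifF//; apply/negbTE; rewrite -leNgt.
rewrite subr_le0 /flat ltr01 ifT; last lra.
rewrite !mul1r ler_expR lerN2 lef_pV2 ?posrE; lra.
Qed.

Let smallstep1 x : 1 <= x -> smallstep x = flat 0 (flat 0 1).
Proof.
move=> x1; rewrite /smallstep [flat 0 (1 - x)]/flat ifF ?subr0//.
by apply/negbTE; rewrite -leNgt; lra.
Qed.

Let top_gt0 : 0 < flat 0 (flat 0 1).
Proof.
have flat_gt0 x : 0 < x -> 0 < flat 0 x.
  by move=> x0; rewrite /flat x0 mul1r expR_gt0.
apply: (flat_gt0); apply: (flat_gt0); exact: ltr01.
Qed.

(* A primitive of [step]: multiplying a smooth step by the identity makes both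
   the step [derive1 pstep] and its primitive explicit. *)
Definition pstep x : R :=
  2^-1 * ((2 * x - 2^-1) *
    ((flat 0 (flat 0 1))^-1 * smallstep (2 * x - 2^-1))).

Definition step : R -> R := derive1 pstep.

Lemma smooth1_pstep : smooth1 pstep.
Proof.
apply: smooth1Z; have s := @smooth1_affine
  (fun x => x * ((flat 0 (flat 0 1))^-1 * smallstep x)) 2 (- 2^-1).
apply: s; apply: (smooth1M smooth1_id); exact: smooth1Z.
Qed.

Lemma smooth1_step : smooth1 step.
Proof. exact/smooth1_deriv/smooth1_pstep. Qed.

(** The argument 2 x - 1/2 in [pstep] confines the transition to [1/4, 3/4]. With this margin [step]
    is constant near 0 and near 1, so its derivative vanishes at these two points as well. *)
Lemma pstep_le x : x <= 4^-1 -> pstep x = 0.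
Proof. by move=> x4; rewrite /pstep smallstep0 ?mulr0//; lra. Qed.

Lemma pstep_ge x : 3 / 4 <= x -> pstep x = x - 4^-1.
Proof.
move=> x4; rewrite /pstep smallstep1; last by lra.
by rewrite mulVf ?gt_eqF//; lra.
Qed.

Lemma step_lt x : x < 4^-1 -> step x = 0.
Proof.
move=> x4; apply: (@derive1_near_cst _ 0); near=> y; apply: pstep_le.
by apply: ltW; near: y; exact: lt_nbhsl.
Unshelve. all: by end_near. Qed.

Lemma step_gt x : 3 / 4 < x -> step x = 1.
Proof.
move=> x4; rewrite /step derive1E.
have Hd : is_derive x 1 (fun y : R => y - 4^-1) 1.
  rewrite (_ : (fun y => _) = id + cst (- 4^-1))//.
  by have := is_deriveD (@is_derive_id _ _ x 1) (is_derive_cst (- 4^-1 : R) x (1:R)); rewrite addr0.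
suff [_ ->] : is_derive x 1 pstep 1 by [].
apply: near_eq_is_derive Hd; near=> y; rewrite pstep_ge//.
by apply: ltW; near: y; exact: lt_nbhsr.
Unshelve. all: by end_near. Qed.

Lemma step_le0 x : x <= 0 -> step x = 0.
Proof. by move=> x0; apply: step_lt; lra. Qed.

Lemma step_ge1 x : 1 <= x -> step x = 1.
Proof. by move=> x0; apply: step_gt; lra. Qed.

(** Each of the three functions is continuous and constant outside a compact interval. The constant
    K serves for all steps and densities below; the third bound is meant for [gstep], whose two
    arguments differ by 1. *)
Lemma step_bound : exists2 K : R, 1 <= K & forall x,
  [/\ `|step x| <= K, `|derive1 step x| <= K & `|pstep x - pstep (x - 1)| <= K].
Proof.
have [K1 K10 H1] : exists2 K : R, 0 < K & forall x, `|step x| <= K.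
  apply: (@bounded_cst_tails _ 0 1 0 1).
  - exact/smooth1_continuous/smooth1_step.
  - by move=> x x0; apply: step_le0; exact: ltW.
  - by move=> x x1; apply: step_ge1; exact: ltW.
have [K2 K20 H2] : exists2 K : R, 0 < K & forall x, `|derive1 step x| <= K.
  apply: (@bounded_cst_tails _ 0 1 0 0).
  - exact/smooth1_continuous/smooth1_deriv/smooth1_step.
  - move=> x x0; apply: (@derive1_near_cst _ 0); near=> y; apply: step_le0.
    by apply: ltW; near: y; exact: lt_nbhsl.
  - move=> x x1; apply: (@derive1_near_cst _ 1); near=> y; apply: step_ge1.
    by apply: ltW; near: y; exact: lt_nbhsr.
have [K3 K30 H3] : exists2 K : R, 0 < K & forall x, `|pstep x - pstep (x - 1)| <= K.
  apply: (@bounded_cst_tails _ 0 2 0 1).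
  - apply: smooth1_continuous; apply: smooth1B; first exact: smooth1_pstep.
    have := smooth1_affine 1 (-1) smooth1_pstep.
    by under eq_fun do rewrite mul1r.
  - by move=> x x0; rewrite !pstep_le ?subrr//; lra.
  - by move=> x x2; rewrite !pstep_ge; lra.
exists (1 + K1 + K2 + K3) => [|x]; first by lra.
by have := H1 x; have := H2 x; have := H3 x => *; split; lra.
Unshelve. all: by end_near. Qed.

(** Distribution function of a smooth density of total mass 1 carried by [lo, hi]; the density need
    not be nonnegative. *)
Definition unit_step (lo hi : R) f :=
  [/\ smooth1 f, forall x, x <= lo -> f x = 0 & forall x, hi <= x -> f x = 1].

Lemma unit_step_derive0 (lo hi : R) f x :
  unit_step lo hi f -> x < lo \/ hi < x -> derive1 f x = 0.
Proof.
move=> [sf flo fhi] [xlo|xhi].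
  apply: (@derive1_near_cst _ 0); near=> y; apply: flo; apply: ltW.
  by near: y; exact: lt_nbhsl.
apply: (@derive1_near_cst _ 1); near=> y; apply: fhi; apply: ltW.
by near: y; exact: lt_nbhsr.
Unshelve. all: by end_near. Qed.

Lemma unit_stepW (lo hi lo' hi' : R) f :
  lo' <= lo -> hi <= hi' -> unit_step lo hi f -> unit_step lo' hi' f.
Proof.
move=> lolo hihi [sf flo fhi]; split=> // x h; [apply: flo|apply: fhi].
  exact: le_trans lolo.
exact: le_trans hihi _.
Qed.

Definition hstep (c w : R) x := step (w^-1 * x + - (w^-1 * c)).

Lemma hstep_unit (c w : R) : 0 < w -> unit_step c (c + w) (hstep c w).
Proof.
move=> w0; split; first exact/smooth1_affine/smooth1_step.
  move=> x xc; apply: step_le0; rewrite -mulrBr pmulr_rle0 ?invr_gt0//; lra.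
move=> x xc; apply: step_ge1; rewrite -mulrBr.
by rewrite -ler_pdivrMl ?invr_gt0// invrK; lra.
Qed.

Lemma derive1_hstep (c w : R) x :
  derive1 (hstep c w) x = w^-1 * derive1 step (w^-1 * x + - (w^-1 * c)).
Proof. exact/derive1_affine/smooth1_step. Qed.

(** Its derivative is a difference of two translated steps, divided by w. Such differences telescope
    over j, so the densities of a grid add up to a plateau; the densities of [hstep] have no such
    property. *)
Definition gstep (a w : R) (j : nat) x :=
  pstep (w^-1 * x + - (w^-1 * a + j%:R)) -
  pstep (w^-1 * x + - (w^-1 * a + j.+1%:R)).

Lemma gstep_unit (a w : R) j : 0 < w ->
  unit_step (a + w * j%:R) (a + w * j.+2%:R) (gstep a w j).
Proof.
move=> w0; have wK y z : w^-1 * y - (w^-1 * a + z) = w^-1 * (y - a - w * z).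
  by rewrite !mulrBr mulKf ?gt_eqF// opprD addrA.
have j1 : j.+1%:R = j%:R + 1 :> R by rewrite natr1.
have j2 : j.+2%:R = j%:R + 2 :> R by rewrite -addn2 natrD.
split.
- by apply: smooth1B; exact/smooth1_affine/smooth1_pstep.
- move=> x xc; rewrite /gstep !wK !pstep_le ?subrr//; apply: (@le_trans _ _ 0); rewrite ?invr_ge0//.
    by rewrite pmulr_rle0 ?invr_gt0//; nra.
  by rewrite pmulr_rle0 ?invr_gt0//; lra.
- move=> x xc; rewrite /gstep !wK !pstep_ge.
  + by rewrite -!wK j1; lra.
  + apply: (@le_trans _ _ 1); first lra.
    by rewrite -ler_pdivrMl ?invr_gt0// invrK; nra.
  + apply: (@le_trans _ _ 1); first lra.
    by rewrite -ler_pdivrMl ?invr_gt0// invrK; nra.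
Qed.

Lemma derive1_gstep (a w : R) j x :
  derive1 (gstep a w j) x =
  w^-1 * (step (w^-1 * x + - (w^-1 * a + j%:R)) -
          step (w^-1 * x + - (w^-1 * a + j.+1%:R))).
Proof.
have d (b : R) := smooth1_is_derive x (smooth1_affine w^-1 b smooth1_pstep).
have := is_deriveB (d (- (w^-1 * a + j%:R))) (d (- (w^-1 * a + j.+1%:R))).
move=> [_ dE]; rewrite derive1E [LHS]dE.
by rewrite !derive1_affine ?mulrBr//; exact: smooth1_pstep.
Qed.

End smooth1.

(** * Boxes and Lebesgue measure *)

Section rV_norm.
Context {R : realType} {n : nat}.
Implicit Types (x y : 'rV[R]_n) (r : R).

Lemma rV_norm_coord x i : `|x 0 i| <= `|x|.
Proof.
rewrite [`|x|]mx_normrE; exact: (le_bigmax_cond _ (fun ij => `|x ij.1 ij.2|) (j := (0, i))).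
Qed.

Lemma rV_norm_le x r : 0 <= r -> (forall i, `|x 0 i| <= r) -> `|x| <= r.
Proof.
move=> r0 xr; rewrite [`|x|]mx_normrE; apply/bigmax_leP; split=> // -[i j] _ /=.
by rewrite ord1.
Qed.

Lemma rV_norm_lt x r : 0 < r -> (forall i, `|x 0 i| < r) -> `|x| < r.
Proof.
move=> r0 xr; rewrite [`|x|]mx_normrE; apply/bigmax_ltP; split=> // -[i j] _ /=.
by rewrite ord1.
Qed.

Lemma rV_norm_attained x : 0 < `|x| -> exists i, `|x 0 i| = `|x|.
Proof.
move=> x0; apply: contrapT => /forallNP h.
suff : `|x| < `|x| by rewrite ltxx.
apply: rV_norm_lt => // i; rewrite lt_neqAle rV_norm_coord andbT.
by apply/eqP; exact: h.
Qed.

Lemma rV_nbhs (A : set 'rV[R]_n) x : nbhs x A ->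
  exists2 e : R, 0 < e & forall y, `|x - y| < e -> A y.
Proof.
by move=> /nbhs_ballP[e e0 eA]; exists e => // y xy; apply: eA; rewrite mx_norm_ball.
Qed.

Lemma rV_nbhsI (A : set 'rV[R]_n) x (e : R) : 0 < e ->
  (forall y, `|x - y| < e -> A y) -> nbhs x A.
Proof.
move=> e0 eA; apply/nbhs_ballP; exists e => // y xy; apply: eA.
by rewrite mx_norm_ball in xy.
Qed.

End rV_norm.

Section boxes.
Context {R : realType} {n : nat}.
Implicit Types (a b x y : 'rV[R]_n).

Definition obox a b : set 'rV[R]_n := [set x | forall i, a 0 i < x 0 i < b 0 i].
Definition cbox a b : set 'rV[R]_n := [set x | forall i, a 0 i <= x 0 i <= b 0 i].

Lemma obox_sub a b : obox a b `<=` cbox a b.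
Proof. by move=> x h i; have /andP[h1 h2] := h i; rewrite !ltW. Qed.

Lemma compact_cbox a b : compact (cbox a b).
Proof.
rewrite (_ : cbox a b = [set v | forall i, `[a 0 i, b 0 i]%classic (v ord0 i)]).
  exact: (@rV_compact R n (fun i => `[a 0 i, b 0 i]%classic)
    (fun i => @segment_compact R _ _)).
by apply/seteqP; split=> x h i; have := h i; rewrite /= in_itv.
Qed.

Lemma open_obox a b : open (obox a b).
Proof.
rewrite openE => x xab.
have h (i : 'I_n) : nbhs x [set y : 'rV[R]_n | a 0 i < y 0 i < b 0 i].
  have /andP[ax xb] := xab i.
  have c := @coord_continuous R 1 n 0 i x.
  have h1 : nbhs x [set y : 'rV[R]_n | a 0 i < y 0 i] := c _ (lt_nbhsr ax).
  have h2 : nbhs x [set y : 'rV[R]_n | y 0 i < b 0 i] := c _ (lt_nbhsl xb).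
  by apply: filterS2 h1 h2 => y /= -> ->.
exact: (filter_forall (F := nbhs x)).
Qed.

Lemma measurable_obox a b : measurable (obox a b).
Proof. exact: measurable_rV_box. Qed.

(** Boxes with rational centre and half-width 1/(m+1) form a countable family. Closures inside U are
    required so that locally integrable functions are integrable on each box. *)
Lemma open_boxes (U : set 'rV[R]_n) : open U ->
  exists f : nat -> 'rV[R]_n * 'rV[R]_n, forall x, U x ->
    exists m, [/\ forall i, (f m).1 0 i < (f m).2 0 i, obox (f m).1 (f m).2 x & cbox (f m).1 (f m).2 `<=` U].
Proof.
move=> oU.
pose g (z : 'rV[rat]_n * nat) : 'rV[R]_n * 'rV[R]_n :=
  (\row_i (ratr (z.1 0 i) - z.2.+1%:R^-1), \row_i (ratr (z.1 0 i) + z.2.+1%:R^-1)).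
exists (fun m => oapp g (0, 0) (unpickle m)) => x Ux.
have [e e0 eU] : exists2 e : R, 0 < e & forall y, `|x - y| < e -> U y.
  by apply: rV_nbhs; move: oU; rewrite openE; apply.
have [k ke] : exists k : nat, k.+1%:R^-1 < e / 2.
  have e20 : 0 < e / 2 by rewrite divr_gt0.
  exists (Num.trunc (e / 2)^-1).
  by rewrite -[ltRHS]invrK ltf_pV2 ?posrE ?ltr0n ?invr_gt0// truncnS_gt.
have k0 : 0 < k.+1%:R^-1 :> R by rewrite invr_gt0.
have [d dE] : exists d : R, d = k.+1%:R^-1 by exists k.+1%:R^-1.
rewrite -dE in k0 ke.
have /choice[q xq] : forall i : 'I_n, exists q : rat, `|x 0 i - ratr q| < d.
  move=> i; have [|q] := @rat_in_itvoo R (x 0 i - d) (x 0 i + d).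
    by lra.
  by rewrite in_itv/= => /andP[q1 q2]; exists q; rewrite ltr_norml; lra.
exists (pickle ((\row_i q i, k) : 'rV[rat]_n * nat)).
rewrite pickleK /= -dE; split.
- by move=> i; rewrite !mxE; lra.
- by move=> i; rewrite !mxE; have := xq i; rewrite ltr_norml => h; lra.
- move=> y yb; apply: eU; apply: rV_norm_lt => // i; rewrite !mxE.
  have := xq i; have := yb i; rewrite !mxE ltr_norml => h1 h2; rewrite ltr_norml.
  lra.
Qed.

Lemma rV_open_measurable (U : set 'rV[R]_n) : open U -> measurable U.
Proof.
move=> oU; have [f fU] := open_boxes oU.
rewrite (_ : U = \bigcup_(m in [set m | cbox (f m).1 (f m).2 `<=` U]) obox (f m).1 (f m).2).
  apply: bigcup_measurable => m _; exact: measurable_obox.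
apply/seteqP; split => [x /fU[m [_ xm mU]]|x [m mU /obox_sub/mU]//].
by exists m.
Qed.

Lemma rV_closed_measurable (U : set 'rV[R]_n) : closed U -> measurable U.
Proof.
by move=> /closed_openC/rV_open_measurable/measurableC; rewrite setCK.
Qed.

Lemma measurable_cbox a b : measurable (cbox a b).
Proof.
apply: rV_closed_measurable; apply: compact_closed; last exact: compact_cbox.
exact: norm_hausdorff.
Qed.

Lemma rV_within_measurable (U : set 'rV[R]_n) (f : 'rV[R]_n -> R) :
  measurable U -> {within U, continuous f} -> measurable_fun U f.
Proof.
move=> mU /continuousP cf; apply: (measurability _ (RGenOpens.measurableE R)).
move=> _ [_ [a [b ->] <-]]; have ocf := cf `]a, b[%classic (@interval_open R _ _ _ _).
have /open_subspaceP [V oV VD] := ocf isT isT.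
by rewrite setIC -VD; apply: measurableI => //; exact: rV_open_measurable.
Qed.

Lemma rV_continuous_measurable (U : set 'rV[R]_n) (f : 'rV[R]_n -> R) :
  measurable U -> continuous f -> measurable_fun U f.
Proof.
by move=> mU cf; apply: rV_within_measurable => //; exact: continuous_subspaceT.
Qed.

Lemma leb_obox_lty a b : (leb (obox a b) < +oo)%E.
Proof.
have [ab|/existsNP[i]] := pselect (forall i, a 0 i <= b 0 i).
  by rewrite leb_box// ltry.
move=> /negP; rewrite -ltNge => ba.
rewrite (_ : obox a b = set0) ?measure0//.
by apply/seteqP; split=> // x /(_ i)/andP[h1 h2]; lra.
Qed.

Lemma leb_cbox_lty a b : (leb (cbox a b) < +oo)%E.
Proof.
apply: le_lt_trans (leb_obox_lty (a - const_mx 1) (b + const_mx 1)).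
apply: le_measure; rewrite ?inE; [exact: measurable_cbox|exact: measurable_obox|].
by move=> x h i; have := h i; rewrite !mxE; lra.
Qed.

(** The closed box is enlarged by l/2 on every side into an open one, whose volume is known; this
    explains the factor 2. *)
Lemma leb_cbox_le a b (l : R) : 0 < l -> (forall i, b 0 i - a 0 i <= l) ->
  (leb (cbox a b) <= ((2 * l) ^+ n)%:E)%E.
Proof.
move=> l0 abl; have [ab|/existsNP[i]] := pselect (forall i, a 0 i <= b 0 i); last first.
  move=> /negP; rewrite -ltNge => ba.
  rewrite (_ : cbox a b = set0) ?measure0//; first by rewrite lee_fin exprn_ge0//; lra.
  by apply/seteqP; split=> // x /(_ i)/andP[h1 h2]; lra.
apply: (@le_trans _ _ (leb (obox (a - const_mx (l / 2)) (b + const_mx (l / 2))))).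
  apply: le_measure; rewrite ?inE; [exact: measurable_cbox|exact: measurable_obox|].
  by move=> x h i; have := h i; rewrite !mxE; lra.
rewrite leb_box; last by move=> i; rewrite !mxE; have := ab i; lra.
rewrite lee_fin -[X in _ ^+ X](card_ord n) -prodr_const; apply: ler_prod => i _.
by rewrite !mxE; have := abl i; have := ab i; lra.
Qed.

End boxes.

(** * Product test functions *)

Section rV_fubini.
Context {R : realType}.

Lemma rV_continuous (T : topologicalType) n (f : T -> 'rV[R]_n) :
  (forall i, continuous (fun x => f x 0 i : R)) -> continuous f.
Proof.
move=> cf x A /rV_nbhs[e e0 eA].
have : nbhs x [set y | forall i, `|f x 0 i - f y 0 i| < e].
  apply: (@filter_forall _ _ (fun i (y : T) => `|f x 0 i - f y 0 i| < e) (nbhs x)) => i.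
  by have /cvgrPdist_lt/(_ _ e0) := cf i x.
apply: filterS => y h /=; apply: eA; apply: rV_norm_lt => // i.
by rewrite !mxE; exact: h.
Qed.

Lemma continuous_rV_consl n (y : 'rV[R]_n) : continuous (fun t : R => rV_cons (t, y)).
Proof.
apply: rV_continuous => i; under eq_fun do rewrite rV_consE.
by case: unliftP => [j _|_] /=; [exact: cst_continuous|by move=> z; exact: cvg_id].
Qed.

Lemma continuous_rV_consr n (t : R) : continuous (fun y : 'rV[R]_n => rV_cons (t, y)).
Proof.
apply: rV_continuous => i; under eq_fun do rewrite rV_consE.
case: unliftP => [j _|_] /=; last exact: cst_continuous.
exact: coord_continuous.
Qed.

Lemma integrable_rV_cons n (f : 'rV[R]_n.+1 -> \bar R) :
  leb.-integrable setT f ->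
  ((@lebesgue_measure R) \x (leb : set 'rV[R]_n -> \bar R))%E.-integrable setT
    (f \o @rV_cons R n).
Proof.
move=> /integrableP[mf foo]; apply/integrableP; split.
  exact: measurableT_comp mf (@measurable_rV_cons R n).
move: foo; rewrite /= /leb_cons ge0_integral_pushforward//=.
- exact: measurable_rV_cons.
- exact: measurableT_comp.
Qed.

Lemma integral_rV_cons n (f : 'rV[R]_n.+1 -> \bar R) :
  leb.-integrable setT f ->
  (\int[leb]_x f x =
   \int[@lebesgue_measure R]_t \int[leb]_y f (rV_cons (t, y)))%E.
Proof.
move=> fi; have fci := integrable_rV_cons fi.
have mf := measurable_int _ fi.
rewrite /= /leb_cons integral_pushforward//=; last exact: measurable_rV_cons.
by rewrite preimage_setT -(integral12_prod_meas1 fci).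
Qed.

Lemma integral_rV_cons_swap n (f : 'rV[R]_n.+1 -> \bar R) :
  leb.-integrable setT f ->
  (\int[leb]_x f x =
   \int[leb]_y \int[@lebesgue_measure R]_t f (rV_cons (t, y)))%E.
Proof.
move=> fi; have fci := integrable_rV_cons fi.
have mf := measurable_int _ fi.
rewrite /= /leb_cons integral_pushforward//=; last exact: measurable_rV_cons.
by rewrite preimage_setT -(integral21_prod_meas1 fci).
Qed.

Lemma integral_line (F f : R -> R) (B : R) : 0 < B ->
  (forall t : R, is_derive t 1 F (f t)) -> continuous f ->
  (forall t, B <= `|t| -> f t = 0) ->
  (\int[@lebesgue_measure R]_t (f t)%:E = (F B - F (- B))%:E)%E.
Proof.
move=> B0 dF cf f0.
have cF : continuous F.
  by move=> t; apply/differentiable_continuous/derivable1_diffP; have [] := dF t.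
have BB : - B < B by lra.
have <- : (\int[@lebesgue_measure R]_(t in `[(- B)%R, B]) (f t)%:E = (F B - F (- B))%:E)%E.
  rewrite (@continuous_FTC2 R f F)//.
  - exact: continuous_subspaceT.
  - split.
    + by move=> t _; have [] := dF t.
    + by apply: cvg_at_right_filter; exact: cF.
    + by apply: cvg_at_left_filter; exact: cF.
  - by move=> t _; rewrite derive1E; have [_ ->] := dF t.
rewrite [RHS]integral_mkcond; apply: eq_integral => t _; rewrite patchE.
case: ifPn => // /negP; rewrite inE/= in_itv/= => /negP tB.
by rewrite f0//; move: tB; rewrite -ler_norml -ltNge; exact: ltW.
Qed.

Lemma integrable_line (f : R -> R) (B : R) : continuous f ->
  (forall t, B <= `|t| -> f t = 0) ->
  (@lebesgue_measure R).-integrable setT (EFin \o f).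
Proof.
move=> cf f0; have -> : f = f \_ `[- B, B].
  apply/funext => t; rewrite patchE; case: ifPn => // /negP; rewrite inE/= in_itv/=.
  by move=> /negP; rewrite -ler_norml -ltNge => /ltW/f0.
have mI : measurable (`[- B, B]%classic : set (measurableTypeR R)) by exact: measurable_itv.
rewrite -restrict_EFin; apply/(integrable_mkcond _ mI).
exact: (@continuous_compact_integrable R f _ (@segment_compact _ _ _) (continuous_subspaceT cf)).
Qed.

(** Vanishing outside a cube, phrased by coordinates so that it passes to slices. *)
Definition supp_in n (B : R) (f : 'rV[R]_n -> R) :=
  forall x : 'rV[R]_n, (exists i, B <= `|x 0 i|) -> f x = 0.

Lemma integrable_cs n (B : R) (f : 'rV[R]_n -> R) : continuous f ->
  supp_in B f -> leb.-integrable setT (EFin \o f).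
Proof.
move=> cf fB; pose K : set 'rV[R]_n := cbox (const_mx (- B)) (const_mx B).
have -> : f = f \_ K.
  apply/funext => x; rewrite patchE; case: ifPn => // /negP; rewrite inE => xK.
  apply: fB; apply: contrapT => /forallNP h; apply: xK => i; rewrite !mxE -ler_norml.
  by have /negP := h i; rewrite -ltNge; exact: ltW.
have mK : measurable K by exact: measurable_cbox.
rewrite -restrict_EFin; apply/(integrable_mkcond _ mK).
apply: measurable_bounded_integrable => //; first exact: leb_cbox_lty.
  exact: rV_continuous_measurable.
have cK : compact K by exact: compact_cbox.
have /compact_bounded[M [_ mrt]] := continuous_compact (continuous_subspaceT cf) cK.
by exists M; split; rewrite ?num_real // => ? ? ? ?; exact: mrt.
Qed.

(** A directional derivative sees only the restriction to a line, so it can be transported between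
    spaces of different dimensions. *)
Lemma is_derive_reparam (V V' : normedModType R) (f : V -> R) (g : V' -> R)
    (x v : V) (y w : V') (d : R) :
  (forall h : R, g (h *: w + y) = f (h *: v + x)) ->
  is_derive x v f d -> is_derive y w g d.
Proof.
move=> gf [fv fd].
have g0 : g y = f x by have := gf 0; rewrite !scale0r !add0r.
have E : (fun h : R => h^-1 *: (g (h *: w + y) - g y)) =
         (fun h : R => h^-1 *: (f (h *: v + x) - f x)).
  by apply/funext => h; rewrite gf g0.
split; first by rewrite /derivable E.
by rewrite -fd /derive E.
Qed.

Lemma rV_consD n (h t : R) (y w : 'rV[R]_n) :
  rV_cons (t, h *: w + y) = h *: rV_cons (0, w) + rV_cons (t, y).
Proof.
apply/rowP => i; rewrite [RHS]mxE [X in _ = X + _]mxE !rV_consE.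
case: unliftP => [j _|_] /=.
  by rewrite !mxE.
by rewrite mulr0 add0r.
Qed.

Lemma rV_cons_delta n (j : 'I_n) :
  rV_cons (0 : R, delta_mx 0 j) = delta_mx 0 (lift 0 j).
Proof.
apply/rowP => i; rewrite [RHS]mxE rV_consE; case: unliftP => [k ->|->] /=.
  by rewrite !mxE (inj_eq lift_inj).
by [].
Qed.

(* Integrating out the other coordinates first reduces this to the fundamental
   theorem of calculus on a line. *)
Lemma integral_pderiv0 n (i : 'I_n) (B : R) (F f : 'rV[R]_n -> R) : 0 < B ->
  (forall x, is_derive x (delta_mx 0 i) F (f x)) -> continuous f ->
  supp_in B F -> supp_in B f -> (\int[leb]_x (f x)%:E = 0)%E.
Proof.
move=> B0; elim: n i F f => [[]//|n IH] i F f dF cf FB fB.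
have fi := integrable_cs cf fB.
case: (unliftP 0 i) dF => [j ->|->] dF.
  rewrite integral_rV_cons//; apply: integral0_eq => t _.
  apply: (IH j (fun y => F (rV_cons (t, y)))) => //.
  - move=> y; apply: is_derive_reparam (dF (rV_cons (t, y))) => h.
    by rewrite rV_consD rV_cons_delta.
  - move=> y; apply: (@continuous_comp _ _ _ (fun y => rV_cons (t, y)) f).
      exact: continuous_rV_consr.
    exact: cf.
  - by move=> y [k yk]; apply: FB; exists (lift 0 k); rewrite rV_consE liftK.
  - by move=> y [k yk]; apply: fB; exists (lift 0 k); rewrite rV_consE liftK.
rewrite integral_rV_cons_swap//; apply: integral0_eq => y _.
have dl (t : R) : is_derive t 1 (fun t : R => F (rV_cons (t, y))) (f (rV_cons (t, y))).
  apply: is_derive_reparam (dF (rV_cons (t, y))) => h; congr F.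
  apply/rowP => k; rewrite [RHS]mxE [X in _ = X + _]mxE [X in _ = _ * X + _]mxE !rV_consE.
  case: unliftP => [l ->|->] /=; last by [].
  by rewrite mulr0 add0r.
rewrite (integral_line B0 dl).
- have F0 t : B <= `|t| -> F (rV_cons (t, y)) = 0.
    by move=> tB; apply: FB; exists 0; rewrite rV_consE unlift_none.
  by rewrite !F0 ?subrr// ?normrN ler_norm.
- move=> t; apply: (@continuous_comp _ _ _ (fun t => rV_cons (t, y)) f).
    exact: continuous_rV_consl.
  exact: cf.
- by move=> t tB; apply: fB; exists 0; rewrite rV_consE unlift_none.
Qed.

Definition tensor n (f : 'I_n -> R -> R) (x : 'rV[R]_n) : R := \prod_i f i (x 0 i).

Lemma differentiable_tensor n (f : 'I_n -> R -> R) x :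
  (forall i, smooth1 (f i)) -> differentiable (tensor f) x.
Proof.
move=> sf; rewrite /tensor; elim: (index_enum _) => [|i s IH].
  by under eq_fun do rewrite big_nil; exact: differentiable_cst.
under eq_fun do rewrite big_cons.
apply: differentiableM IH.
apply: (@differentiable_comp _ _ _ _ (fun x : 'rV[R]_n => x 0 i) (f i)).
  exact: differentiable_coord.
by apply/derivable1_diffP; have [] := smooth1_is_derive (x 0 i) (sf i).
Qed.

Lemma continuous_tensor n (f : 'I_n -> R -> R) :
  (forall i, smooth1 (f i)) -> continuous (tensor f).
Proof. by move=> sf x; apply: differentiable_continuous; exact: differentiable_tensor. Qed.

(** Partial derivatives of a tensor are again tensors; smoothness is then an induction on the list
    of derivatives. *)
Definition dtens n (f : 'I_n -> R -> R) (i : 'I_n) : 'I_n -> R -> R :=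
  fun j => if j == i then derive1 (f j) else f j.

Lemma smooth1_dtens n (f : 'I_n -> R -> R) i :
  (forall j, smooth1 (f j)) -> forall j, smooth1 (dtens f i j).
Proof.
by move=> sf j; rewrite /dtens; case: ifP => // _; exact: smooth1_deriv.
Qed.

Lemma is_derive_tensor n (f : 'I_n -> R -> R) i (x : 'rV[R]_n) :
  (forall j, smooth1 (f j)) ->
  is_derive x (delta_mx 0 i) (tensor f) (tensor (dtens f i) x).
Proof.
move=> sf; pose c := \prod_(j | j != i) f j (x 0 j).
have d : is_derive (x 0 i) 1 (f i * cst c) (tensor (dtens f i) x).
  have df := smooth1_is_derive (x 0 i) (sf i).
  apply: is_derive_eq; rewrite scaler0 add0r /tensor (bigD1 i)//= /dtens eqxx.
  rewrite [LHS]mulrC; congr (_ * _); apply: eq_bigr => j ji.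
  by rewrite (negbTE ji).
apply: is_derive_reparam d => h; rewrite /tensor (bigD1 i)//=.
rewrite !mxE !eqxx/=; congr (_ * _); apply: eq_bigr => j ji.
by rewrite !mxE (negbTE ji) andbF mulr0 add0r.
Qed.

Lemma pderiv_tensor n (f : 'I_n -> R -> R) i :
  (forall j, smooth1 (f j)) -> pderiv i (tensor f) = tensor (dtens f i).
Proof. by move=> sf; apply/funext => x; have [] := is_derive_tensor i x sf. Qed.

Lemma smooth_tensor n (f : 'I_n -> R -> R) :
  (forall j, smooth1 (f j)) -> smooth (tensor f).
Proof.
move=> sf l x.
suff [g sg ->] : exists2 g : 'I_n -> R -> R, (forall j, smooth1 (g j)) &
    foldr pderiv (tensor f) l = tensor g by exact: differentiable_tensor.
elim: l => [|i l [g sg gE]]; first by exists f.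
exists (dtens g i); first exact: smooth1_dtens.
by rewrite /= gE pderiv_tensor.
Qed.

Lemma tensor_eq0 n (f : 'I_n -> R -> R) (x : 'rV[R]_n) i :
  f i (x 0 i) = 0 -> tensor f x = 0.
Proof. by move=> fi; rewrite /tensor (bigD1 i)//= fi mul0r. Qed.

Lemma test_tensor n (f : 'I_n -> R -> R) (U : set 'rV[R]_n) (a b : 'rV[R]_n) :
  (forall j, smooth1 (f j)) ->
  (forall j t, t < a 0 j \/ b 0 j < t -> f j t = 0) -> cbox a b `<=` U ->
  test_function U (tensor f) /\ (forall x, ~ cbox a b x -> tensor f x = 0).
Proof.
move=> sf f0 abU.
have H x : ~ cbox a b x -> tensor f x = 0.
  move=> /existsNP[i /negP]; rewrite negb_and -!ltNge => h.
  by apply: (@tensor_eq0 _ _ _ i); apply: f0; exact/orP.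
split=> //; split; first exact: smooth_tensor.
by exists (cbox a b); split => //; exact: compact_cbox.
Qed.

Lemma integral_tensor n (B : R) (F : 'I_n -> R -> R) : 0 < B ->
  (forall i, smooth1 (F i)) ->
  (forall i t, B <= `|t| -> derive1 (F i) t = 0) ->
  (\int[leb]_x (tensor (fun i => derive1 (F i)) x)%:E =
   (\prod_i (F i B - F i (- B)))%:E)%E.
Proof.
move=> B0; elim: n F => [|n IH] F sF F0.
  under eq_integral do rewrite /tensor big_ord0.
  by rewrite big_ord0 integral_cst//= diracE mem_set//= mul1e.
have sF' i : smooth1 (derive1 (F i)) by exact: smooth1_deriv.
rewrite integral_rV_cons; last first.
  apply: (@integrable_cs _ B).
    exact: continuous_tensor.
  by move=> x [i xi]; apply: (@tensor_eq0 _ _ _ i); exact: F0.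
have E t (y : 'rV[R]_n) : tensor (fun i => derive1 (F i)) (rV_cons (t, y)) =
    derive1 (F 0) t * tensor (fun i => derive1 (F (lift 0 i))) y.
  rewrite /tensor big_ord_recl rV_consE unlift_none; congr (_ * _).
  by apply: eq_bigr => i _; rewrite rV_consE liftK.
under eq_integral => t _.
  under eq_integral do rewrite E EFinM.
  rewrite integralZl//; last first.
    apply: (@integrable_cs _ B).
      by apply: continuous_tensor => i; exact: sF'.
    by move=> x [i xi]; apply: (@tensor_eq0 _ _ _ i); exact: F0.
  rewrite (IH (fun i => F (lift 0 i)))//; last by move=> i; exact: F0.
  over.
rewrite big_ord_recl EFinM -(integral_line B0 (fun t => smooth1_is_derive t (sF 0))); last 2 first.
  exact: smooth1_continuous.
  by move=> t; exact: F0.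
rewrite integralZr//; apply: (@integrable_line _ B); last exact: F0.
exact: smooth1_continuous.
Qed.

End rV_fubini.

(** * The fundamental lemma of the calculus of variations *)

Section box_sigma.
Context {R : realType} {n : nat}.

(** A slab in one coordinate is the increasing union of the boxes bounded by m in the others, so
    each coordinate is measurable for the sigma-algebra of boxes. *)
Lemma rV_box_sigma (A : set 'rV[R]_n) : measurable A ->
  <<s [set B | exists a b, B = obox a b] >> A.
Proof.
pose G := [set B : set 'rV[R]_n | exists a b, B = obox a b].
move=> mA.
have := @measurable_fun_rV R n _ (g_sigma_algebraType G) id.
move=> /(_ _ measurableT A mA); rewrite setTI preimage_id; apply => i.
apply: (measurability _ (RGenOpens.measurableE R)).
move=> _ [_ [s [t ->] <-]]; rewrite setTI.
rewrite (_ : _ @^-1` _ = \bigcup_m obox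
    (\row_j (if j == i then s else - m%:R))
    (\row_j (if j == i then t else m%:R))); last first.
  apply/seteqP; split=> [x /=|x [m _] /(_ i)].
    rewrite in_itv/= => sxt; exists (Num.trunc `|x|).+1 => // j; rewrite !mxE.
    case: eqP => [->//|_]; rewrite -ltr_norml.
    by apply: le_lt_trans (rV_norm_coord x j) _; exact: truncnS_gt.
  by rewrite !mxE eqxx /= in_itv.
by apply: bigcupT_measurable => m; apply: sub_sigma_algebra; do 2 eexists.
Qed.

Lemma oboxI (a b c d : 'rV[R]_n) : obox a b `&` obox c d =
  obox (\row_i Num.max (a 0 i) (c 0 i)) (\row_i Num.min (b 0 i) (d 0 i)).
Proof.
apply/seteqP; split=> x /=.
  by move=> [h1 h2] i; rewrite !mxE gt_max lt_min; have /andP[-> ->] := h1 i; have /andP[-> ->] := h2 i.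
move=> h; split=> i; have := h i; rewrite !mxE gt_max lt_min.
  by move=> /andP[/andP[-> _] /andP[-> _]].
by move=> /andP[/andP[_ ->] /andP[_ ->]].
Qed.

End box_sigma.

Section loc_integrable.
Context {R : realType} {n : nat}.
Implicit Types (U K : set 'rV[R]_n) (u w phi : 'rV[R]_n -> R).

Lemma measurable_compact K : compact K -> measurable K.
Proof.
by move=> cK; apply: rV_closed_measurable; exact: compact_closed.
Qed.

Lemma loc_integrable_compact U u K :
  loc_integrable U u -> compact K -> K `<=` U -> measurable U ->
  leb.-integrable K (EFin \o u).
Proof.
move=> [mu lu] cK KU mU; apply/integrableP; split; last exact: lu.
by apply/measurable_EFinP; exact: measurable_funS mu.
Qed.

Lemma integrable_mul_cs U u K phi (M : R) :
  measurable U -> loc_integrable U u -> compact K -> K `<=` U ->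
  measurable_fun setT phi -> (forall x, `|phi x| <= M) ->
  (forall x, ~ K x -> phi x = 0) ->
  leb.-integrable setT (EFin \o (fun x => u x * phi x)).
Proof.
move=> mU lu cK KU mphi phiM phi0.
have mK := measurable_compact cK.
have iK := loc_integrable_compact lu cK KU mU.
have -> : (fun x => u x * phi x) = (fun x => u x * phi x) \_ K.
  apply/funext => x; rewrite patchE; case: ifPn => // /negP; rewrite inE => xK.
  by rewrite phi0// mulr0.
rewrite -restrict_EFin; apply/(integrable_mkcond _ mK).
apply: (@le_integrable _ _ _ leb K mK _ (fun x => M%:E * (u x)%:E)%E).
- apply/measurable_EFinP; apply: measurable_funM.
    by have [mu _] := lu; exact: measurable_funS mu.
  exact: measurable_funTS.
- move=> x Kx; rewrite -EFinM !abse_EFin lee_fin !normrM mulrC.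
  by apply: ler_wpM2r => //; apply: le_trans (phiM x) (ler_norm _).
- exact: integrableZl.
Qed.

Lemma Rintegral_cs U K (f : 'rV[R]_n -> R) : K `<=` U ->
  (forall x, ~ K x -> f x = 0) ->
  \int[leb]_(x in U) f x = \int[leb]_(x in K) f x.
Proof.
move=> KU f0; rewrite [LHS]Rintegral_mkcond [RHS]Rintegral_mkcond.
congr (Rintegral _ _ _); apply/funext => x; rewrite !patchE.
have [xK|xK] := pselect (K x); first by rewrite !mem_set//; exact: KU.
by rewrite f0// !if_same.
Qed.

Lemma bounded_cs K phi : compact K -> continuous phi ->
  (forall x, ~ K x -> phi x = 0) -> exists M, forall x, `|phi x| <= M.
Proof.
move=> cK cphi phi0.
have /compact_bounded[M [_ mrt]] := continuous_compact (continuous_subspaceT cphi) cK.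
exists (Num.max (M + 1) 0) => x; rewrite le_max.
have [xK|xK] := pselect (K x); last by rewrite phi0// normr0 lexx orbT.
by rewrite (mrt (M + 1)) ?ltrDl//; exists x.
Qed.

(* Dynkin's lemma: the sets on which the integral of [w] vanishes form a
   lambda-system containing the boxes. *)
Lemma box_integral0_ae U w : open U -> loc_integrable U w ->
  (forall a b : 'rV[R]_n, (forall i, a 0 i < b 0 i) -> cbox a b `<=` U ->
    \int[leb]_(x in obox a b) w x = 0) ->
  {ae leb, forall x, U x -> w x = 0}.
Proof.
move=> oU lw w0; have mU := rV_open_measurable oU.
have box_ae a b : cbox a b `<=` U -> ae_eq leb (obox a b) (EFin \o w) (cst 0%E).
  move=> abU; set B := obox a b; have mB : measurable B by exact: measurable_obox.
  have iB : leb.-integrable B (EFin \o w).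
    apply: (integrableS _ mB (@obox_sub _ _ _ _)); first exact: measurable_cbox.
    exact: (loc_integrable_compact lw (@compact_cbox _ _ a b) abU mU).
  have ibox c d : (\int[leb]_(x in obox c d `&` B) (w x)%:E = 0)%E.
    rewrite oboxI; set a' := \row_i _; set b' := \row_i _.
    have [ab|/existsNP[i /negP]] := pselect (forall i, a' 0 i < b' 0 i).
      have sub : cbox a' b' `<=` cbox a b.
        move=> x h i; have := h i; rewrite !mxE ge_max le_min.
        by move=> /andP[/andP[_ ->] /andP[_ ->]].
      have I0 := w0 a' b' ab (subset_trans sub abU).
      rewrite -[LHS]fineK; first by rewrite -[X in _ = X]/(0%:E) -I0.
      apply: integrable_fin_num; first exact: measurable_obox.
      apply: (integrableS _ _ _ iB) => //; first exact: measurable_obox.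
      move=> x h i; have := h i; rewrite !mxE gt_max lt_min.
      by move=> /andP[/andP[_ ->] /andP[_ ->]].
    rewrite -leNgt => ba; rewrite (_ : obox _ _ = set0) ?integral_set0//.
    by apply/seteqP; split=> // x /(_ i)/andP[h1 h2]; move: (lt_trans h1 h2); rewrite ltNge ba.
  pose H := [set A : set 'rV[R]_n | measurable A /\ (\int[leb]_(x in A `&` B) (w x)%:E = 0)%E].
  have mw A : A `<=` B -> measurable A -> leb.-integrable A (EFin \o w).
    by move=> AB mA; exact: integrableS iB.
  have IB0 : (\int[leb]_(x in B) (w x)%:E = 0)%E by rewrite -(ibox a b) setIid.
  have HD : dynkin H.
    split.
    - by split => //; rewrite setTI.
    - move=> A [mA A0]; split; first exact: measurableC.
      have mAB : measurable (A `&` B) by exact: measurableI.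
      have mCB : measurable (~` A `&` B) by apply: measurableI => //; exact: measurableC.
      have := @integral_setU _ _ _ leb (A `&` B) (~` A `&` B) (EFin \o w) mAB mCB.
      rewrite -setIUl setUv setTI IB0 A0 add0e => <-//.
        exact: measurable_int iB.
      by apply/disj_setPS => x [[Ax _] [nAx _]].
    - move=> F tF HF; split; first by apply: bigcupT_measurable => k; have [] := HF k.
      rewrite setI_bigcupl integral_bigcup.
      + by apply: eseries0 => k _ _; have [] := HF k.
      + exact: trivIset_setIr.
      + by move=> k; apply: measurableI => //; have [] := HF k.
      + apply: mw; first by move=> x [k _ []].
        by apply: bigcupT_measurable => k; apply: measurableI => //; have [] := HF k.
  have /dynkin_lambda_system HL := HD.
  have GH : [set B | exists a b, B = obox a b] `<=` H.
    by move=> _ [c [d ->]]; split; [exact: measurable_obox|exact: ibox].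
  have GI : setI_closed [set B : set 'rV[R]_n | exists a b, B = obox a b].
    by move=> _ _ [c [d ->]] [e [f ->]]; rewrite oboxI; eexists; eexists.
  apply: integral_ae_eq => // E EB mE.
  have := lambda_system_subset GI HL GH (fun X _ => @subsetT _ X) (rV_box_sigma mE).
  move=> [_]; rewrite setIidl// => ->.
  by rewrite integral0_eq.
(* Countably many boxes with closure in U cover U, so the exceptional sets add up to a null set;
   boxes that stick out of U contribute the empty set. *)
have [f fU] := open_boxes oU.
pose N m : set 'rV[R]_n := if `[< cbox (f m).1 (f m).2 `<=` U >] then
  ~` [set x | obox (f m).1 (f m).2 x -> (EFin \o w) x = cst 0%E x] else set0.
apply: (@negligibleS _ _ _ _ (\bigcup_m N m)).
  move=> x /not_implyP[Ux wx]; have [m [_ xm fmU]] := fU x Ux.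
  by exists m => //; rewrite /N asboolT// => /(_ xm) [wx0].
apply: negligible_bigcup => m; rewrite /N.
by case: ifPn => [/asboolP fmU|_]; [exact: box_ae|exact: negligible_set0].
Qed.

End loc_integrable.

(** * Bumps on a grid of an interval, and their sums *)

Section plateau.
Context {R : realType}.
Implicit Types (a w t : R).

Definition zeta a w (j : nat) t : R :=
  step (w^-1 * t + - (w^-1 * a + j%:R)) - step (w^-1 * t + - (w^-1 * a + j.+1%:R)).

Lemma smooth1_zeta a w j : smooth1 (zeta a w j).
Proof. by apply: smooth1B; exact/smooth1_affine/smooth1_step. Qed.

(** With the mesh w = (b - a) / (N + 1), used below, it vanishes outside (a, b) and equals 1 on
    [a + w, b - w]: N bumps, each two meshes wide, fill N + 1 meshes. *)
Definition plateau a w (N : nat) t : R := \sum_(0 <= j < N) zeta a w j t.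

Lemma plateauE a w N t : plateau a w N t =
  step (w^-1 * t + - (w^-1 * a)) - step (w^-1 * t + - (w^-1 * a + N%:R)).
Proof.
rewrite /plateau /zeta.
pose F (j : nat) := - step (w^-1 * t + - (w^-1 * a + j%:R)).
rewrite (eq_bigr (fun j => F j.+1 - F j)) => [|j _].
  by rewrite telescope_sumr// /F addr0 opprK addrC.
by rewrite /F opprK addrC.
Qed.

Lemma smooth1_plateau a w N : smooth1 (plateau a w N).
Proof.
rewrite (_ : plateau a w N = fun t => step (w^-1 * t + - (w^-1 * a)) -
    step (w^-1 * t + - (w^-1 * a + N%:R))); last first.
  by apply/funext => t; rewrite plateauE.
by apply: smooth1B; exact/smooth1_affine/smooth1_step.
Qed.

Let argE a w t z : 0 < w -> w^-1 * t + - (w^-1 * a + z) = w^-1 * (t - a - w * z).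
Proof. by move=> w0; rewrite !mulrBr mulKf ?gt_eqF// opprD addrA. Qed.

Lemma step_arg_le0 a w t z : 0 < w -> t <= a + w * z ->
  step (w^-1 * t + - (w^-1 * a + z)) = 0.
Proof.
move=> w0 h; rewrite argE//; apply: step_le0.
by rewrite pmulr_rle0 ?invr_gt0//; lra.
Qed.

Lemma step_arg_ge1 a w t z : 0 < w -> a + w * z + w <= t ->
  step (w^-1 * t + - (w^-1 * a + z)) = 1.
Proof.
move=> w0 h; rewrite argE//; apply: step_ge1.
by rewrite -ler_pdivrMl ?invr_gt0// invrK; lra.
Qed.

Lemma zeta_out a w j t : 0 < w -> t <= a + w * j%:R \/ a + w * j.+2%:R <= t ->
  zeta a w j t = 0.
Proof.
have j1 : j.+1%:R = j%:R + 1 :> R by rewrite natr1.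
have j2 : j.+2%:R = j%:R + 2 :> R by rewrite -addn2 natrD.
move=> w0 [h|h]; rewrite /zeta.
  by rewrite !step_arg_le0 ?subrr// j1; nra.
by rewrite !step_arg_ge1 ?subrr// ?j1; move: h; rewrite j2; nra.
Qed.

Lemma plateau_out a w N t : 0 < w -> t <= a \/ a + w * N.+1%:R <= t ->
  plateau a w N t = 0.
Proof.
move=> w0; rewrite plateauE -{1}[w^-1 * a]addr0 => h.
have N0 : 0 <= N%:R :> R by [].
have N1 : N.+1%:R = N%:R + 1 :> R by rewrite natr1.
case: h => h; rewrite ?N1 in h.
  have wN := mulr_ge0 (ltW w0) N0.
  by rewrite !step_arg_le0 ?subrr//; lra.
by rewrite !step_arg_ge1 ?subrr//; nra.
Qed.

Lemma plateau_in a w N t : 0 < w -> a + w <= t <= a + w * N%:R ->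
  plateau a w N t = 1.
Proof.
move=> w0 /andP[h1 h2]; rewrite plateauE -{1}[w^-1 * a]addr0.
have h3 : a + w * 0 + w <= t by lra.
by rewrite (step_arg_ge1 w0 h3) (step_arg_le0 w0 h2) subr0.
Qed.

Lemma plateau_bound : exists2 K : R, 1 <= K & forall a w N t, `|plateau a w N t| <= K.
Proof.
have [K K1 HK] := @step_bound R.
exists (2 * K) => [|a w N t]; first lra.
rewrite plateauE; apply: le_trans (ler_normB _ _) _.
have [h1 _ _] := HK (w^-1 * t + - (w^-1 * a)).
have [h2 _ _] := HK (w^-1 * t + - (w^-1 * a + N%:R)).
by apply: le_trans (lerD h1 h2) _; rewrite mulr_natl mulr2n.
Qed.

End plateau.

Section test_functions.
Context {R : realType} {n : nat}.
Implicit Types (U V K : set 'rV[R]_n) (u w g phi : 'rV[R]_n -> R).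

Lemma test_functionW U V phi : U `<=` V -> test_function U phi -> test_function V phi.
Proof.
move=> UV [sphi [K [cK KU K0]]]; split=> //; exists K; split=> //.
exact: subset_trans UV.
Qed.

Lemma smooth_cont phi : smooth phi -> continuous phi.
Proof. by move=> sphi x; apply: differentiable_continuous; exact: (sphi [::]). Qed.

Lemma smooth_pderiv phi i : smooth phi -> smooth (pderiv i phi).
Proof. by move=> sphi l x; have := sphi (rcons l i) x; rewrite foldr_rcons. Qed.

Lemma pderiv_out K phi i : compact K -> (forall x, ~ K x -> phi x = 0) ->
  forall x, ~ K x -> pderiv i phi x = 0.
Proof.
move=> cK phi0 x Kx; rewrite /pderiv.
have cl : closed K by exact: compact_closed.
have nK : nbhs x (~` K) by apply: open_nbhs_nbhs; split => //; exact: closed_openC.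
have d : is_derive x (delta_mx 0 i : 'rV[R]_n) (cst (0 : R)) 0 by exact: is_derive_cst.
suff [_ ->] : is_derive x (delta_mx 0 i) phi 0 by [].
by apply: near_eq_is_derive d; apply: filterS nK => y /phi0 ->.
Qed.

Lemma test_integrable U u phi : measurable U -> loc_integrable U u ->
  test_function U phi -> leb.-integrable U (EFin \o (fun x => u x * phi x)).
Proof.
move=> mU lu [sphi [K [cK KU phi0]]].
have cphi := smooth_cont sphi.
have [M phiM] := bounded_cs cK cphi phi0.
apply: (integrableS _ _ (@subsetT _ U)) => //.
apply: (integrable_mul_cs mU lu cK KU _ phiM phi0).
exact: rV_continuous_measurable.
Qed.

Lemma test_pderiv U phi i : test_function U phi -> test_function U (pderiv i phi).
Proof.
move=> [sphi [K [cK KU phi0]]]; split; first exact: smooth_pderiv.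
by exists K; split=> //; exact: pderiv_out.
Qed.

Lemma loc_integrableB U u w : measurable U -> loc_integrable U u -> loc_integrable U w ->
  loc_integrable U (fun x => u x - w x).
Proof.
move=> mU lu lw; split; first by apply: measurable_funB; [case: lu|case: lw].
move=> K cK KU; have iu := loc_integrable_compact lu cK KU mU.
have iw := loc_integrable_compact lw cK KU mU.
by have /integrableP[] := integrableB (measurable_compact cK) iu iw.
Qed.

(* Products of plateaus approximate the indicator function of a box. *)
Lemma box_approx U w (a b : 'rV[R]_n) : measurable U -> loc_integrable U w ->
  (forall i, a 0 i < b 0 i) -> cbox a b `<=` U ->
  (fun N => \int[leb]_(x in U) (w x *
     tensor (fun i => plateau (a 0 i) ((b 0 i - a 0 i) / N.+1%:R) N) x)) @ \oo -->
  \int[leb]_(x in obox a b) w x.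
Proof.
move=> mU lw ab abU; set K := cbox a b.
have cK : compact K by exact: compact_cbox.
have mK : measurable K by exact: measurable_cbox.
have iw := loc_integrable_compact lw cK abU mU.
have mw := measurable_int _ iw.
pose phi N := tensor (fun i => plateau (a 0 i) ((b 0 i - a 0 i) / N.+1%:R) N).
have w_gt0 N i : 0 < (b 0 i - a 0 i) / N.+1%:R by rewrite divr_gt0// subr_gt0.
have phi_out N x : ~ obox a b x -> phi N x = 0.
  move=> /existsNP[i /negP]; rewrite negb_and -!leNgt => h.
  apply: (@tensor_eq0 _ _ _ _ i); apply: plateau_out => //.
  by rewrite divfK// addrC subrK; exact/orP.
have cphi N : continuous (phi N).
  by apply: continuous_tensor => i; exact: smooth1_plateau.
have [C C1 HC] := @plateau_bound R.
have phiC N x : `|phi N x| <= C ^+ n.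
  rewrite /phi /tensor normr_prod -[X in _ ^+ X](card_ord n) -prodr_const.
  by apply: ler_prod => i _; rewrite normr_ge0/=; exact: HC.
pose f x := w x * \1_(obox a b) x.
have [|||||fint _ H] := @dominated_convergence _ _ R leb K mK
  (fun N => EFin \o (fun x => w x * phi N x)) (EFin \o f)
  (fun x => (C ^+ n)%:E * `|(w x)%:E|)%E.
- move=> N; apply/measurable_EFinP; apply: measurable_funM.
    exact/measurable_EFinP.
  exact: rV_continuous_measurable.
- apply/measurable_EFinP; apply: measurable_funM.
    exact/measurable_EFinP.
  by apply: measurable_indic; exact: measurable_obox.
- apply: aeW => x Kx /=; rewrite /f; apply: cvg_EFin; first by apply: nearW.
  apply: cvgMl_tmp; rewrite indicE.
  have [xab|xab] := pselect (obox a b x); last first.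
    by rewrite memNset//; apply: cvg_near_cst; apply: nearW => N; exact: phi_out.
  rewrite mem_set//; apply: cvg_near_cst.
  (* Once the mesh is smaller than the distances from x_i to both ends, x_i lies in the flat
     part. *)
  have h (i : 'I_n) : \forall N \near \oo, plateau (a 0 i) ((b 0 i - a 0 i) / N.+1%:R) N (x 0 i) = 1.
    have /andP[h1 h2] := xab i.
    near=> N.
    have N1 : 0 < N.+1%:R :> R by [].
    have NE : N%:R = N.+1%:R - 1 :> R by rewrite -natr1 addrK.
    have k1 : (b 0 i - a 0 i) / (x 0 i - a 0 i) <= N.+1%:R.
      by apply: (@le_trans _ _ N%:R); [near: N; exact: nbhs_infty_ger|rewrite ler_nat].
    have k2 : (b 0 i - a 0 i) / (b 0 i - x 0 i) <= N.+1%:R.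
      by apply: (@le_trans _ _ N%:R); [near: N; exact: nbhs_infty_ger|rewrite ler_nat].
    rewrite ler_pdivrMr ?subr_gt0// in k1; rewrite ler_pdivrMr ?subr_gt0// in k2.
    have e1 : (b 0 i - a 0 i) / N.+1%:R <= x 0 i - a 0 i by rewrite ler_pdivrMr// mulrC.
    have e2 : (b 0 i - a 0 i) / N.+1%:R <= b 0 i - x 0 i by rewrite ler_pdivrMr// mulrC.
    apply: plateau_in => //; rewrite NE mulrBr divfK ?gt_eqF// mulr1.
    move: e1 e2; move: ((b 0 i - a 0 i) / N.+1%:R) => z e1 e2.
    by apply/andP; split; lra.
  have := @filter_forall _ _ (fun i N => plateau (a 0 i) ((b 0 i - a 0 i) / N.+1%:R) N (x 0 i) = 1) \oo _ h.
  move=> hN; near=> N; rewrite /phi /tensor big1// => i _.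
  move: i; near: N; exact: hN.
- by apply: integrableZl => //; exact: integrable_abse.
- apply: aeW => x N Kx /=; rewrite -EFinM lee_fin normrM mulrC.
  by apply: ler_wpM2r.
have KE N : \int[leb]_(x in U) (w x * phi N x) = \int[leb]_(x in K) (w x * phi N x).
  by apply: Rintegral_cs => // x Kx; rewrite phi_out ?mulr0// => /obox_sub.
rewrite (funext KE).
have -> : \int[leb]_(x in obox a b) w x = \int[leb]_(x in K) f x.
  rewrite (@Rintegral_cs _ _ K (obox a b)).
  - by apply: eq_Rintegral => x /set_mem xab; rewrite /f indicE mem_set// mulr1.
  - exact: obox_sub.
  - by move=> x xab; rewrite /f indicE memNset// mulr0.
apply: fine_cvg; rewrite fineK; first exact: H.
exact: integrable_fin_num fint.
Unshelve. all: by end_near. Qed.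

End test_functions.

(** * Weak derivatives *)

Section weak.
Context {R : realType} {n : nat}.
Implicit Types (U V K : set 'rV[R]_n) (u w g phi : 'rV[R]_n -> R) (i : 'I_n).

(** Products of plateaus are test functions, so the integrals of w over boxes are limits of
    zeros. *)
Lemma weak0_ae U w : open U -> loc_integrable U w ->
  (forall phi, test_function U phi -> \int[leb]_(x in U) (w x * phi x) = 0) ->
  {ae leb, forall x, U x -> w x = 0}.
Proof.
move=> oU lw w0; have mU := rV_open_measurable oU.
apply: box_integral0_ae => // a b ab abU.
have := box_approx mU lw ab abU.
under eq_fun => N.
  rewrite w0; last first.
    have [|||//] := @test_tensor R n (fun i => plateau (a 0 i) ((b 0 i - a 0 i) / N.+1%:R) N) U a b.
    - by move=> j; exact: smooth1_plateau.
    - move=> j t h; apply: plateau_out; first by rewrite divr_gt0// subr_gt0.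
      rewrite divfK ?pnatr_eq0// addrC subrK.
      by case: h => /ltW; [left|right].
    - exact: abU.
  over.
by move=> H; apply: (cvg_unique _ H); [exact: Rhausdorff|exact: cvg_cst].
Qed.

Lemma weak_pderiv_unique U i u g g' : open U ->
  weak_pderiv U i u g -> weak_pderiv U i u g' ->
  {ae leb, forall x, U x -> g x = g' x}.
Proof.
move=> oU [_ lg ug] [_ lg' ug']; have mU := rV_open_measurable oU.
have h0 phi : test_function U phi -> \int[leb]_(x in U) ((g x - g' x) * phi x) = 0.
  move=> tphi.
  under eq_Rintegral do rewrite mulrBl.
  rewrite RintegralB//; [|exact: test_integrable|exact: test_integrable].
  by apply/eqP; rewrite subr_eq0 -eqr_opp -ug// -ug'.
apply: filterS (weak0_ae oU (loc_integrableB mU lg lg') h0) => x h /h/eqP.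
by rewrite subr_eq0 => /eqP.
Qed.

Lemma loc_integrable_sub U V u : measurable U -> measurable V -> U `<=` V ->
  loc_integrable V u -> loc_integrable U u.
Proof.
move=> mU mV UV [mu lu]; split; first exact: measurable_funS mu.
by move=> K cK KU; apply: lu => //; exact: subset_trans UV.
Qed.

Lemma loc_integrable_ae U u w : measurable U -> loc_integrable U u ->
  measurable_fun U w -> {ae leb, forall x, U x -> u x = w x} -> loc_integrable U w.
Proof.
move=> mU [mu lu] mw uw; split=> // K cK KU; have mK := measurable_compact cK.
rewrite -(@ae_eq_integral _ _ _ leb K (fun x => `|w x|%:E) (fun x => `|u x|%:E))//; first exact: lu.
- by apply/measurable_EFinP; apply: measurableT_comp => //; exact: measurable_funS mu.
- by apply/measurable_EFinP; apply: measurableT_comp => //; exact: measurable_funS mw.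
- by apply: filterS uw => x /= h Kx; rewrite h//; exact: KU.
Qed.

Lemma Rintegral_ae U (f h : 'rV[R]_n -> R) : measurable U ->
  measurable_fun U f -> measurable_fun U h ->
  {ae leb, forall x, U x -> f x = h x} ->
  \int[leb]_(x in U) f x = \int[leb]_(x in U) h x.
Proof.
move=> mU mf mh fh; rewrite /Rintegral; congr fine.
apply: ae_eq_integral => //; try exact/measurable_EFinP.
by apply: filterS fh => x h' Ux /=; rewrite h'.
Qed.

Lemma weak_pderiv_sub U V i u g : open U -> open V -> U `<=` V ->
  weak_pderiv V i u g -> weak_pderiv U i u g.
Proof.
move=> oU oV UV [lu lg ug].
have mU := rV_open_measurable oU; have mV := rV_open_measurable oV.
split; try exact: loc_integrable_sub UV _.
move=> phi tphi; have [sphi [K [cK KU phi0]]] := tphi.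
have KV := subset_trans KU UV.
have out (h : 'rV[R]_n -> R) psi : (forall x, ~ K x -> psi x = 0) ->
    \int[leb]_(x in U) (h x * psi x) = \int[leb]_(x in V) (h x * psi x).
  move=> psi0; rewrite (Rintegral_cs KU) ?(Rintegral_cs KV)// => x /psi0 ->;
  by rewrite mulr0.
rewrite !out//; last exact: pderiv_out.
by apply: ug; exact: test_functionW tphi.
Qed.

Lemma measurable_test U phi : measurable U -> test_function U phi -> measurable_fun U phi.
Proof.
by move=> mU [sphi _]; apply: rV_continuous_measurable => //; exact: smooth_cont.
Qed.

Lemma weak_pderiv_ae U i u u' g g' : open U -> weak_pderiv U i u g ->
  measurable_fun U u' -> measurable_fun U g' ->
  {ae leb, forall x, U x -> u x = u' x} -> {ae leb, forall x, U x -> g x = g' x} ->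
  weak_pderiv U i u' g'.
Proof.
move=> oU [lu lg ug] mu' mg' uu gg; have mU := rV_open_measurable oU.
split; [exact: loc_integrable_ae uu|exact: loc_integrable_ae gg|move=> phi tphi].
have mphi := measurable_test mU tphi.
have mdphi := measurable_test mU (test_pderiv i tphi).
have [[mu _] [mg _]] := (lu, lg).
have <- : \int[leb]_(x in U) (u x * pderiv i phi x) =
    \int[leb]_(x in U) (u' x * pderiv i phi x).
  apply: Rintegral_ae => //; [exact: measurable_funM|exact: measurable_funM|].
  by apply: filterS uu => x h /h ->.
have <- : \int[leb]_(x in U) (g x * phi x) = \int[leb]_(x in U) (g' x * phi x).
  apply: Rintegral_ae => //; [exact: measurable_funM|exact: measurable_funM|].
  by apply: filterS gg => x h /h ->.
exact: ug.
Qed.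

Lemma weak_wD U i u g : weak_pderiv U i u g -> weak_pderiv U i u (wD U i u).
Proof. by move=> ug; rewrite /wD; apply: (@xgetPex _ (fun=> 0) [set g | weak_pderiv U i u g]); exists g. Qed.

Lemma loc_integrable_continuous U u : measurable U -> {within U, continuous u} ->
  loc_integrable U u.
Proof.
move=> mU cu; split; first exact: rV_within_measurable.
move=> K cK KU; have cuK := continuous_subspaceW KU cu.
have mK := measurable_compact cK.
have /compact_bounded[M [_ mrt]] := continuous_compact cuK cK.
have Kfin : (leb K < +oo)%E.
  have [B [_ HB]] := compact_bounded cK.
  apply: le_lt_trans (leb_cbox_lty (const_mx (- (B + 1))) (const_mx (B + 1))).
  apply: le_measure; rewrite ?inE; [exact: mK|exact: measurable_cbox|].
  move=> x Kx i; rewrite !mxE -ler_norml; apply: le_trans (rV_norm_coord _ _) _.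
  by apply: HB => //; rewrite ltrDl.
have bK : [bounded u x | x in K].
  by exists M; split; rewrite ?num_real // => y My z Kz; apply: mrt => //; exists z.
by have /integrableP[] := measurable_bounded_integrable mK Kfin
  (rV_within_measurable mK cuK) bK.
Qed.

(** Integration by parts: u phi has compact support in U, so its i-th derivative has integral zero
    over the whole space. *)
Lemma smooth_weak_pderiv U i u : open U -> smooth u -> weak_pderiv U i u (pderiv i u).
Proof.
move=> oU su; have mU := rV_open_measurable oU.
have cu := smooth_cont su; have cdu := smooth_cont (smooth_pderiv i su).
have lu : loc_integrable U u.
  by apply: loc_integrable_continuous => //; exact: continuous_subspaceT.
have lg : loc_integrable U (pderiv i u).
  by apply: loc_integrable_continuous => //; exact: continuous_subspaceT.
split=> // phi tphi.
have [sphi [K [cK KU phi0]]] := tphi.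
have cphi := smooth_cont sphi; have cdphi := smooth_cont (smooth_pderiv i sphi).
have tdphi := test_pderiv i tphi.
apply/eqP; rewrite -addr_eq0 -RintegralD//; last 2 first.
- exact: test_integrable.
- exact: test_integrable.
have dphi0 := @pderiv_out _ _ K phi i cK phi0.
pose psi x := u x * pderiv i phi x + pderiv i u x * phi x.
have psi0 x : ~ K x -> psi x = 0.
  by move=> Kx; rewrite /psi phi0// dphi0// !mulr0 addr0.
rewrite (@Rintegral_cs _ _ U K psi)// -(@Rintegral_cs _ _ setT K psi)//.
have [B [_ HB]] := compact_bounded cK.
have Kout (x : 'rV[R]_n) : (exists j, Num.max (B + 1) 1 <= `|x 0 j|) -> ~ K x.
  move=> [j]; rewrite ge_max => /andP[Bx _] Kx.
  have B2 : B < B + 2^-1 by rewrite ltrDl.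
  have := HB (B + 2^-1) B2 x Kx => /= xB; have := rV_norm_coord x j; lra.
have dpsi (x : 'rV[R]_n) : is_derive x (delta_mx 0 i) (u * phi) (psi x).
  have du : is_derive x (delta_mx 0 i) u (pderiv i u x).
    by apply: DeriveDef => //; apply: diff_derivable; exact: (su [::]).
  have dp : is_derive x (delta_mx 0 i) phi (pderiv i phi x).
    by apply: DeriveDef => //; apply: diff_derivable; exact: (sphi [::]).
  by apply: is_derive_eq; rewrite /psi /GRing.scale/= [X in _ + X]mulrC.
have B0 : 0 < Num.max (B + 1) 1 by rewrite lt_max ltr01 orbT.
rewrite /Rintegral (integral_pderiv0 B0 dpsi)//.
- move=> x; apply: (@continuousD _ _ _ (fun x => u x * pderiv i phi x)
    (fun x => pderiv i u x * phi x) x); apply: continuousM.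
  + exact: cu.
  + exact: cdphi.
  + exact: cdu.
  + exact: cphi.
- by move=> x /Kout/phi0; rewrite /= => fx; rewrite !fctE fx mulr0.
- by move=> x /Kout/psi0.
Qed.

End weak.

(** * Morrey's inequality on a box *)

Section Lp.
Context {R : realType} {n : nat}.
Implicit Types (U V K : set 'rV[R]_n) (u w g phi : 'rV[R]_n -> R).

(** Hölder's inequality against the indicator function of K, with conjugate exponent (1 -
    1/p)^-1. *)
Lemma Lp_Rintegral V K (p : R) g (N m : R) : measurable V -> measurable K ->
  K `<=` V -> 1 < p -> measurable_fun V g -> (Lpnorm p V g <= N%:E)%E ->
  (leb K <= m%:E)%E -> \int[leb]_(x in K) `|g x| <= N * m `^ (1 - p^-1).
Proof.
move=> mV mK KV p1 mg gN Km.
have p0 : 0 < p by lra.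
have q0 : 0 < 1 - p^-1 by rewrite subr_gt0 invf_lt1.
have N0 : 0 <= N by rewrite -lee_fin; apply: le_trans gN; exact: Lnorm_ge0.
have mgV : measurable_fun setT (g \_ V) by apply/(measurable_restrictT _ mV).
have m1 : measurable_fun setT (\1_K : 'rV[R]_n -> R) by exact: measurable_indic.
have pq : p^-1 + ((1 - p^-1)^-1)^-1 = 1 by rewrite invrK; lra.
have := @hoelder _ _ _ leb (g \_ V) (\1_K) p (1 - p^-1)^-1 mgV m1 p0.
rewrite invr_gt0 => /(_ q0 pq) H.
have E1 : ('N[leb]_1[EFin \o (g \_ V \* \1_K)%R] = \int[leb]_(x in K) `|(g x)%:E|)%E.
  rewrite Lnorm1 [RHS]integral_mkcond; apply: eq_integral => x _ /=.
  rewrite [RHS]patchE indicE; case: ifPn => xK; last by rewrite mulr0 normr0.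
  by rewrite mulr1 patchE mem_set//; apply: KV; exact/set_mem.
have E2 : ('N[leb]_(((1 - p^-1)^-1)%:E)[EFin \o \1_K] = (leb K) `^ (1 - p^-1))%E.
  rewrite unlock /= invrK; congr (_ `^ _)%E.
  rewrite -[X in _ = leb X](setIT K) -integral_indic//; apply: eq_integral => x _.
  rewrite /= indicE; case: (x \in K); first by rewrite normr1 powR1.
  by rewrite normr0 powR0// invr_eq0 gt_eqF.
have le1 : ((\int[leb]_(x in K) `|(g x)%:E|) <= (N * m `^ (1 - p^-1))%:E)%E.
  rewrite -E1; apply: le_trans H _; rewrite E2 EFinM; apply: lee_pmul => //.
  - exact: Lnorm_ge0.
  - exact: poweR_ge0.
  - rewrite -poweR_EFin; apply: gt0_ler_poweR => //; first exact: ltW.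
      by rewrite in_itv/= leey measure_ge0.
    by rewrite in_itv/= leey andbT; apply: le_trans Km; exact: measure_ge0.
rewrite /Rintegral -lee_fin fineK//.
rewrite ge0_fin_numE; last exact: integral_ge0.
by apply: le_lt_trans le1 _; rewrite ltry.
Qed.

End Lp.

(** * Averages against two product densities *)

Section tensor_means.
Context {R : realType} {n : nat}.
Variables (V : set 'rV[R]_n) (u : 'rV[R]_n -> R) (g : 'I_n -> 'rV[R]_n -> R).
Hypotheses (oV : open V) (ug : forall i, weak_pderiv V i u (g i)).
Variables (F F' : 'I_n -> R -> R) (lo hi : 'rV[R]_n) (S T B : R).
Hypotheses (loV : cbox lo hi `<=` V)
  (uF : forall i, unit_step (lo 0 i) (hi 0 i) (F i))
  (uF' : forall i, unit_step (lo 0 i) (hi 0 i) (F' i))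
  (FS : forall i t, `|derive1 (F i) t| <= S)
  (FS' : forall i t, `|derive1 (F' i) t| <= S)
  (FT : forall i t, `|F i t - F' i t| <= T)
  (gB : forall i, \int[leb]_(x in cbox lo hi) `|g i x| <= B).

(** Interpolates between the two densities: the first k factors come from F', the others from F.
    [Phi i] is a primitive in x_i of the difference of two consecutive interpolants, and it has
    compact support because F i and F' i agree outside [lo, hi]. *)
Let mix (k : nat) (j : 'I_n) := if (j < k)%N then derive1 (F' j) else derive1 (F j).
Let Phi (i j : 'I_n) := if j == i then (fun t => F j t - F' j t) else mix i j.

Let sF i : smooth1 (F i). Proof. by have [] := uF i. Qed.
Let sF' i : smooth1 (F' i). Proof. by have [] := uF' i. Qed.

Let smix k j : smooth1 (mix k j).
Proof. by rewrite /mix; case: ifP => _; exact: smooth1_deriv. Qed.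

Let sPhi i j : smooth1 (Phi i j).
Proof. by rewrite /Phi; case: ifP => _ //; exact: smooth1B. Qed.

Let tensor_telescope (i : 'I_n) x :
  tensor (dtens (Phi i) i) x = tensor (mix i) x - tensor (mix i.+1) x.
Proof.
rewrite /tensor (bigD1 i)//= [in RHS](bigD1 i)//= [X in _ - X](bigD1 i)//=.
have E k : (k = i :> nat \/ k = i.+1 :> nat) ->
    \prod_(j | j != i) mix k j (x 0 j) = \prod_(j | j != i) dtens (Phi i) i j (x 0 j).
  move=> ki; apply: eq_bigr => j ji; rewrite /dtens /Phi (negbTE ji) /mix.
  suff -> : (j < k)%N = (j < i)%N by [].
  case: ki => ->//; rewrite ltnS leq_eqVlt; suff -> : (j == i :> nat) = false by [].
  exact/negbTE.
rewrite !E; [|by right|by left].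
rewrite -mulrBl; congr (_ * _); rewrite /dtens eqxx /Phi eqxx /mix ltnn ltnSn.
have := is_deriveB (smooth1_is_derive (x 0 i) (sF i)) (smooth1_is_derive (x 0 i) (sF' i)).
by move=> [_ dE]; rewrite derive1E.
Qed.

Let mix_out k j t : t < lo 0 j \/ hi 0 j < t -> mix k j t = 0.
Proof. by move=> h; rewrite /mix; case: ifP => _; apply: unit_step_derive0 h. Qed.

Let Phi_out i j t : t < lo 0 j \/ hi 0 j < t -> Phi i j t = 0.
Proof.
move=> h; rewrite /Phi; case: ifP => _; last exact: mix_out.
have [_ f0 f1] := uF j; have [_ f0' f1'] := uF' j.
by case: h => /ltW h; [rewrite f0// f0'//|rewrite f1// f1'//]; rewrite subrr.
Qed.

Let test_mix k : test_function V (tensor (mix k)).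
Proof. by have [] := test_tensor (smix k) (mix_out k) loV. Qed.

Let Phi_bound i x : `|tensor (Phi i) x| <= S ^+ n.-1 * T.
Proof.
have S0 : 0 <= S by apply: le_trans (FS i 0).
rewrite /tensor (bigD1 i)//= normrM mulrC; apply: ler_pM => //.
  rewrite normr_prod; apply: (@le_trans _ _ (\prod_(j < n | j != i) S)).
    apply: ler_prod => j ji; rewrite normr_ge0/= /Phi (negbTE ji) /mix.
    by case: ifP.
  by rewrite prodr_const cardC1 card_ord.
by rewrite /Phi eqxx.
Qed.

(* Replacing the factors F i by F' i one at a time, each difference is the i-th
   partial derivative of the test function [tensor (Phi i)], so that the weak
   derivative of u takes over. *)
Lemma tensor_mean_diff :
  `|\int[leb]_(x in V) (u x * tensor (fun i => derive1 (F i)) x) -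
    \int[leb]_(x in V) (u x * tensor (fun i => derive1 (F' i)) x)| <=
  n%:R * (S ^+ n.-1 * T * B).
Proof.
have mV := rV_open_measurable oV.
pose I k := \int[leb]_(x in V) (u x * tensor (mix k) x).
have step_le (i : 'I_n) : `|I i.+1 - I i| <= S ^+ n.-1 * T * B.
  have [lu lg uE] := ug i.
  have [tPhi Phi0] := test_tensor (sPhi i) (Phi_out i) loV.
  have := uE _ tPhi; rewrite pderiv_tensor//.
  under eq_Rintegral do rewrite tensor_telescope mulrBr.
  rewrite RintegralB//; [|exact: test_integrable|exact: test_integrable].
  rewrite -/(I i) -/(I i.+1) distrC => ->; rewrite normrN.
  rewrite (@Rintegral_cs _ _ V (cbox lo hi))//; last by move=> x /Phi0 ->; rewrite mulr0.
  have mK := measurable_cbox lo hi.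
  have ig := loc_integrable_compact lg (@compact_cbox _ _ lo hi) loV mV.
  have iga := integrable_abse ig.
  have igP : leb.-integrable (cbox lo hi) (EFin \o (fun x => g i x * tensor (Phi i) x)).
    by apply: (integrableS _ mK loV) => //; exact: test_integrable.
  apply: le_trans (le_normr_Rintegral mK igP) _.
  apply: (@le_trans _ _ (\int[leb]_(x in cbox lo hi) (S ^+ n.-1 * T * `|g i x|))).
    apply: le_Rintegral => //.
    - exact: (integrable_abse igP).
    - have H : leb.-integrable (cbox lo hi) (fun x => (S ^+ n.-1 * T)%:E * (abse \o (EFin \o g i)) x)%E.
        exact: integrableZl.
      by apply: eq_integrable H => // x _; rewrite /= EFinM.
    - by move=> x _; rewrite normrM mulrC; apply: ler_wpM2r.
  rewrite RintegralZl//; apply: ler_wpM2l => //.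
  by apply: le_trans (Phi_bound i 0).
have -> : \int[leb]_(x in V) (u x * tensor (fun i => derive1 (F i)) x) = I 0%N by [].
have -> : \int[leb]_(x in V) (u x * tensor (fun i => derive1 (F' i)) x) = I n.
  congr Rintegral; apply/funext => x; congr (_ * _); apply: eq_bigr => j _.
  by rewrite /mix ltn_ord.
rewrite distrC -(telescope_sumr I (leq0n n)) big_mkord.
apply: le_trans (ler_norm_sum _ _ _) _.
apply: le_trans (ler_sum _ (fun i _ => step_le i)) _.
by rewrite sumr_const card_ord mulr_natl.
Qed.

End tensor_means.

(** * Dyadic scales and geometric convergence *)

Section dyadic.
Context {R : realType}.

Lemma geometric_limit (a : nat -> R) (C th : R) : 0 <= th < 1 ->
  (forall k, `|a k - a k.+1| <= C * th ^+ k) ->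
  exists l, forall k, `|a k - l| <= C / (1 - th) * th ^+ k.
Proof.
move=> /andP[th0 th1] aC; have th1' : 0 < 1 - th by lra.
have C0 : 0 <= C by have := le_trans (normr_ge0 _) (aC 0%N); rewrite expr0 mulr1.
have bnd k m : `|a k - a (k + m)%N| <= C / (1 - th) * th ^+ k.
  (* The sharper bound, with the tail subtracted, is the one that an induction on m preserves. *)
  suff H : `|a k - a (k + m)%N| <= C / (1 - th) * (th ^+ k - th ^+ (k + m)).
    apply: le_trans H _; apply: ler_wpM2l; first by rewrite divr_ge0// ltW.
    by rewrite gerBl exprn_ge0.
  elim: m => [|m IH]; first by rewrite addn0 !subrr normr0 mulr0.
  have -> : a k - a (k + m.+1)%N = (a k - a (k + m)%N) + (a (k + m)%N - a (k + m.+1)%N).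
    by rewrite addrA subrK.
  apply: le_trans (ler_normD _ _) _; rewrite addnS.
  apply: le_trans (lerD IH (aC _)) _; rewrite le_eqVlt; apply/orP; left; apply/eqP.
  by rewrite exprS; field; rewrite gt_eqF.
have cva : cvgn a.
  have c1 : cvgn (series (telescope a)).
    apply: normed_cvg; apply: (@series_le_cvg _ _ (geometric C th)).
    - by move=> k; exact: normr_ge0.
    - by move=> k; rewrite /= mulr_ge0// exprn_ge0.
    - by move=> k; rewrite /= /telescope distrC; exact: aC.
    - by apply: is_cvg_geometric_series; rewrite ger0_norm.
  rewrite telescopeK in c1.
  rewrite (_ : a = (fun n => (a n - a 0%N) + a 0%N)).
    by apply: is_cvgD => //; exact: is_cvg_cst.
  by apply/funext => k; rewrite subrK.
exists (limn a) => k.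
have c2 : (fun m => `|a k - a m|) @ \oo --> `|a k - limn a|.
  by apply: cvg_norm; apply: cvgB => //; exact: cvg_cst.
apply: cvgr_to_le c2 _; near=> m.
have km : (k <= m)%N by near: m; exact: nbhs_infty_ge.
by rewrite -(subnKC km); exact: bnd.
Unshelve. all: by end_near. Qed.

(** The exponent starts at 1, so that all scales are at most 1/2; the averages below require t <
    1. *)
Definition dyad (k : nat) : R := 2^-1 ^+ k.+1.

Lemma dyad_gt0 k : 0 < dyad k. Proof. by rewrite exprn_gt0. Qed.

Lemma dyad_le k : dyad k <= 2^-1.
Proof. by rewrite /dyad exprS ger_pMr// exprn_ile1//; lra. Qed.

Lemma dyadS k : dyad k = 2 * dyad k.+1.
Proof. by rewrite /dyad [in RHS]exprS; lra. Qed.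

Lemma dyad_lt (e : R) : 0 < e -> exists k, dyad k < e.
Proof.
move=> e0; have : (fun k => (2^-1 : R) ^+ k) @ \oo --> (0 : R).
  by apply: cvg_expr; rewrite ger0_norm//; lra.
move=> /cvgrPdist_lt/(_ _ e0)[k _ /(_ k.+1 (leqnSn k))]/=.
by rewrite sub0r normrN ger0_norm ?exprn_ge0// => ke; exists k.
Qed.

Lemma dyad_between (d : R) : 0 < d <= 2^-1 -> exists k, dyad k.+1 <= d <= dyad k.
Proof.
move=> /andP[d0 d2]; have [k kd] := dyad_lt d0.
have ex : exists k, dyad k <= d by exists k; exact: ltW.
case: (ex_minnP ex) => -[|m] md mmin.
  exists 0%N; have := dyadS 0; have := dyad_gt0 1.
  by rewrite /dyad expr1 d2 andbT in md *; lra.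
exists m; rewrite md/= leNgt; apply/negP => /ltW/mmin.
by rewrite ltnn.
Qed.

End dyadic.

Section morrey_constants.
Context {R : realType} {n : nat}.
Variables (p : R).
Hypotheses (n0 : (0 < n)%N) (np : n%:R < p).

Let p1 : 1 < p.
Proof. by apply: le_lt_trans np; rewrite ler1n. Qed.

Let p0 : 0 < p. Proof. by apply: lt_trans p1. Qed.

Definition holder_exp : R := 1 - n%:R / p.

Lemma holder_exp_gt0 : 0 < holder_exp.
Proof. by rewrite subr_gt0 ltr_pdivrMr// mul1r. Qed.

(** At scale t, the densities are bounded by kap / t, their primitives differ by at most T, and both
    are carried by one box of side at most L t. *)
Definition cmp_cst (kap L T : R) : R :=
  n%:R * (kap ^+ n.-1 * T * (((2 * L) ^+ n) `^ (1 - p^-1))).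

Lemma cmp_cst_ge0 kap L T : 0 <= kap -> 0 <= T -> 0 <= cmp_cst kap L T.
Proof.
move=> k0 T0; rewrite /cmp_cst mulr_ge0// !mulr_ge0// ?powR_ge0//.
by rewrite exprn_ge0.
Qed.

(** The powers of t are -(n - 1) from the densities and n (1 - 1/p) from the volume; their sum is
    the Hölder exponent 1 - n/p. *)
Lemma volume_scaling (kap L T t N : R) : 0 < t -> 0 <= L ->
  n%:R * ((kap / t) ^+ n.-1 * T * (N * ((2 * (L * t)) ^+ n) `^ (1 - p^-1))) =
  cmp_cst kap L T * N * t `^ holder_exp.
Proof.
move=> t0 L0; have tn0 := ltW t0.
have E : (t ^+ n) `^ (1 - p^-1) = t ^+ n.-1 * t `^ holder_exp.
  rewrite -powR_mulrn// -powRrM -[t ^+ n.-1]powR_mulrn// -powRD; last first.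
    by apply/implyP => _; rewrite gt_eqF.
  congr (_ `^ _); rewrite /holder_exp; have -> : n.-1%:R = n%:R - 1 :> R.
    by rewrite -[in RHS](prednK n0) -natr1 addrK.
  by field; rewrite gt_eqF.
have -> : (2 * (L * t)) ^+ n = (2 * L) ^+ n * t ^+ n by rewrite mulrA exprMn.
rewrite powRM ?exprn_ge0// ?mulr_ge0// E expr_div_n /cmp_cst.
have tX : t ^+ n.-1 != 0 by rewrite expf_neq0// gt_eqF.
move: (t ^+ n.-1) tX (t `^ holder_exp) (kap ^+ n.-1) => X X0 Y Z.
by move: (_ `^ _) => W; field.
Qed.

Section compare_family.
Variables (V : set 'rV[R]_n) (u : 'rV[R]_n -> R) (g : 'I_n -> 'rV[R]_n -> R) (N : R).
Hypotheses (oV : open V) (ug : forall i, weak_pderiv V i u (g i))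
  (gN : forall i, (Lpnorm p V (g i) <= N%:E)%E).

Lemma tensor_mean_compare (F F' : 'I_n -> R -> R) (lo hi : 'rV[R]_n) (kap L T t : R) :
  0 < t -> 0 < L -> cbox lo hi `<=` V ->
  (forall i, unit_step (lo 0 i) (hi 0 i) (F i)) ->
  (forall i, unit_step (lo 0 i) (hi 0 i) (F' i)) ->
  (forall i s, `|derive1 (F i) s| <= kap / t) ->
  (forall i s, `|derive1 (F' i) s| <= kap / t) ->
  (forall i s, `|F i s - F' i s| <= T) ->
  (forall i, hi 0 i - lo 0 i <= L * t) ->
  `|\int[leb]_(x in V) (u x * tensor (fun i => derive1 (F i)) x) -
    \int[leb]_(x in V) (u x * tensor (fun i => derive1 (F' i)) x)| <=
  cmp_cst kap L T * N * t `^ holder_exp.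
Proof.
move=> t0 L0 loV uF uF' FS FS' FT hilo; rewrite -volume_scaling//; last exact: ltW.
apply: (@tensor_mean_diff _ _ V u g oV ug F F' lo hi) => // i.
apply: (@Lp_Rintegral _ _ V) => //.
- exact: rV_open_measurable.
- exact: measurable_cbox.
- by have [_ [mg _] _] := ug i.
- by apply: leb_cbox_le => //; exact: mulr_gt0.
Qed.

End compare_family.
End morrey_constants.

Lemma holder_continuous (R : realType) n (V : set 'rV[R]_n) (f : 'rV[R]_n -> R) (C e : R) :
  0 < e -> (forall x y, V x -> V y -> `|f x - f y| <= C * `|x - y| `^ e) ->
  {within V, continuous f}.
Proof.
move=> e0 fC; apply/subspace_continuousP => x Vx; apply/cvgrPdist_le => d d0.
pose C' := Num.max C 1; have C'0 : 0 < C' by rewrite lt_max ltr01 orbT.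
pose r := (d / C') `^ e^-1.
have dC : 0 < d / C' by exact: divr_gt0.
have r0 : 0 < r by exact: powR_gt0.
apply: (@rV_nbhsI _ _ _ x r r0) => y xy Vy.
apply: le_trans (fC x y Vx Vy) _.
have re : r `^ e = d / C'.
  by rewrite /r -powRrM mulVf ?gt_eqF// powRr1// ltW.
have -> : d = C' * r `^ e by rewrite re mulrC divfK// gt_eqF.
apply: (@le_trans _ _ (C' * `|x - y| `^ e)).
  by apply: ler_wpM2r; [exact: powR_ge0|rewrite le_max lexx].
by apply: ler_wpM2l; [exact: ltW|apply: ge0_ler_powR; rewrite ?nnegrE// ltW].
Qed.

(** * The Hölder continuous representative on a box *)

Section morrey.
Context {R : realType} {n : nat}.
Variables (p : R) (A B : 'rV[R]_n) (D K : R).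
Hypotheses (n0 : (0 < n)%N) (np : n%:R < p).
Hypotheses (AB : forall i, (1 : R) <= B 0 i - A 0 i) (BD : forall i, B 0 i - A 0 i <= D)
  (D1 : (1 : R) <= D) (K1 : (1 : R) <= K).
Hypothesis HK : forall x, [/\ `|@step R x| <= K, `|derive1 (@step R) x| <= K &
  `|@pstep R x - pstep (x - 1)| <= K].

Implicit Types (x y z : 'rV[R]_n) (t s : R).

Let V := obox A B.
Let oV : open V. Proof. exact: open_obox. Qed.
Let e := @holder_exp R n p.

(** A homothety towards the corner A. As the sides of the box have length at least 1, the cube of
    side t placed here stays in the box however close x is to the boundary, so no boundary case
    arises. *)
Definition corner (x : 'rV[R]_n) (t : R) (i : 'I_n) := (1 - t) * x 0 i + t * A 0 i.

Lemma corner_in x t i : V x -> 0 < t < 1 ->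
  A 0 i < corner x t i /\ corner x t i + t < B 0 i.
Proof.
move=> /(_ i)/andP[Ax xB] /andP[t0 t1]; have := AB i; rewrite /corner => h.
by split; nra.
Qed.

Lemma corner_dist x y t s i (d : R) : V y -> s <= t -> 0 < s -> t < 1 ->
  `|x 0 i - y 0 i| <= d -> `|corner x t i - corner y s i| <= d + t * D.
Proof.
move=> /(_ i)/andP[Ay yB] st s0 t1 xyd; have := BD i => h.
have -> : corner x t i - corner y s i = (1 - t) * (x 0 i - y 0 i) + (s - t) * (y 0 i - A 0 i).
  by rewrite /corner; ring.
apply: le_trans (ler_normD _ _) _; rewrite !normrM; apply: lerD.
  rewrite -[leRHS]mul1r; apply: ler_pM => //.
  by rewrite ger0_norm; lra.
apply: ler_pM => //.
  by rewrite ler0_norm; lra.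
by rewrite ger0_norm; lra.
Qed.

Variables (u : 'rV[R]_n -> R) (g : 'I_n -> 'rV[R]_n -> R) (N : R).
Hypotheses (ug : forall i, weak_pderiv V i u (g i))
  (gN : forall i, (Lpnorm p V (g i) <= N%:E)%E).

Let N0 : 0 <= N.
Proof. by rewrite -lee_fin; apply: le_trans (gN (Ordinal n0)); exact: Lnorm_ge0. Qed.

(* Mean of u against a smooth density on the cube of side t with lower corner
   (1 - t) x + t A, which stays inside the box. *)
Definition avg (x : 'rV[R]_n) (t : R) : R := \int[leb]_(z in V)
  (u z * tensor (fun i => derive1 (hstep (corner x t i) t)) z).

Lemma hstep_derive_bound (c t kap s : R) : 0 < t -> K <= kap ->
  `|derive1 (hstep c t) s| <= kap / t.
Proof.
move=> t0 Kk; rewrite derive1_hstep normrM mulrC; apply: ler_pM => //.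
  by have [_ h _] := HK (t^-1 * s + - (t^-1 * c)); exact: le_trans h Kk.
by rewrite ger0_norm ?invr_ge0// ltW.
Qed.

Lemma hstep_bound (c t s : R) : `|hstep c t s| <= K.
Proof. by have [h _ _] := HK (t^-1 * s + - (t^-1 * c)). Qed.

Definition avg_cst := @cmp_cst R n p (2 * K) (3 * D + 1) (2 * K).

(** Serves twice: for one point at two successive dyadic scales, which gives convergence, and for
    two points at one scale, which gives Hölder continuity. *)
Lemma avg_diff x y t s : V x -> V y -> 0 < s -> s <= t -> t <= 2 * s -> t < 1 ->
  `|x - y| <= 2 * D * t -> `|avg x t - avg y s| <= avg_cst * N * t `^ e.
Proof.
move=> Vx Vy s0 st ts t1 xy; have t0 : 0 < t by exact: lt_le_trans st.
have cx i := corner_in i Vx (introT andP (conj t0 t1)).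
have cy i := corner_in i Vy (introT andP (conj s0 (le_lt_trans st t1))).
(* The smallest box containing both cubes: their corners differ by at most 2 D t + D t in each
   coordinate, so its sides are at most (3 D + 1) t. *)
pose lo : 'rV[R]_n := \row_i Num.min (corner x t i) (corner y s i).
pose hi : 'rV[R]_n := \row_i Num.max (corner x t i + t) (corner y s i + s).
have D1' := D1; have K1' := K1; have L0 : 0 < 3 * D + 1 by lra.
have K2 : K <= 2 * K by lra.
apply: (@tensor_mean_compare _ _ p n0 np V u g N oV ug gN _ _ lo hi) => //.
- move=> z zK i; have := zK i; rewrite !mxE => /andP[+ +]; rewrite ge_min le_max.
  have [a1 a2] := cx i; have [a3 a4] := cy i.
  by move=> /orP[] h1 /orP[] h2; lra.
- move=> i; apply: unit_stepW (hstep_unit _ t0); rewrite !mxE ?ge_min ?le_max lexx//.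
- move=> i; apply: unit_stepW (hstep_unit _ s0); rewrite !mxE ?ge_min ?le_max lexx orbT//.
- by move=> i z; exact: hstep_derive_bound.
- move=> i z; apply: le_trans (hstep_derive_bound _ _ s0 (lexx K)) _.
  by rewrite ler_pdivlMr// mulrAC ler_pdivrMr//; nra.
- move=> i z; apply: le_trans (ler_normB _ _) _.
  by apply: le_trans (lerD (hstep_bound _ _ _) (hstep_bound _ _ _)) _; lra.
- move=> i; rewrite !mxE.
  have xyi : `|x 0 i - y 0 i| <= 2 * D * t.
    by have := rV_norm_coord (x - y) i; rewrite !mxE => h; exact: le_trans h xy.
  have := corner_dist Vy st s0 t1 xyi; rewrite ler_norml => /andP[h1 h2].
  by case: (leP (corner x t i) (corner y s i)) => h3; case: (leP (corner x t i + t)) => h4; lra.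
Qed.


Let e0 : 0 < e. Proof. exact: holder_exp_gt0. Qed.
Let th : R := 2^-1 `^ e.

Let th01 : 0 <= th < 1.
Proof.
rewrite powR_ge0/= (_ : 1 = 1 `^ e); last by rewrite powR1.
by apply: gt0_ltr_powR => //; rewrite ?nnegrE; lra.
Qed.

Let dyad_powR k : dyad k `^ e = th ^+ k.+1 :> R.
Proof.
by rewrite /dyad -[2^-1 ^+ _]powR_mulrn ?invr_ge0// powRAC powR_mulrn// powR_ge0.
Qed.

Definition limit_cst := avg_cst / (1 - th).

Let avg_cst_ge0 : 0 <= avg_cst.
Proof. by have := D1; have := K1 => *; apply: cmp_cst_ge0; lra. Qed.

Let limit_cst_ge0 : 0 <= limit_cst.
Proof. by have /andP[_ h] := th01; rewrite divr_ge0// subr_ge0 ltW. Qed.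

(** Consecutive averages differ by a geometric term, because dyad k ^ e is a power of 2^-e. *)
Lemma avg_limit : exists r : 'rV[R]_n -> R, forall x, V x -> forall k,
  `|avg x (dyad k) - r x| <= limit_cst * N * dyad k `^ e.
Proof.
suff /choice[r rP] : forall x, exists l, V x -> forall k,
  `|avg x (dyad k) - l| <= limit_cst * N * dyad k `^ e by exists r => x /rP.
move=> x; have [Vx|nVx] := pselect (V x); last by exists 0.
have [|l lP] := @geometric_limit R (fun k => avg x (dyad k)) (avg_cst * N * th) th th01.
  move=> k; rewrite -mulrA -exprS -dyad_powR; apply: avg_diff => //.
  - exact: dyad_gt0.
  - by have := @dyad_gt0 R k.+1; rewrite (@dyadS R k); lra.
  - by rewrite -dyadS.
  - by have := @dyad_le R k; lra.
  - by rewrite subrr normr0 !mulr_ge0 ?ltW ?dyad_gt0//; apply: lt_le_trans D1.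
exists l => _ k; apply: le_trans (lP k) _; rewrite dyad_powR exprS /limit_cst le_eqVlt.
by apply/orP; left; apply/eqP; have /andP[_ h] := th01; field; rewrite subr_eq0 gt_eqF.
Qed.

Variable r : 'rV[R]_n -> R.
Hypothesis rP : forall x, V x -> forall k, `|avg x (dyad k) - r x| <= limit_cst * N * dyad k `^ e.

Definition holder_cst := 2 * limit_cst + avg_cst.

Lemma rep_holder x y : V x -> V y -> `|r x - r y| <= holder_cst * N * `|x - y| `^ e.
Proof.
move=> Vx Vy; have D1' := D1.
have [->|xy] := eqVneq x y.
  by rewrite subrr normr0 !mulr_ge0// ?powR_ge0// /holder_cst addr_ge0// mulr_ge0.
have xy0 : 0 < `|x - y| by rewrite normr_gt0 subr_eq0.
have xyD : `|x - y| <= D.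
  apply: rV_norm_le => [|i]; first lra.
  have := BD i; have /andP[h1 h2] := Vx i; have /andP[h3 h4] := Vy i => h5.
  by rewrite !mxE ler_norml; lra.
(* A scale comparable to the distance: large enough for [avg_diff] to apply, yet at most |x - y|, so
   that all three errors have the order wanted. *)
have [|k /andP[k1 k2]] := @dyad_between R (`|x - y| / (2 * D)).
  rewrite divr_gt0//=; last lra.
  by rewrite ler_pdivrMr; lra.
have dk := @dyad_gt0 R k.
have xyk : `|x - y| <= 2 * D * dyad k by move: k2; rewrite ler_pdivrMr; lra.
have kxy : dyad k <= `|x - y|.
  rewrite (@dyadS R k); have : dyad k.+1 * (2 * D) <= `|x - y|.
    by rewrite -ler_pdivlMr//; lra.
  by have := @dyad_gt0 R k.+1; nra.
have a1 := rP Vx k; have a2 := rP Vy k.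
have a3 : `|avg x (dyad k) - avg y (dyad k)| <= avg_cst * N * dyad k `^ e.
  by apply: avg_diff => //; have := @dyad_le R k; lra.
have E (a b c d : R) : c - d = - (a - c) + (a - b) + (b - d) by ring.
have E' (c1 c2 m d : R) : c2 * m * d + c1 * m * d + c2 * m * d = (2 * c2 + c1) * m * d.
  by ring.
rewrite (E (avg x (dyad k)) (avg y (dyad k)) (r x) (r y)).
apply: (@le_trans _ _ (holder_cst * N * dyad k `^ e)).
  apply: le_trans (ler_normD _ _) _.
  apply: le_trans (lerD (ler_normD _ _) (lexx _)) _; rewrite normrN.
  by apply: le_trans (lerD (lerD a1 a3) a2) _; rewrite E'.
apply: ler_wpM2l; first by rewrite mulr_ge0// /holder_cst addr_ge0// mulr_ge0.
by apply: ge0_ler_powR; rewrite ?nnegrE// ltW.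
Qed.

Lemma rep_continuous : {within V, continuous r}.
Proof. exact: holder_continuous e0 rep_holder. Qed.

Lemma gstep_derive_bound (a w t kap s : R) j : 0 < t -> t <= w -> 2 * K <= kap ->
  `|derive1 (gstep a w j) s| <= kap / t.
Proof.
move=> t0 tw Kk; have w0 := lt_le_trans t0 tw.
have -> : derive1 (gstep a w j) s = w^-1 * zeta a w j s by rewrite derive1_gstep.
rewrite normrM mulrC; apply: ler_pM => //; last first.
  by rewrite ger0_norm ?lef_pV2 ?posrE// invr_ge0 ltW.
rewrite /zeta; apply: le_trans (ler_normB _ _) _.
have [h1 _ _] := HK (w^-1 * s + - (w^-1 * a + j%:R)).
have [h2 _ _] := HK (w^-1 * s + - (w^-1 * a + j.+1%:R)).
by apply: le_trans (lerD h1 h2) _; rewrite -mulr2n -mulr_natl.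
Qed.

Lemma gstep_bound (a w s : R) j : `|gstep a w j s| <= K.
Proof.
have [_ _] := HK (w^-1 * s + - (w^-1 * a + j%:R)).
suff E : w^-1 * s + - (w^-1 * a + j.+1%:R) = w^-1 * s + - (w^-1 * a + j%:R) - 1.
  by rewrite /gstep E.
by rewrite -natr1 !opprD !addrA.
Qed.


Lemma Rintegral_sum_test (I : finType) (w : 'rV[R]_n -> R) (f : I -> 'rV[R]_n -> R) :
  loc_integrable V w -> (forall i, test_function V (f i)) ->
  \int[leb]_(x in V) (w x * \sum_i f i x) = \sum_i \int[leb]_(x in V) (w x * f i x).
Proof.
move=> lw tf; have mV := rV_open_measurable oV.
have iw i : leb.-integrable V (EFin \o (fun x => w x * f i x)) by exact: test_integrable.
rewrite /Rintegral sum_fine => [|i _]; last exact: integrable_fin_num (iw i).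
congr fine; rewrite -(integral_sum mV (f := fun i x => (w x * f i x)%:E))//.
by apply: eq_integral => x _; rewrite mulr_sumr sumEFin.
Qed.

Lemma Rintegral_le_cst (Q : set 'rV[R]_n) (h : 'rV[R]_n -> R) (c m : R) :
  measurable Q -> leb.-integrable Q (EFin \o h) -> (forall x, Q x -> `|h x| <= c) ->
  0 <= c -> (leb Q <= m%:E)%E -> `|\int[leb]_(x in Q) h x| <= c * m.
Proof.
move=> mQ ih hc c0 Qm.
have Qfin : leb Q \is a fin_num.
  by rewrite ge0_fin_numE ?measure_ge0//; apply: le_lt_trans Qm _; rewrite ltry.
apply: le_trans (le_normr_Rintegral mQ ih) _.
apply: (@le_trans _ _ (\int[leb]_(x in Q) c)).
  apply: le_Rintegral => //; first exact: (integrable_abse ih).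
  apply: measurable_bounded_integrable => //.
    by rewrite -ge0_fin_numE ?measure_ge0.
  exact: bounded_cst.
rewrite Rintegral_cst//; apply: ler_wpM2l => //.
by rewrite -lee_fin fineK.
Qed.

(** * Comparison of u with r on one cell of a grid *)

Section grid.
Variables (a b : 'rV[R]_n) (bet : R).
Hypotheses (ab : forall i, a 0 i < b 0 i) (abV : cbox a b `<=` V).
Hypotheses (bet0 : 0 < bet) (bet1 : bet <= 1) (betP : forall i, bet <= b 0 i - a 0 i).

Let aV : V a. Proof. by apply: abV => i; rewrite lexx ltW. Qed.
Let bV : V b. Proof. by apply: abV => i; rewrite lexx ltW. Qed.

Let abD i : b 0 i - a 0 i <= D.
Proof.
by have /andP[h1 h2] := aV i; have /andP[h3 h4] := bV i; have := BD i; lra.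
Qed.

(* On a cell of the grid of mesh (b - a) / (k + 1), both u and its candidate r
   are compared with the density [rho] of that cell; there is no Lebesgue
   differentiation theorem to identify u with r directly. *)
Definition grid_cst := (@cmp_cst R n p (2 * K / bet) (3 * D) (2 * K) + limit_cst) * N +
  holder_cst * N * (2 * D) `^ e * (2 * K / bet) ^+ n * (4 * D) ^+ n.

Variables (k : nat) (f : 'I_n -> nat).
Hypotheses (k0 : (0 < k)%N) (fk : forall i, (f i < k)%N).
Let t : R := k.+1%:R^-1.
Let w i := (b 0 i - a 0 i) / k.+1%:R.

Let t0 : 0 < t. Proof. by rewrite invr_gt0. Qed.
Let t2 : t <= 2^-1. Proof. by rewrite lef_pV2 ?posrE// ler_nat. Qed.
(** With [wD], this bounds the shape of the cells: the constants depend on the box (a, b) through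
    [bet], but not on the mesh. *)
Let betw i : bet * t <= w i.
Proof. by apply: ler_wpM2r; [exact: ltW|]. Qed.
Let wD i : w i <= D * t.
Proof. by apply: ler_wpM2r; [exact: ltW|]. Qed.
Let bett0 : 0 < bet * t. Proof. exact: mulr_gt0. Qed.
Let w0 i : 0 < w i. Proof. exact: lt_le_trans (betw i). Qed.

(** [xf] and [yf] are the extreme corners of the support of the density of the cell, which is two
    meshes wide. *)
Let xf : 'rV[R]_n := \row_i (a 0 i + w i * (f i)%:R).
Let yf : 'rV[R]_n := \row_i (a 0 i + w i * (f i).+2%:R).

Let xyE i : yf 0 i = xf 0 i + 2 * w i.
Proof. by rewrite !mxE -addn2 natrD; ring. Qed.

Let xy_in i : a 0 i <= xf 0 i /\ yf 0 i <= b 0 i.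
Proof.
rewrite !mxE; split; first by rewrite lerDl mulr_ge0// ltW.
have -> : b 0 i = a 0 i + w i * k.+1%:R by rewrite /w divfK// addrC subrK.
by rewrite lerD2l; apply: ler_wpM2l; [exact: ltW|rewrite ler_nat ltnS].
Qed.

Let xfV : V xf.
Proof.
apply: abV => i; have [h1 h2] := xy_in i; have := xyE i; have := w0 i => h3 h4.
by rewrite h1/=; lra.
Qed.

Let rho := tensor (fun i => derive1 (gstep (a 0 i) (w i) (f i))).

Let ustep_g i : unit_step (xf 0 i) (yf 0 i) (gstep (a 0 i) (w i) (f i)).
Proof. by rewrite !mxE; exact: gstep_unit. Qed.

Let sgstep i : smooth1 (gstep (a 0 i) (w i) (f i)). Proof. by have [] := ustep_g i. Qed.

Let xyV : cbox xf yf `<=` V.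
Proof.
move=> z zK; apply: abV => i; have [h1 h2] := xy_in i; have /andP[h3 h4] := zK i.
by rewrite (le_trans h1 h3) (le_trans h4 h2).
Qed.

Let rho_test : test_function V rho /\ (forall x, ~ cbox xf yf x -> rho x = 0).
Proof.
apply: test_tensor xyV => [j|j s h]; first exact: smooth1_deriv.
exact: unit_step_derive0 (ustep_g j) h.
Qed.

Let KKb : 2 * K <= 2 * K / bet.
Proof. by have K1' := K1; rewrite ler_pdivlMr// -[leRHS]mulr1 ler_wpM2l//; lra. Qed.

Let rho_bound x : `|rho x| <= (2 * K / bet / t) ^+ n.
Proof.
rewrite /rho /tensor normr_prod -[X in _ ^+ X](card_ord n) -prodr_const.
apply: ler_prod => i _; rewrite normr_ge0/= -mulrA -invfM.
by apply: gstep_derive_bound => //; exact: betw.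
Qed.

Let int_rho : \int[leb]_(x in V) rho x = 1.
Proof.
have [_ rho0] := rho_test.
rewrite (Rintegral_cs xyV)// -(@Rintegral_cs _ _ setT)//.
pose M := 1 + `|xf| + `|yf|.
have M0 : 0 < M by rewrite /M -addrA ltr_wpDr// addr_ge0.
have xyM i : - M < xf 0 i /\ yf 0 i < M.
  have := rV_norm_coord xf i; have := rV_norm_coord yf i.
  have := normr_ge0 xf; have := normr_ge0 yf.
  by rewrite !ler_norml /M => ? ? /andP[? ?] /andP[? ?]; lra.
rewrite /Rintegral (@integral_tensor _ _ M)//.
  rewrite big1//= => i _; have [_ g0 g1] := ustep_g i; have [h1 h2] := xyM i.
  by rewrite g1 ?g0 ?subr0// ltW.
move=> i s; have [h1 h2] := xyM i.
rewrite ler_normr => /orP[] sM; apply: unit_step_derive0 (ustep_g i) _; [right|left]; lra.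
Qed.

Let lu : loc_integrable V u. Proof. by have [] := ug (Ordinal n0). Qed.

Let mV : measurable V. Proof. exact: rV_open_measurable. Qed.

Let lr : loc_integrable V r.
Proof. exact: loc_integrable_continuous mV rep_continuous. Qed.

(** The density [rho] and the one of the average at [xf] live at comparable scales on a common box
    of side at most 3 D t, so the comparison of tensor means applies. *)
Let u_cell s : 0 < s -> s <= t -> t <= 2 * s ->
  `|\int[leb]_(x in V) (u x * rho x) - avg xf s| <=
  @cmp_cst R n p (2 * K / bet) (3 * D) (2 * K) * N * t `^ e.
Proof.
move=> s0 st ts; have D1' := D1; have K1' := K1.
have s1 : s < 1 by have t2' := t2; lra.
have cx i := corner_in i xfV (introT andP (conj s0 s1)).
pose lo : 'rV[R]_n := \row_i Num.min (xf 0 i) (corner xf s i).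
pose hi : 'rV[R]_n := \row_i Num.max (yf 0 i) (corner xf s i + s).
have D30 : 0 < 3 * D by lra.
have loE i : lo 0 i = Num.min (xf 0 i) (corner xf s i) by rewrite mxE.
have hiE i : hi 0 i = Num.max (yf 0 i) (corner xf s i + s) by rewrite mxE.
apply: (@tensor_mean_compare _ _ p n0 np V u g N oV ug gN _ _ lo hi) => //.
- move=> z zK i; have := zK i; rewrite loE hiE => /andP[+ +]; rewrite ge_min le_max.
  have [a1 a2] := cx i; have [a3 a4] := xy_in i.
  have /andP[a5 _] := aV i; have /andP[_ a6] := bV i.
  by move=> /orP[] h1 /orP[] h2; lra.
- move=> i; apply: unit_stepW (ustep_g i).
    by rewrite loE ge_min lexx.
  by rewrite hiE le_max lexx.
- move=> i; apply: unit_stepW (hstep_unit _ s0).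
    by rewrite loE ge_min lexx orbT.
  by rewrite hiE le_max lexx orbT.
- move=> i z; rewrite -mulrA -invfM; apply: gstep_derive_bound => //; exact: betw.
- move=> i z; apply: le_trans (hstep_derive_bound _ _ s0 (lexx K)) _.
  apply: (@le_trans _ _ (2 * K / t)).
    by rewrite ler_pdivlMr// mulrAC ler_pdivrMr//; nra.
  by apply: ler_wpM2r; [rewrite invr_ge0 ltW|exact: KKb].
- move=> i z; apply: le_trans (ler_normB _ _) _.
  by apply: le_trans (lerD (gstep_bound _ _ _ _) (hstep_bound _ _ _)) _; lra.
- move=> i; rewrite loE hiE xyE.
  have /andP[h1 h2] := xfV i; have h3 := BD i; have h4 := wD i; have h5 := w0 i.
  have c1 : corner xf s i = xf 0 i - s * (xf 0 i - A 0 i) by rewrite /corner; ring.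
  have c2 : 0 <= s * (xf 0 i - A 0 i) by rewrite mulr_ge0//; lra.
  have c3 : s * (xf 0 i - A 0 i) <= t * D by apply: ler_pM; lra.
  have c4 : t <= D * t by rewrite ler_peMl// ltW.
  rewrite c1; move: c2 c3; move: (s * _) => q c2 c3.
  by rewrite minEle maxEle; do 2 case: ifP => _; lra.
Qed.

(** As [rho] has integral 1, only the oscillation of r over the cell enters, times the supremum of
    |rho| and the volume of the support; in the last two factors the powers of t cancel. *)
Let r_cell : `|\int[leb]_(x in V) (r x * rho x) - r xf| <=
  holder_cst * N * (2 * D) `^ e * (2 * K / bet) ^+ n * (4 * D) ^+ n * t `^ e.
Proof.
have D1' := D1; have K1' := K1; have [tr rho0] := rho_test.
have lc : loc_integrable V (fun=> r xf).
  by apply: loc_integrable_continuous => //; exact: cst_continuous.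
have -> : \int[leb]_(x in V) (r x * rho x) - r xf =
    \int[leb]_(x in cbox xf yf) ((r x - r xf) * rho x).
  rewrite -(Rintegral_cs (f := fun z => (r z - r xf) * rho z) xyV); last first.
    by move=> x /rho0 ->; rewrite mulr0.
  under [RHS]eq_Rintegral do rewrite mulrBl.
  rewrite RintegralB//; [|exact: test_integrable|exact: (test_integrable mV lc)].
  congr (_ - _); rewrite -[LHS]mulr1 -int_rho RintegralZl//.
  have l1 : loc_integrable V (fun=> 1).
    by apply: loc_integrable_continuous => //; exact: cst_continuous.
  by have := test_integrable mV l1 tr; under eq_fun do rewrite /= mul1r.
have Dt0 : 0 < 2 * D * t by rewrite mulr_gt0//; lra.
have C30 : 0 <= holder_cst * N by rewrite mulr_ge0// /holder_cst addr_ge0// mulr_ge0.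
have -> : holder_cst * N * (2 * D) `^ e * (2 * K / bet) ^+ n * (4 * D) ^+ n * t `^ e =
    (holder_cst * N * (2 * D * t) `^ e * (2 * K / bet / t) ^+ n) * (2 * (2 * D * t)) ^+ n.
  have D20 : 0 <= 2 * D by lra.
  rewrite [(2 * D * t) `^ e](powRM e D20 (ltW t0)).
  have -> : 2 * (2 * D * t) = 4 * D * t by ring.
  rewrite [(_ / t) ^+ n]expr_div_n [(4 * D * t) ^+ n]exprMn.
  have tX : t ^+ n != 0 by rewrite expf_neq0// gt_eqF.
  move: tX; move: (t ^+ n) (t `^ e) ((4 * D) ^+ n) ((2 * K / bet) ^+ n) ((2 * D) `^ e) (holder_cst * N).
  by move=> X1 X2 X3 X4 X5 X6 X10; field.
apply: Rintegral_le_cst.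
- exact: measurable_cbox.
- apply: (integrableS mV _ xyV); first exact: measurable_cbox.
  by apply: test_integrable => //; exact: loc_integrableB.
- move=> x xK; rewrite normrM; apply: ler_pM => //.
  apply: le_trans (rep_holder (xyV xK) xfV) _; apply: ler_wpM2l => //.
  apply: ge0_ler_powR; rewrite ?nnegrE ?(ltW Dt0) ?(ltW e0)//.
  apply: rV_norm_le => [|i]; first exact: ltW.
  have /andP[h1 h2] := xK i; have h3 := wD i; rewrite xyE in h2.
  by rewrite [(x - xf) 0 i]mxE [(- xf) 0 i]mxE ler_norml; lra.
- apply: mulr_ge0; first by apply: mulr_ge0 => //; exact: powR_ge0.
  apply: exprn_ge0; apply: divr_ge0; last exact: ltW.
  by apply: divr_ge0; [lra|exact: ltW].
- by apply: leb_cbox_le => // i; rewrite xyE; have h3 := wD i; lra.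
Qed.

(** The product of bumps is [rho] times the volume of a mesh cell. The error is thus t^e times a
    volume, and it stays of order t^e after summation over all cells. *)
Lemma grid_cell : `|\int[leb]_(x in V) ((u x - r x) * tensor (fun i => zeta (a 0 i) (w i) (f i)) x)| <=
  grid_cst * t `^ e * (D * t) ^+ n.
Proof.
have [tr rho0] := rho_test.
have zE x : tensor (fun i => zeta (a 0 i) (w i) (f i)) x = (\prod_i w i) * rho x.
  rewrite /rho /tensor -big_split/=; apply: eq_bigr => i _.
  by rewrite derive1_gstep mulVKf// gt_eqF.
under eq_Rintegral do rewrite zE mulrCA.
have lw := loc_integrableB mV lu lr.
rewrite RintegralZl//; last exact: (test_integrable mV lw tr).
rewrite normrM mulrC; apply: ler_pM => //; last first.
  rewrite normr_prod -[X in _ ^+ X](card_ord n) -prodr_const.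
  by apply: ler_prod => i _; rewrite normr_ge0/= (ger0_norm (ltW (w0 i))).
under eq_Rintegral do rewrite mulrBl.
rewrite RintegralB//; [|exact: (test_integrable mV lu tr)|exact: (test_integrable mV lr tr)].
have [|m /andP[m1 m2]] := @dyad_between R t; first by rewrite t0 t2.
have ts : t <= 2 * dyad m.+1 by rewrite -dyadS.
have h1 := u_cell (@dyad_gt0 R m.+1) m1 ts.
have h2 := rP xfV m.+1.
have h3 := r_cell.
have h2' : `|avg xf (dyad m.+1) - r xf| <= limit_cst * N * t `^ e.
  apply: le_trans h2 _; apply: ler_wpM2l; first exact: mulr_ge0.
  have dm := @dyad_gt0 R m.+1.
  by apply: ge0_ler_powR; rewrite ?nnegrE ?(ltW e0) ?(ltW dm) ?(ltW t0).
have E (x1 x2 x3 x4 : R) : x1 - x4 = (x1 - x2) + (x2 - x3) - (x4 - x3) by ring.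
rewrite (E _ (avg xf (dyad m.+1)) (r xf)).
apply: le_trans (ler_normB _ _) _.
apply: le_trans (lerD (ler_normD _ _) (lexx _)) _.
apply: le_trans (lerD (lerD h1 h2') h3) _.
rewrite /grid_cst [leRHS]mulrDl; apply: lerD => //.
by rewrite -mulrDl -mulrDl.
Qed.

End grid.

Let V_dist_box (a b : 'rV[R]_n) : (forall i, a 0 i < b 0 i) ->
  exists bet : R, [/\ 0 < bet, bet <= 1 & forall i, bet <= b 0 i - a 0 i].
Proof.
move=> ab; exists (\big[Num.min/1]_i (b 0 i - a 0 i)); split.
- by apply/bigmin_gtP; split=> // i _; rewrite subr_gt0.
- exact: bigmin_le_id.
- by move=> i; exact: (bigmin_le_cond _ (fun i => b 0 i - a 0 i)).
Qed.

(** It suffices that u - r has zero integral over each box. This integral is the limit of integrals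
    against products of plateaus, which are sums over the cells of a grid. *)
Lemma rep_ae : {ae leb, forall x, V x -> u x = r x}.
Proof.
have mV := rV_open_measurable oV.
have lu : loc_integrable V u by have [] := ug (Ordinal n0).
have lr : loc_integrable V r := loc_integrable_continuous mV rep_continuous.
have lw := loc_integrableB mV lu lr.
suff : {ae leb, forall x, V x -> u x - r x = 0}.
  by apply: filterS => x h /h/eqP; rewrite subr_eq0 => /eqP.
apply: (box_integral0_ae oV lw) => a b ab abV.
have [bet [bet0 bet1 betP]] := V_dist_box ab.
have H := box_approx mV lw ab abV.
pose G := grid_cst bet * D ^+ n.
have G0 : 0 <= G.
  have D1' := D1; have K1' := K1; have Kb : 0 <= 2 * K / bet by rewrite divr_ge0// ?ltW//; lra.
  have C30 : 0 <= holder_cst * N by rewrite mulr_ge0// /holder_cst addr_ge0// mulr_ge0.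
  apply: mulr_ge0; last by apply: exprn_ge0; lra.
  apply: addr_ge0.
    by apply: mulr_ge0 => //; apply: addr_ge0 => //; apply: cmp_cst_ge0 => //; lra.
  apply: mulr_ge0; last by apply: exprn_ge0; lra.
  apply: mulr_ge0; last exact: exprn_ge0.
  by apply: mulr_ge0 => //; exact: powR_ge0.
have bound (k : nat) : (0 < k)%N ->
    `|\int[leb]_(x in V) ((u x - r x) *
       tensor (fun i => plateau (a 0 i) ((b 0 i - a 0 i) / k.+1%:R) k) x)| <=
    G * k.+1%:R^-1 `^ e.
  move=> k0.
  (* Distributivity: a product of n sums of k bumps is a sum over the k^n ways of choosing one bump
     per coordinate. *)
  have pE x : tensor (fun i => plateau (a 0 i) ((b 0 i - a 0 i) / k.+1%:R) k) x =
      \sum_(f : {ffun 'I_n -> 'I_k})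
        tensor (fun i => zeta (a 0 i) ((b 0 i - a 0 i) / k.+1%:R) (f i)) x.
    rewrite /tensor /plateau; under eq_bigr do rewrite big_mkord.
    by rewrite bigA_distr_bigA.
  under eq_Rintegral do rewrite pE.
  rewrite Rintegral_sum_test//; last first.
    move=> f; have [|||//] := @test_tensor R n (fun i => zeta (a 0 i)
      ((b 0 i - a 0 i) / k.+1%:R) (f i)) V a b.
    - by move=> j; exact: smooth1_zeta.
    - move=> j s h; have wj : 0 < (b 0 j - a 0 j) / k.+1%:R by rewrite divr_gt0// subr_gt0.
      apply: zeta_out => //; case: h => h; [left|right].
        by apply: le_trans (ltW h) _; rewrite lerDl mulr_ge0// ltW.
      apply: le_trans _ (ltW h).
      rewrite [leRHS](_ : _ = a 0 j + (b 0 j - a 0 j) / k.+1%:R * k.+1%:R); last first.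
        by rewrite divfK// addrC subrK.
      by rewrite lerD2l; apply: ler_wpM2l; [exact: ltW|rewrite ler_nat ltnS].
    - exact: abV.
  apply: le_trans (ler_norm_sum _ _ _) _.
  apply: (@le_trans _ _ (\sum_(f : {ffun 'I_n -> 'I_k})
      (grid_cst bet * k.+1%:R^-1 `^ e * (D * k.+1%:R^-1) ^+ n))).
    apply: ler_sum => f _; exact: (@grid_cell a b bet ab abV bet0 bet1 betP k (fun i => f i)).
  rewrite sumr_const card_ffun !card_ord -[leLHS]mulr_natl natrX.
  have kt : (k%:R * k.+1%:R^-1) ^+ n <= 1 :> R.
    rewrite exprn_ile1//.
    by rewrite ler_pdivrMr// mul1r ler_nat.
  rewrite (_ : _ * _ = (G * k.+1%:R^-1 `^ e) * (k%:R * k.+1%:R^-1) ^+ n); last first.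
    rewrite /G !exprMn; ring.
  rewrite -[leRHS]mulr1; apply: ler_wpM2l => //.
  by apply: mulr_ge0 => //; exact: powR_ge0.
apply: (cvg_unique _ H); first exact: Rhausdorff.
apply/cvgrPdist_le => d d0; near=> k.
rewrite sub0r normrN; apply: le_trans (bound k _) _; first by near: k; exact: nbhs_infty_gt.
(* G may be zero, hence G + 1 in the denominator; m is the mesh for which m^e equals this
   quotient. *)
have dG : 0 < d / (G + 1) by apply: divr_gt0 => //; lra.
pose m := (d / (G + 1)) `^ e^-1.
have m0 : 0 < m by exact: powR_gt0.
have km : k.+1%:R^-1 <= m.
  rewrite -[leRHS]invrK lef_pV2 ?posrE ?invr_gt0//.
  apply: (@le_trans _ _ k%:R); last by rewrite ler_nat.
  by near: k; exact: nbhs_infty_ger.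
apply: (@le_trans _ _ (G * (d / (G + 1)))).
  apply: ler_wpM2l => //; rewrite -[leRHS](_ : m `^ e = _).
    by apply: ge0_ler_powR; rewrite ?nnegrE ?(ltW e0) ?(ltW m0).
  by rewrite /m -powRrM mulVf ?gt_eqF// powRr1// ltW.
rewrite mulrCA -[leRHS]mulr1; apply: ler_wpM2l; first exact: ltW.
by rewrite ler_pdivrMr; lra.
Unshelve. all: by end_near. Qed.

End morrey.

Lemma morrey_box (R : realType) (n : nat) (p : R) (A B : 'rV[R]_n) :
  (0 < n)%N -> n%:R < p -> (forall i, 1 <= B 0 i - A 0 i) ->
  exists2 C : R, 0 <= C & forall (u : 'rV[R]_n -> R) (g : 'I_n -> 'rV[R]_n -> R) (N : R),
    (forall i, weak_pderiv (obox A B) i u (g i)) ->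
    (forall i, (Lpnorm p (obox A B) (g i) <= N%:E)%E) ->
    exists r : 'rV[R]_n -> R,
      [/\ forall x y, obox A B x -> obox A B y -> `|r x - r y| <= C * N * `|x - y| `^ @holder_exp R n p,
          {within obox A B, continuous r} &
          {ae leb, forall x, obox A B x -> u x = r x}].
Proof.
move=> n0 np AB; have [K K1 HK] := @step_bound R.
pose D : R := \big[Num.max/1]_i (B 0 i - A 0 i).
have D1 : 1 <= D by exact: bigmax_ge_id.
have BD i : B 0 i - A 0 i <= D by exact: (le_bigmax_cond _ (fun i => B 0 i - A 0 i)).
exists (Num.max 0 (@holder_cst R n p D K)) => [|u g N ug gN]; first by rewrite le_max lexx.
have [r rP] := avg_limit n0 np AB BD D1 K1 HK ug gN.
have N0 : 0 <= N by rewrite -lee_fin; apply: le_trans (gN (Ordinal n0)); exact: Lnorm_ge0.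
exists r; split.
- move=> x y Vx Vy; apply: le_trans (rep_holder n0 np AB BD D1 K1 HK ug gN rP Vx Vy) _.
  apply: ler_wpM2r; first exact: powR_ge0.
  by apply: ler_wpM2r => //; rewrite le_max lexx orbT.
- exact: (rep_continuous n0 np AB BD D1 K1 HK ug gN rP).
- exact: (rep_ae n0 np AB BD D1 K1 HK ug gN rP).
Qed.

(** * Lebesgue norms *)

Section integral_monotone.
Context d (T : measurableType d) (R : realType).
Variable mu : {measure set T -> \bar R}.
Local Open Scope ereal_scope.

(* The energy density is not known to be measurable. The integral of a
   nonnegative function being a supremum over the simple functions below it,
   monotonicity does not need measurability. *)
Lemma ge0_le_integral_nomeas (D : set T) (f g : T -> \bar R) :
  (forall x, D x -> 0 <= f x) -> (forall x, D x -> f x <= g x) ->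
  \int[mu]_(x in D) f x <= \int[mu]_(x in D) g x.
Proof.
move=> f0 fg; have g0 x : D x -> 0 <= g x by move=> Dx; exact: le_trans (f0 x Dx) (fg x Dx).
rewrite ge0_integralE// ge0_integralE//; apply: ereal_sup_le => _ [h hf <-].
exists h => // x; apply: le_trans (hf x) _.
by rewrite !patchE; case: ifPn => // /set_mem; exact: fg.
Qed.

End integral_monotone.

Section frob.
Context {R : realType}.

Lemma frob_ge0 m n (A : 'M[R]_(m, n)) : 0 <= frob A.
Proof. exact: sqrtr_ge0. Qed.

Lemma le_frob_sum m n m' n' (A : 'M[R]_(m, n)) (B : 'M[R]_(m', n')) :
  \sum_i \sum_j A i j ^+ 2 <= \sum_i \sum_j B i j ^+ 2 -> frob A <= frob B.
Proof. exact: ler_wsqrtr. Qed.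

Lemma frob_entry m n (A : 'M[R]_(m, n)) i j : `|A i j| <= frob A.
Proof.
rewrite -sqrtr_sqr; apply: ler_wsqrtr; rewrite (bigD1 i)//= (bigD1 j)//= -addrA.
rewrite lerDl addr_ge0//; first by apply: sumr_ge0 => k _; exact: sqr_ge0.
by apply: sumr_ge0 => k _; apply: sumr_ge0 => l _; exact: sqr_ge0.
Qed.

Lemma frob_rV_le n (x : 'rV[R]_n) (c : R) : (forall i, `|x 0 i| <= c) ->
  frob x <= n%:R * c.
Proof.
move=> xc; have n0 : 0 <= \sum_(i < n) `|x 0 i| by apply: sumr_ge0.
apply: (@le_trans _ _ (\sum_(i < n) `|x 0 i|)); last first.
  apply: le_trans (ler_sum _ (fun i _ => xc i)) _.
  by rewrite sumr_const card_ord mulr_natl.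
rewrite -(ger0_norm n0) -sqrtr_sqr; apply: ler_wsqrtr; rewrite big_ord1 /=.
rewrite expr2 mulr_suml; apply: ler_sum => i _.
rewrite -real_normK ?num_real// expr2; apply: ler_wpM2l => //.
by rewrite (bigD1 i)//= lerDl; apply: sumr_ge0.
Qed.

Lemma measurable_frob d (T : measurableType d) m n (U : set T) (A : T -> 'M[R]_(m, n)) :
  (forall i j, measurable_fun U (fun x => A x i j)) ->
  measurable_fun U (fun x => frob (A x)).
Proof.
move=> mA; apply: (@measurableT_comp _ _ _ _ _ _ (@Num.sqrt R)).
  by apply: continuous_measurable_fun; exact: sqrt_continuous.
apply: measurable_sum => i; apply: measurable_sum => j.
exact: measurable_funX.
Qed.

End frob.

Section Lp_facts.
Context {R : realType} {n : nat}.
Implicit Types (U V K : set 'rV[R]_n) (u w g phi f : 'rV[R]_n -> R) (p : R).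

Lemma LpnormE p U f : 0 < p -> Lpnorm p U f =
  ((\int[leb]_(x in U) ((`|f x| `^ p)%:E)) `^ p^-1)%E.
Proof.
move=> p0; rewrite /Lpnorm unlock; congr (_ `^ _)%E.
rewrite [RHS]integral_mkcond; apply: eq_integral => x _ /=.
rewrite !patchE; case: ifPn => // _.
by rewrite normr0 powR0// gt_eqF.
Qed.

Lemma Lpnorm_mono p U f g : 0 < p ->
  (forall x, U x -> `|f x| <= `|g x|) -> (Lpnorm p U f <= Lpnorm p U g)%E.
Proof.
move=> p0 fg; rewrite !LpnormE//; apply: gt0_ler_poweR.
- by rewrite invr_ge0 ltW.
- by rewrite in_itv/= leey andbT; apply: integral_ge0 => x _; rewrite lee_fin powR_ge0.
- by rewrite in_itv/= leey andbT; apply: integral_ge0 => x _; rewrite lee_fin powR_ge0.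
apply: ge0_le_integral_nomeas => x Ux; first by rewrite lee_fin powR_ge0.
by rewrite lee_fin; apply: ge0_ler_powR; rewrite ?nnegrE ?(ltW p0)//; exact: fg.
Qed.

(** Used with Q an annulus, for the gradient of a cutoff function, and with Q the whole space, for
    bounded functions on a set of finite measure. *)
Lemma Lpnorm_le_indic p U Q f (M m : R) : 0 < p -> 0 <= M -> measurable U -> measurable Q ->
  measurable_fun U f -> (leb (U `&` Q) <= m%:E)%E ->
  {ae leb, forall x, U x -> `|f x| <= M * \1_Q x} ->
  (Lpnorm p U f <= (M * m `^ p^-1)%:E)%E.
Proof.
move=> p0 M0 mU mQ mf Qm fM; have p1 : 0 <= p^-1 by rewrite invr_ge0 ltW.
have m0 : 0 <= m by rewrite -lee_fin; apply: le_trans Qm; exact: measure_ge0.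
have -> : (M * m `^ p^-1)%:E = (((M `^ p) * m)%:E `^ p^-1)%E.
  by rewrite poweR_EFin powRM ?powR_ge0// -powRrM mulfV ?gt_eqF// powRr1.
rewrite LpnormE//; apply: gt0_ler_poweR => //.
- by rewrite in_itv/= leey andbT; apply: integral_ge0 => x _; rewrite lee_fin powR_ge0.
- by rewrite in_itv/= leey andbT lee_fin mulr_ge0// powR_ge0.
apply: (@le_trans _ _ (\int[leb]_(x in U) (M `^ p * \1_Q x)%:E)%E).
  have f0 x : U x -> (0 <= (`|f x| `^ p)%:E)%E by rewrite lee_fin powR_ge0.
  have h0 x : U x -> (0 <= (M `^ p * \1_Q x)%:E)%E by rewrite lee_fin mulr_ge0// powR_ge0.
  apply: (ae_ge0_le_integral mU f0 _ h0).
  - apply/measurable_EFinP; apply: (@measurableT_comp _ _ _ _ _ _ (fun y : R => y `^ p)).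
      exact: measurable_powR.
    exact: measurableT_comp.
  - by apply/measurable_EFinP; apply: measurable_funM => //; exact: measurable_indic.
  - apply: filterS fM => x h Ux; rewrite lee_fin; move: (h Ux); rewrite indicE.
    case: (x \in Q); rewrite ?mulr1 ?mulr0 => h'.
      by apply: ge0_ler_powR; rewrite ?nnegrE ?(ltW p0).
    by rewrite (_ : `|f x| = 0) ?powR0 ?gt_eqF//; apply/le_anti; rewrite h' normr_ge0.
under eq_integral do rewrite EFinM.
have mI : measurable_fun U (EFin \o (\1_Q : 'rV[R]_n -> R)).
  by apply/measurable_EFinP; exact: measurable_indic.
have I0 (x : 'rV[R]_n) : U x -> (0 <= ((\1_Q x : R)%:E))%E by rewrite lee_fin.
rewrite (ge0_integralZl_EFin _ mU I0 mI (powR_ge0 _ _)).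
rewrite integral_indic// setIC EFinM; apply: lee_pmul => //.
by rewrite lee_fin powR_ge0.
Qed.

End Lp_facts.

(** * Measure density from the extension operator *)

Section continuous_ae.
Context {R : realType} {n : nat}.

(** A disagreement at one point persists on a small box, and boxes have positive measure. *)
Lemma continuous_ae_eq (U : set 'rV[R]_n) (f g : 'rV[R]_n -> R) : open U ->
  {within U, continuous f} -> {within U, continuous g} ->
  {ae leb, forall x, U x -> f x = g x} -> forall x, U x -> f x = g x.
Proof.
move=> oU; rewrite !continuous_open_subspace// => cf cg [N [mN N0 fgN]] x Ux.
apply/eqP; rewrite -subr_eq0; apply/negPn/negP => d0.
have h0 : 0 < `|f x - g x| by rewrite normr_gt0.
have cx : (fun y => f y - g y) @ x --> f x - g x.
  by have := cvgB (cf x (mem_set Ux)) (cg x (mem_set Ux)); apply.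
have /rV_nbhs[e1 e10 He1] : nbhs x [set y | `|(f x - g x) - (f y - g y)| < `|f x - g x|].
  by have /cvgrPdist_lt/(_ _ h0) := cx.
have /rV_nbhs[e2 e20 He2] : nbhs x U by move: oU; rewrite openE; apply.
pose e := Num.min e1 e2; have e0 : 0 < e by rewrite lt_min e10.
pose a := x - const_mx (e / 2); pose b := x + const_mx (e / 2).
have sub : obox a b `<=` N.
  move=> y yab; apply: fgN => /= fgy.
  have xy : `|x - y| < e.
    apply: rV_norm_lt => // i; have := yab i; rewrite !mxE ltr_norml => h; lra.
  have Uy : U y by apply: He2; apply: lt_le_trans xy _; rewrite ge_min lexx orbT.
  have xy1 : `|x - y| < e1 by apply: lt_le_trans xy _; rewrite ge_min lexx.
  by have := He1 y xy1; rewrite /= fgy// subrr subr0 ltxx.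
have mo : measurable (obox a b) by exact: measurable_obox.
have : (leb (obox a b) <= leb N)%E by apply: le_measure; rewrite ?inE.
rewrite N0 leb_box; last by move=> i; rewrite !mxE; lra.
rewrite lee_fin leNgt; apply/negP/negPn; apply: prodr_gt0 => i _.
by rewrite !mxE; lra.
Qed.

End continuous_ae.

(** * Cutoff functions and annuli *)

Section cutoff.
Context {R : realType} {n : nat}.
Variables (K : R) (x : 'rV[R]_n) (rr : R).
Hypotheses (rr0 : 0 < rr).
Hypothesis HK : forall x, [/\ `|@step R x| <= K, `|derive1 (@step R) x| <= K &
  `|@pstep R x - pstep (x - 1)| <= K].

Let K0 : 0 <= K. Proof. by have [h _ _] := HK 0; apply: le_trans h. Qed.

(** Rises over [x_i - rr, x_i - rr/2] and falls over [x_i + rr/2, x_i + rr], so that the gradient of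
    the product is carried by an annulus in the sup norm. *)
Definition cut1 (i : 'I_n) (t : R) : R :=
  hstep (x 0 i - rr) (rr / 2) t - hstep (x 0 i + rr / 2) (rr / 2) t.

Definition cutoff : 'rV[R]_n -> R := tensor cut1.

Let rr2 : 0 < rr / 2. Proof. by rewrite divr_gt0. Qed.

Let u1 i : unit_step (x 0 i - rr) (x 0 i - rr / 2) (hstep (x 0 i - rr) (rr / 2)).
Proof.
have := hstep_unit (x 0 i - rr) rr2.
by rewrite (_ : x 0 i - rr + rr / 2 = x 0 i - rr / 2)//; lra.
Qed.

Let u2 i : unit_step (x 0 i + rr / 2) (x 0 i + rr) (hstep (x 0 i + rr / 2) (rr / 2)).
Proof.
have := hstep_unit (x 0 i + rr / 2) rr2.
by rewrite (_ : x 0 i + rr / 2 + rr / 2 = x 0 i + rr)//; lra.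
Qed.

Lemma smooth1_cut1 i : smooth1 (cut1 i).
Proof. by apply: smooth1B; [have [] := u1 i|have [] := u2 i]. Qed.

Lemma smooth_cutoff : smooth cutoff.
Proof. by apply: smooth_tensor => i; exact: smooth1_cut1. Qed.

Lemma cutoff_center : cutoff x = 1.
Proof.
rewrite /cutoff /tensor big1// => i _; rewrite /cut1.
have rr2' := rr2; have [_ _ h1] := u1 i; have [_ h2 _] := u2 i.
by rewrite h1 ?h2 ?subr0//; lra.
Qed.

Lemma cut1_out i t : rr <= `|t - x 0 i| -> cut1 i t = 0.
Proof.
have rr2' := rr2; have [_ h0 h1] := u1 i; have [_ h2 h3] := u2 i.
rewrite ler_normr /cut1 => /orP[] h; first by rewrite h1 ?h3 ?subrr//; lra.
by rewrite h0 ?h2 ?subrr//; lra.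
Qed.

Lemma cutoff_out (z : 'rV[R]_n) i : rr <= `|z 0 i - x 0 i| -> cutoff z = 0.
Proof. by move=> /cut1_out; exact: tensor_eq0. Qed.

Lemma cut1_bound i t : `|cut1 i t| <= 2 * K.
Proof.
apply: le_trans (ler_normB _ _) _; rewrite mulr_natl mulr2n.
by apply: lerD; exact: (hstep_bound HK).
Qed.

Lemma cutoff_bound z : `|cutoff z| <= (2 * K) ^+ n.
Proof.
rewrite /cutoff /tensor normr_prod -[X in _ ^+ X](card_ord n) -prodr_const.
by apply: ler_prod => i _; rewrite normr_ge0/= cut1_bound.
Qed.

Lemma derive1_cut1 i t : derive1 (cut1 i) t =
  derive1 (hstep (x 0 i - rr) (rr / 2)) t - derive1 (hstep (x 0 i + rr / 2) (rr / 2)) t.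
Proof.
have [s1 _ _] := u1 i; have [s2 _ _] := u2 i.
have := is_deriveB (smooth1_is_derive t s1) (smooth1_is_derive t s2).
by move=> [_ dE]; rewrite derive1E.
Qed.

Lemma derive1_cut1_bound i t : `|derive1 (cut1 i) t| <= 4 * K / rr.
Proof.
rewrite derive1_cut1; apply: le_trans (ler_normB _ _) _.
have -> : 4 * K / rr = K / (rr / 2) + K / (rr / 2) by field; rewrite gt_eqF.
by apply: lerD; exact: (hstep_derive_bound HK).
Qed.

Lemma derive1_step_out s : s <= 0 \/ 1 <= s -> derive1 (@step R) s = 0.
Proof.
case=> h.
  apply: (@derive1_near_cst _ _ 0); near=> y; apply: step_lt.
  by near: y; apply: lt_nbhsl; lra.
apply: (@derive1_near_cst _ _ 1); near=> y; apply: step_gt.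
by near: y; apply: lt_nbhsr; lra.
Unshelve. all: by end_near. Qed.

Lemma derive1_hstep_out (c w t : R) : 0 < w -> t <= c \/ c + w <= t ->
  derive1 (hstep c w) t = 0.
Proof.
move=> w0 h; rewrite derive1_hstep derive1_step_out ?mulr0// -mulrBr.
case: h => h; [left|right].
  by rewrite pmulr_rle0 ?invr_gt0//; lra.
by rewrite -ler_pdivrMl ?invr_gt0// invrK; lra.
Qed.

Lemma derive1_cut1_in i t : `|t - x 0 i| <= rr / 2 -> derive1 (cut1 i) t = 0.
Proof.
rewrite ler_norml => /andP[h1 h2]; have rr2' := rr2; rewrite derive1_cut1.
have E1 : derive1 (hstep (x 0 i - rr) (rr / 2)) t = 0.
  by apply: derive1_hstep_out => //; right; lra.
have E2 : derive1 (hstep (x 0 i + rr / 2) (rr / 2)) t = 0.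
  by apply: derive1_hstep_out => //; left; lra.
exact: (eq_trans (congr2 (fun a b => a - b) E1 E2) (subrr 0)).
Qed.

Lemma derive1_cut1_out i t : rr <= `|t - x 0 i| -> derive1 (cut1 i) t = 0.
Proof.
have rr2' := rr2; rewrite ler_normr derive1_cut1 => h.
have E1 : derive1 (hstep (x 0 i - rr) (rr / 2)) t = 0.
  by apply: derive1_hstep_out => //; case/orP : h => h; [right|left]; lra.
have E2 : derive1 (hstep (x 0 i + rr / 2) (rr / 2)) t = 0.
  by apply: derive1_hstep_out => //; case/orP : h => h; [right|left]; lra.
exact: (eq_trans (congr2 (fun a b => a - b) E1 E2) (subrr 0)).
Qed.

Definition annulus : set 'rV[R]_n := [set z | rr / 2 < `|z - x| < rr].

(** If |z - x| >= rr, some coordinate is at distance at least rr and its factor vanishes,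
    differentiated or not. If |z - x| <= rr/2, the differentiated factor vanishes. *)
Lemma pderiv_cutoff_bound i (z : 'rV[R]_n) :
  `|pderiv i cutoff z| <= (4 * K / rr) * (2 * K) ^+ n.-1 * \1_annulus z.
Proof.
have rr0' := rr0; have K0' := K0.
rewrite pderiv_tensor; last by move=> j; exact: smooth1_cut1.
have c0 : 0 <= (4 * K / rr) * (2 * K) ^+ n.-1.
  by rewrite mulr_ge0 ?exprn_ge0// ?divr_ge0 ?mulr_ge0// ltW.
rewrite indicE; case: (boolP (z \in annulus)) => /=; last first.
  move=> /negP; rewrite inE => nz; rewrite mulr0.
  suff -> : tensor (dtens cut1 i) z = 0 by rewrite normr0.
  have [zlt|zge] := ltP `|z - x| rr; last first.
    have [|j zj] := rV_norm_attained (x := z - x); first by apply: lt_le_trans zge.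
    apply: (@tensor_eq0 _ _ _ _ j); rewrite /dtens.
    have zj' : rr <= `|z 0 j - x 0 j| by move: zj zge; rewrite !mxE => ->.
    by case: ifP => _; [exact: derive1_cut1_out|exact: cut1_out].
  have zle : `|z - x| <= rr / 2 by rewrite leNgt; apply/negP => h; apply: nz; rewrite /annulus/= h.
  apply: (@tensor_eq0 _ _ _ _ i); rewrite /dtens eqxx; apply: derive1_cut1_in.
  by apply: le_trans zle; have := rV_norm_coord (z - x) i; rewrite !mxE.
move=> _; rewrite mulr1 /tensor (bigD1 i)//= normrM; apply: ler_pM => //.
  by rewrite /dtens eqxx; exact: derive1_cut1_bound.
rewrite normr_prod; apply: (@le_trans _ _ (\prod_(j < n | j != i) (2 * K))).
  by apply: ler_prod => j ji; rewrite normr_ge0/= /dtens (negbTE ji) cut1_bound.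
by rewrite prodr_const cardC1 card_ord.
Qed.

Lemma measurable_annulus : measurable annulus.
Proof.
apply: rV_open_measurable.
have c : continuous (fun z : 'rV[R]_n => `|z - x|).
  move=> z; apply: (@continuous_comp _ _ _ (fun z : 'rV[R]_n => z - x) (fun z => `|z|)).
    by apply: continuousB; [exact: cvg_id|exact: cst_continuous].
  exact: norm_continuous.
rewrite (_ : annulus = (fun z : 'rV[R]_n => `|z - x|) @^-1` `]rr / 2, rr[).
  by apply: open_comp => [z _|]; [exact: c|exact: interval_open].
by apply/seteqP; split=> z; rewrite /annulus /= in_itv.
Qed.

End cutoff.

Section density.
Context {R : realType} {n : nat}.
Implicit Types (U V : set 'rV[R]_n) (u : 'rV[R]_n -> R) (p : R).

Lemma leb_sub_obox_lty U (A B : 'rV[R]_n) : measurable U -> U `<=` obox A B ->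
  (leb U < +oo)%E.
Proof.
move=> mU UV; apply: le_lt_trans (leb_obox_lty A B).
by apply: le_measure; rewrite ?inE//; exact: measurable_obox.
Qed.

Lemma wD_smooth_ae U u i : open U -> smooth u ->
  {ae leb, forall x, U x -> wD U i u x = pderiv i u x}.
Proof.
move=> oU su; apply: (@weak_pderiv_unique _ _ U i u) => //.
  exact: weak_wD (smooth_weak_pderiv i oU su).
exact: smooth_weak_pderiv.
Qed.

Lemma W1_smooth U u p (A B : 'rV[R]_n) (M : R) : 0 < p -> open U -> U `<=` obox A B ->
  smooth u -> (forall x, `|u x| <= M) -> (forall i x, `|pderiv i u x| <= M) ->
  W1 p U u.
Proof.
move=> p0 oU UV su uM duM; have mU := rV_open_measurable oU.
have M0 : 0 <= M by apply: le_trans (uM 0).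
have Ufin := leb_sub_obox_lty mU UV.
have mem (f : 'rV[R]_n -> R) : measurable_fun U f -> {ae leb, forall x, U x -> `|f x| <= M} -> memLp p U f.
  move=> mf fM; split=> //.
  have Um : (leb (U `&` setT) <= (fine (leb U))%:E)%E.
    by rewrite setIT fineK// ge0_fin_numE ?measure_ge0.
  apply: le_lt_trans (Lpnorm_le_indic p0 M0 mU measurableT mf Um _) (ltry _).
  by apply: filterS fM => x h Ux; rewrite indicT mulr1; exact: h.
split.
  apply: mem; last by apply: aeW => x _; exact: uM.
  by apply: rV_continuous_measurable => //; exact: smooth_cont.
move=> i; have w := weak_wD (smooth_weak_pderiv i oU su); split=> //.
apply: mem; first by have [_ [mw _] _] := w.
by apply: filterS (wD_smooth_ae i oU su) => x h /h ->; exact: duM.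
Qed.

Lemma Lpnorm_wD_frob V u p i : 0 < p ->
  (Lpnorm p V (wD V i u) <= Lpnorm p V (fun x => frob (wgrad V u x)))%E.
Proof.
move=> p0; apply: Lpnorm_mono => // x _; rewrite [leRHS]ger0_norm ?frob_ge0//.
by have := frob_entry (wgrad V u x) 0 i; rewrite mxE.
Qed.

(* The extension operator is applied to a cutoff function equal to 1 at x and
   vanishing at z: by Morrey's inequality the extension cannot jump from 1 to 0
   over the distance rr unless its gradient, hence the gradient of the cutoff on
   U k, has a large norm. *)
Lemma measure_density (p : R) (A B : 'rV[R]_n) (eps : nat -> R)
    (U : nat -> set 'rV[R]_n) (E : nat -> ('rV[R]_n -> R) -> 'rV[R]_n -> R) :
  (0 < n)%N -> n%:R < p -> (forall i, 1 <= B 0 i - A 0 i) ->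
  (forall k, open (U k)) -> (forall k, U k `<=` obox A B) ->
  extension_operator p eps U (obox A B) E ->
  exists2 c : R, 0 < c & forall k x z (rr : R), U k x -> U k z ->
    0 < rr -> `|z - x| = rr ->
    ((c * rr ^+ n)%:E <= leb (U k `&` annulus x rr))%E.
Proof.
move=> n0 np AB oU UV EE.
have p1 : 1 < p by apply: le_lt_trans np; rewrite ler1n.
have p0 : 0 < p by apply: lt_trans p1.
have [K K1 HK] := @step_bound R; have K0 : 0 <= K by lra.
have [Cm Cm0 HM] := morrey_box n0 np AB.
have [Ce HE] := ext_W1_bounds EE (ltW p1).
pose Ce' := Num.max Ce 0; have Ce0 : 0 <= Ce' by rewrite le_max lexx orbT.
pose Cx := n%:R * (4 * K * (2 * K) ^+ n.-1).
have Cx0 : 0 <= Cx by rewrite !mulr_ge0// exprn_ge0// mulr_ge0.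
pose C := Cm * Ce' * Cx + 1.
have C'0 : 0 <= Cm * Ce' * Cx by apply: mulr_ge0 => //; exact: mulr_ge0.
have C0 : 0 < C by exact: ltr_wpDl.
exists (C `^ (- p)) => [|k x z rr Ux Uz rr0 zx]; first exact: powR_gt0.
have mU := rV_open_measurable (oU k).
have mA := measurable_annulus x rr.
have mUA : measurable (U k `&` annulus x rr) by exact: measurableI.
set psi := cutoff x rr.
have spsi : smooth psi by exact: smooth_cutoff.
have Ufin := leb_sub_obox_lty mU (UV k).
pose m := fine (leb (U k `&` annulus x rr)).
have mE : leb (U k `&` annulus x rr) = m%:E.
  rewrite /m fineK// ge0_fin_numE ?measure_ge0//; apply: le_lt_trans Ufin.
  by apply: le_measure; rewrite ?inE.
have m0 : 0 <= m by rewrite -lee_fin -mE measure_ge0.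
pose b := 4 * K / rr * (2 * K) ^+ n.-1.
have b0 : 0 <= b by rewrite mulr_ge0 ?exprn_ge0 ?divr_ge0 ?mulr_ge0// ltW.
have dpsi i y : `|pderiv i psi y| <= b * \1_(annulus x rr) y.
  exact: (@pderiv_cutoff_bound _ _ K x rr rr0 HK i y).
have W1psi : W1 p (U k) psi.
  apply: (@W1_smooth _ _ _ A B (Num.max ((2 * K) ^+ n) b)) => //.
    by move=> y; rewrite le_max (@cutoff_bound _ _ K x rr HK y).
  move=> i y; apply: le_trans (dpsi i y) _; rewrite le_max; apply/orP; right.
  by rewrite -[leRHS]mulr1; apply: ler_wpM2l => //; rewrite indicE; case: (_ \in _).
have ae_grad : {ae leb, forall y, U k y -> forall i, wD (U k) i psi y = pderiv i psi y}.
  have h : {ae leb, forall y, forall i, U k y -> wD (U k) i psi y = pderiv i psi y}.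
    apply: (@filter_forall _ _ (fun i y => U k y -> wD (U k) i psi y = pderiv i psi y)).
    by move=> i; exact: wD_smooth_ae.
  by apply: filterS h => y h Uy i; exact: h.
have gU : (Lpnorm p (U k) (fun y => frob (wgrad (U k) psi y)) <=
    (n%:R * b * m `^ p^-1)%:E)%E.
  apply: (Lpnorm_le_indic p0 _ mU mA) => //.
  - by rewrite mulr_ge0.
  - apply: measurable_frob => i j; under eq_fun do rewrite mxE.
    by have [_ /(_ j)[_ []]] := W1psi.
  - by rewrite mE.
  - apply: filterS ae_grad => y h Uy; rewrite ger0_norm ?frob_ge0//.
    rewrite -mulrA; apply: frob_rV_le => i; rewrite mxE h//.
have [EU EV] := HE k psi W1psi.
have [wE1 wE2] := ext_W1 EE (ltW p1) W1psi.
pose N := Ce' * (n%:R * b * m `^ p^-1).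
have EN i : (Lpnorm p (obox A B) (wD (obox A B) i (E k psi)) <= N%:E)%E.
  apply: le_trans (Lpnorm_wD_frob _ _ _ p0) _; apply: le_trans EV _.
  apply: (@le_trans _ _ (Ce'%:E * Lpnorm p (U k) (fun y => frob (wgrad (U k) psi y)))%E).
    by apply: lee_wpmul2r; [exact: Lnorm_ge0|rewrite lee_fin le_max lexx].
  by rewrite /N EFinM; apply: lee_wpmul2l.
have [r [rH rc rae]] := HM (E k psi) (fun i => wD (obox A B) i (E k psi)) N
  (fun i => (wE2 i).1) EN.
(* The extension equals the cutoff function almost everywhere on U k, and both sides are continuous
   there; hence r is 1 at x and 0 at z. *)
have rpsi y : U k y -> r y = psi y.
  apply: (continuous_ae_eq (oU k)).
  - exact: continuous_subspaceW (UV k) rc.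
  - by apply: continuous_subspaceT; exact: smooth_cont.
  - have := ext_extends EE (ltW p1) W1psi.
    by apply: filterS2 rae => y' h1 h2 Uy'; rewrite -(h1 (UV k _ Uy')) h2.
have := rH x z (UV k _ Ux) (UV k _ Uz).
rewrite !rpsi// /psi cutoff_center//.
have -> : cutoff x rr z = 0.
  have [|j zj] := rV_norm_attained (x := z - x); first by rewrite zx.
  by apply: (@cutoff_out _ _ _ _ rr0 _ j); move: zj; rewrite !mxE zx => ->.
rewrite subr0 normr1 distrC zx => H1.
(* The gradient has size 1/rr on the annulus, of measure m, so Morrey's inequality reads 1 <= C
   m^(1/p) rr^-1 rr^(1 - n/p). The p-th power of this gives m >= C^-p rr^n. *)
have H2 : rr `^ (n%:R / p) <= C * m `^ p^-1.
  have rE : rr `^ (@holder_exp R n p) = rr / rr `^ (n%:R / p).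
    rewrite /holder_exp powRB; last by apply/implyP => _; rewrite gt_eqF.
    by rewrite powRr1// ltW.
  have rX : 0 < rr `^ (n%:R / p) by exact: powR_gt0.
  have mX : 0 <= m `^ p^-1 by exact: powR_ge0.
  move: H1; rewrite rE.
  have -> : Cm * N * (rr / rr `^ (n%:R / p)) =
      (Cm * Ce' * Cx) * m `^ p^-1 / rr `^ (n%:R / p).
    rewrite /N /b /Cx; move: rX; move: (rr `^ _) (m `^ _) ((2 * K) ^+ _) => X Y Z X0.
    by field; rewrite !gt_eqF.
  rewrite ler_pdivlMr// mul1r => H2; apply: le_trans H2 _.
  by apply: ler_wpM2r => //; rewrite /C lerDl.
have : (rr `^ (n%:R / p)) `^ p <= (C * m `^ p^-1) `^ p.
  by apply: ge0_ler_powR; rewrite ?nnegrE ?powR_ge0 ?(ltW p0)// mulr_ge0 ?powR_ge0// ltW.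
rewrite -powRrM divfK ?gt_eqF// powR_mulrn ?(ltW rr0)//.
rewrite powRM ?powR_ge0 ?(ltW C0)//.
rewrite -[(m `^ _) `^ _]powRrM mulVf ?gt_eqF// powRr1// => H3.
rewrite mE lee_fin powRN mulrC ler_pdivrMr ?powR_gt0//.
by rewrite mulrC.
Qed.

End density.

(** * Geometry of the perforated domain *)

Section perforated_geometry.
Context {R : realType} {n : nat}.
Variables (a b : 'rV[int]_n) (Ys : set 'rV[R]_n).
Hypothesis ab : forall i, a 0 i < b 0 i.
Hypothesis oYs : open Ys.
Hypothesis Ysub : Ys `<=` unit_cell.

Lemma boxE : box a b = obox (map_mx intr a) (map_mx intr b) :> set 'rV[R]_n.
Proof. by apply/seteqP; split=> x h i; have := h i; rewrite !mxE. Qed.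

Lemma box_width i : 1 <= map_mx intr b 0 i - map_mx intr a 0 i :> R.
Proof. by rewrite !mxE -intrB ler1z lerBrDr addrC lezD1 ab. Qed.

(** If a face of the cell stuck out of the box, so would a point of the open cell close to that
    face; the cap 1/2 on [d] keeps this test point in the cell. *)
Lemma cells_coord (e : R) k : 0 < e -> cells (box a b) e k ->
  forall i, (a 0 i)%:~R <= e * (k 0 i)%:~R /\ e * ((k 0 i)%:~R + 1) <= (b 0 i)%:~R.
Proof.
move=> e0 kc i.
have h (t : R) : 0 < t < 1 -> (a 0 i)%:~R < e * (t + (k 0 i)%:~R) < (b 0 i)%:~R.
  move=> t01; have /(_ i) : box a b (e *: (const_mx t + map_mx intr k)).
    by apply: kc; exists (const_mx t) => // j; rewrite mxE.
  by rewrite !mxE.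
split; rewrite leNgt; apply/negP => l.
  pose d := Num.min (((a 0 i)%:~R - e * (k 0 i)%:~R) / e) (1 / 2).
  have d0 : 0 < d by rewrite lt_min divr_gt0//; lra.
  have d1 : d <= 1 / 2 by rewrite ge_min lexx orbT.
  have de : d * e <= (a 0 i)%:~R - e * (k 0 i)%:~R.
    by rewrite -ler_pdivlMr// ge_min lexx.
  by have := h d; lra.
pose d := Num.min ((e * ((k 0 i)%:~R + 1) - (b 0 i)%:~R) / e) (1 / 2).
have d0 : 0 < d by rewrite lt_min divr_gt0//; lra.
have d1 : d <= 1 / 2 by rewrite ge_min lexx orbT.
have de : d * e <= e * ((k 0 i)%:~R + 1) - (b 0 i)%:~R.
  by rewrite -ler_pdivlMr// ge_min lexx.
by have := h (1 - d); lra.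
Qed.

Lemma coord_cells (e : R) (k : 'rV[int]_n) : 0 < e ->
  (forall i, (a 0 i)%:~R <= e * (k 0 i)%:~R /\ e * ((k 0 i)%:~R + 1) <= (b 0 i)%:~R) ->
  cells (box a b) e k.
Proof.
move=> e0 h x [y y01 <-] i; rewrite !mxE; have [h1 h2] := h i; have /andP[y0 y1] := y01 i.
rewrite mulrDr; have ey0 : 0 < e * y 0 i by exact: mulr_gt0.
have ey1 : e * y 0 i < e by rewrite gtr_pMr.
by lra.
Qed.

Lemma interior_cbox (A B : 'rV[R]_n) : interior (cbox A B) `<=` obox A B.
Proof.
move=> x /rV_nbhs[d d0 hd] i.
have hx t : `|t| < d -> A 0 i <= x 0 i + t <= B 0 i.
  move=> td; have -> : x 0 i + t = (x + const_mx t) 0 i by rewrite !mxE.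
  apply: hd; apply: rV_norm_lt => // j; rewrite !mxE opprD addrA subrr sub0r normrN.
  exact: td.
have := hx (d / 2); have := hx (- (d / 2)).
rewrite normrN gtr0_norm ?divr_gt0// ltr_pdivrMr// mulr_natr mulr2n ltrDl d0.
by move=> /(_ isT) h1 /(_ isT) h2; lra.
Qed.

Lemma open_scaled_copy (e : R) k : 0 < e -> open (scaled_copy e k Ys).
Proof.
move=> e0; have -> : scaled_copy e k Ys =
    (fun x : 'rV[R]_n => e^-1 *: x - map_mx intr k) @^-1` Ys.
  apply/seteqP; split=> [x [y Yy <-]|x /= Yx].
    by rewrite /= scalerA mulVf ?gt_eqF// scale1r addrK.
  eexists; first exact: Yx.
  by rewrite subrK scalerA mulfV ?gt_eqF// scale1r.
apply: open_comp => // x _; apply: continuousB; last exact: cst_continuous.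
exact: scaler_continuous.
Qed.

Lemma copy_perforated (e : R) k : 0 < e -> cells (box a b) e k ->
  scaled_copy e k Ys `<=` perforated (box a b) Ys e.
Proof.
move=> e0 kc; rewrite /perforated -(open_subsetE _ (open_scaled_copy e0)).
move=> x [y Yy <-]; exists k => //; exists y => //; exact: subset_closure.
Qed.

(** The closed copies only lie in the closed box; taking the interior leads back to the open one. *)
Lemma perforated_sub (e : R) : 0 < e -> perforated (box a b) Ys e `<=` box a b.
Proof.
move=> e0; rewrite [X in _ `<=` X]boxE; apply: subset_trans (@interior_cbox _ _).
apply: interiorS.
move=> x [k kc] [y Yy <-] i; rewrite !mxE; have [h1 h2] := cells_coord e0 kc i.
move: h1 h2; have /andP[y0 y1] : 0 <= y 0 i <= 1.
  have : closure Ys `<=` cbox 0 (const_mx 1).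
    have /closure_id -> : closed (cbox (0 : 'rV[R]_n) (const_mx 1)).
      by apply: compact_closed; [exact: norm_hausdorff|exact: compact_cbox].
    apply: closureS => z /Ysub h j; have /andP[z0 z1] := h j.
    by rewrite !mxE !ltW.
  by move=> /(_ _ Yy i); rewrite !mxE.
rewrite mulrDr; have ey0 : 0 <= e * y 0 i by rewrite mulr_ge0// ltW.
have ey1 : e * y 0 i <= e by rewrite ger_pMr.
by move=> h1 h2; lra.
Qed.

(** Rounding x/e down gives the index of a cell whose closure contains x. It lies in the box because
    1/e and the corners of the box are integral. The copy in this cell of any point of Ys is within
    e of x. *)
Lemma perforated_near (e : R) (m : nat) (x : 'rV[R]_n) : 0 < e -> e^-1 = m%:R ->
  Ys !=set0 -> box a b x ->
  exists2 y, perforated (box a b) Ys e y & `|x - y| <= e.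
Proof.
move=> e0 em [y0 Yy0] bx.
pose k : 'rV[int]_n := \row_i Num.floor (e^-1 * x 0 i).
have kx i : (k 0 i)%:~R <= e^-1 * x 0 i < (k 0 i)%:~R + 1.
  by rewrite mxE; have := floor_itv (e^-1 * x 0 i); rewrite intrD.
have kc : cells (box a b) e k.
  apply: coord_cells => // i; have /andP[k1 k2] := kx i; have /andP[x1 x2] := bx i.
  have e1 : e * e^-1 = 1 by rewrite mulfV ?gt_eqF.
  have s (c : int) : e * (c * m%:Z)%:~R = c%:~R.
    by rewrite intrM -[m%:~R]em mulrCA e1 mulr1.
  split.
    rewrite -(s (a 0 i)); apply: ler_wpM2l; first exact: ltW.
    rewrite ler_int mxE floor_ge_int intrM -[m%:~R]em mulrC.
    by apply: ler_wpM2l; rewrite ?invr_ge0 ltW.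
  rewrite -(s (b 0 i)); apply: ler_wpM2l; first exact: ltW.
  rewrite -[1]/(1%:~R) -intrD ler_int lezD1 -(ltr_int R).
  apply: le_lt_trans k1 _.
  by rewrite intrM -[m%:~R]em mulrC ltr_pM2r// invr_gt0.
exists (e *: (y0 + map_mx intr k)).
  by apply: (copy_perforated e0 kc); exists y0.
apply: rV_norm_le; first exact: ltW.
move=> i; have := kx i; rewrite !mxE; set kk := Num.floor _ => /andP[k1 k2].
rewrite -(mulVKf (lt0r_neq0 e0) (x 0 i)) -mulrBr normrM (gtr0_norm e0).
rewrite -[leRHS]mulr1; apply: ler_wpM2l; first exact: ltW.
have /andP[y1 y2] := Ysub Yy0 i.
by rewrite ler_norml; lra.
Qed.

(** The points are taken in the first and the last cell along the diagonal. They come from two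
    distinct points of Ys, since the cells coincide when e = 1 and the box is a unit cube; the
    distance is at least 1 - e (1 - d) >= d. *)
Lemma perforated_far : (0 < n)%N -> Ys !=set0 ->
  exists2 d : R, 0 < d < 1 & forall (e : R) (m : nat), 0 < e -> e^-1 = m%:R ->
    exists z1 z2, [/\ perforated (box a b) Ys e z1, perforated (box a b) Ys e z2 &
      d <= `|z1 - z2|].
Proof.
move=> n0 [y0 Yy0]; pose i0 := Ordinal n0.
have [r r0 hr] : exists2 r : R, 0 < r & forall y, `|y0 - y| < r -> Ys y.
  by apply: rV_nbhs; move: oYs; rewrite openE; apply.
pose d := r / 2; have d0 : 0 < d by rewrite divr_gt0.
have Y1 : Ys (y0 + const_mx d).
  apply: hr; apply: rV_norm_lt => // j.
  by rewrite !mxE opprD addrA subrr sub0r normrN gtr0_norm// /d; lra.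
exists d.
  rewrite d0; have := Ysub Y1 i0; have := Ysub Yy0 i0; rewrite !mxE; lra.
move=> e m e0 em.
have m1 : 1 <= m%:R :> R.
  by rewrite ler1n lt0n; apply/negP => /eqP m0; have := em; rewrite m0 => /eqP;
     rewrite invr_eq0 gt_eqF.
have e1 : e * m%:R = 1 by rewrite -em mulfV ?gt_eqF.
have ele1 : e <= 1 by rewrite -e1 ler_peMr// ltW.
have abR i : (a 0 i)%:~R + 1 <= (b 0 i)%:~R :> R.
  by rewrite -[1]/(1%:~R) -intrD ler_int lezD1.
pose k1 : 'rV[int]_n := \row_i (a 0 i * m%:Z).
pose k2 : 'rV[int]_n := \row_i (b 0 i * m%:Z - 1).
have k1E i : e * (k1 0 i)%:~R = (a 0 i)%:~R.
  by rewrite mxE intrM mulrCA e1 mulr1.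
have k2E i : e * (k2 0 i)%:~R = (b 0 i)%:~R - e.
  by rewrite mxE intrB intrM mulrBr mulrCA e1 !mulr1.
have c1 : cells (box a b) e k1.
  by apply: coord_cells => // i; rewrite mulrDr k1E mulr1; have := abR i; lra.
have c2 : cells (box a b) e k2.
  by apply: coord_cells => // i; rewrite mulrDr k2E mulr1; have := abR i; lra.
exists (e *: (y0 + const_mx d + map_mx intr k2)), (e *: (y0 + map_mx intr k1)); split.
- by apply: (copy_perforated e0 c2); eexists; first exact: Y1.
- by apply: (copy_perforated e0 c1); eexists; first exact: Yy0.
have := rV_norm_coord (e *: (y0 + const_mx d + map_mx intr k2) - e *: (y0 + map_mx intr k1)) i0.
apply: le_trans; apply: le_trans (ler_norm _).
have := k1E i0; have := k2E i0; have := abR i0.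
have -> : (e *: (y0 + const_mx d + map_mx intr k2) - e *: (y0 + map_mx intr k1)) 0 i0 =
    e * (y0 0 i0 + d + (k2 0 i0)%:~R) - e * (y0 0 i0 + (k1 0 i0)%:~R).
  by rewrite !mxE.
move: (k1 0 i0) (k2 0 i0) (y0 0 i0) => u v w.
rewrite !mulrDr => h1 h2 h3; rewrite h2 h3.
have d1 : d <= 1 by have := Ysub Y1 i0; have := Ysub Yy0 i0; rewrite !mxE; lra.
have : 0 <= (1 - d) * (1 - e) by rewrite mulr_ge0//; lra.
by lra.
Qed.

(** One of two points at distance at least d from each other is at least d/2 away from x, and on a
    connected set the distance to x takes all intermediate values. So r0 = d/2 is independent of
    eps. *)
Lemma perforated_sphere : (0 < n)%N -> Ys !=set0 ->
  exists2 r0 : R, 0 < r0 < 1 & forall (e : R) (m : nat), 0 < e -> e^-1 = m%:R ->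
    connected (perforated (box a b) Ys e) ->
    forall x (r : R), perforated (box a b) Ys e x -> 0 < r <= r0 ->
      exists2 z, perforated (box a b) Ys e z & `|z - x| = r.
Proof.
move=> n0 Y0; have [d /andP[d0 d1] hd] := perforated_far n0 Y0.
exists (d / 2) => [|e m e0 em cU x r Ux /andP[r0 rd]]; first by rewrite divr_gt0//=; lra.
have [z1 [z2 [Uz1 Uz2 z12]]] := hd e m e0 em.
have [z Uz rz] : exists2 z, perforated (box a b) Ys e z & r <= `|z - x|.
  have tri : `|z1 - z2| <= `|z1 - x| + `|z2 - x|.
    by rewrite [`|z2 - x|]distrC -[z1 - z2](subrKA x); exact: ler_normD.
  have [h|h] := leP (d / 2) `|z1 - x|; first by exists z1 => //; lra.
  by exists z2 => //; lra.
have cf : {within perforated (box a b) Ys e, continuous (fun z => `|z - x|)}.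
  apply: continuous_subspaceT => w.
  apply: (@continuous_comp _ _ _ (fun z : 'rV[R]_n => z - x) (fun z => `|z|)).
    by apply: continuousB; [exact: cvg_id|exact: cst_continuous].
  exact: norm_continuous.
have /connected_intervalP := connected_continuous_connected cU cf.
move=> /(_ 0 `|z - x|) h.
have [|||w Uw wr] := h _ _ r; last by exists w.
- by exists x => //; rewrite subrr normr0.
- by exists z.
by rewrite rz (ltW r0).
Qed.

End perforated_geometry.

(** * Lower bound for the determinant *)

(** F dominates a simple function once the null set is removed. As F may fail to be measurable, the
    null set is taken out of the sets S k, which keep their measure, and the comparison becomes
    pointwise. *)
Lemma sum_le_integral (R : realType) (n : nat) (U : set 'rV[R]_n)
    (F : 'rV[R]_n -> \bar R) (S : nat -> set 'rV[R]_n) (t : nat -> R) N :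
  measurable U -> (forall k, measurable (S k)) -> (forall k, S k `<=` U) ->
  trivIset setT S -> (forall k, 0 <= t k) -> (forall x, U x -> (0 <= F x)%E) ->
  {ae leb, forall x k, S k x -> ((t k)%:E <= F x)%E} ->
  (\sum_(k < N) (t k)%:E * leb (S k) <= \int[leb]_(x in U) F x)%E.
Proof.
move=> mU mS SU tS t0 F0 [Z [mZ Z0 FZ]].
pose T k := S k `\` Z.
have mT k : measurable (T k) by exact: measurableD.
have TE k : leb (T k) = leb (S k).
  apply/eqP; rewrite eq_le; apply/andP; split.
    by apply: le_measure; rewrite ?inE//; exact: subDsetl.
  apply: (@le_trans _ _ (leb (T k `|` Z))).
    apply: le_measure; rewrite ?inE//; first exact: measurableU.
    by move=> x Sx; have [Zx|Zx] := pselect (Z x); [right|left].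
  apply: le_trans (measureU2 _ _ _) _ => //.
  by have := Z0; rewrite /= => ->; rewrite adde0.
have mI k : measurable_fun U (fun x => (\1_(T k) x : R)%:E).
  by apply/measurable_EFinP; exact: measurable_indic.
have t0' k (x : 'rV[R]_n) : (0 <= (t k)%:E * (\1_(T k) x : R)%:E)%E.
  by apply: mule_ge0; rewrite lee_fin.
apply: (@le_trans _ _ (\int[leb]_(x in U) (\sum_(k < N) (t k)%:E * (\1_(T k) x : R)%:E))%E).
  rewrite ge0_integral_sum//; last first.
    by move=> k; apply: measurable_funeM.
  apply: lee_sum => k _; rewrite ge0_integralZl//.
  - rewrite integral_indic// -TE (_ : T k `&` U = T k)//.
    by apply/setIidPl => x [/SU].
  - by rewrite lee_fin.
apply: ge0_le_integral_nomeas => x Ux; first exact: sume_ge0.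
have [[k Tk]|nT] := pselect (exists k : 'I_N, T k x).
  rewrite (bigD1 k)//= big1 ?adde0; last first.
    move=> j jk; rewrite indicE memNset ?mule0// => -[Sj _].
    have := tS j k I I; have [Sk _] := Tk.
    move=> /(_ (ex_intro _ x (conj Sj Sk))) /val_inj jk'.
    by rewrite jk' eqxx in jk.
  rewrite indicE mem_set// mule1; have [Sk nZ] := Tk.
  by apply: contrapT => nF; apply: nZ; apply: FZ => /(_ k Sk).
rewrite big1 => [|k _]; first exact: F0.
by rewrite indicE memNset ?mule0// => Tk; apply: nT; exists k.
Qed.

(** * Local Lipschitz continuity of the determinant *)

Section det_lipschitz.
Context {R : realType}.

Lemma prod_seq_bound (I : Type) (s : seq I) (f : I -> R) K :
  (forall i, `|f i| <= K) -> `|\prod_(i <- s) f i| <= K ^+ size s.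
Proof.
move=> fK; elim: s => [|i s IH]; first by rewrite big_nil normr1 expr0.
by rewrite big_cons exprS normrM ler_pM.
Qed.

(** Exchanging one factor at a time costs h times a product of the others; K >= 1 allows a single
    power of K for all terms. *)
Lemma prod_seq_lipschitz (I : Type) (s : seq I) (f g : I -> R) K h : 1 <= K ->
  (forall i, `|f i| <= K) -> (forall i, `|g i| <= K) ->
  (forall i, `|f i - g i| <= h) ->
  `|\prod_(i <- s) f i - \prod_(i <- s) g i| <= (size s)%:R * K ^+ size s * h.
Proof.
move=> K1 fK gK fgh; have K0 : 0 <= K by lra.
elim: s => [|i s IH]; first by rewrite !big_nil subrr normr0 !mul0r.
have h0 : 0 <= h by apply: le_trans (fgh i).
rewrite !big_cons [size _]/= exprS.
set P := \prod_(j <- s) f j; set Q := \prod_(j <- s) g j.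
have -> : f i * P - g i * Q = f i * (P - Q) + (f i - g i) * Q by ring.
apply: le_trans (ler_normD _ _) _; rewrite !normrM.
have H1 : `|f i| * `|P - Q| <= K * ((size s)%:R * K ^+ size s * h) by exact: ler_pM.
have H2 : `|f i - g i| * `|Q| <= h * K ^+ size s.
  by apply: ler_pM => //; exact: prod_seq_bound.
have H3 : 0 <= (K - 1) * (h * K ^+ size s).
  by rewrite mulr_ge0 ?subr_ge0// mulr_ge0// exprn_ge0.
rewrite -natr1; move: H1 H2 H3; move: (`|_| * _) (`|_| * _) (K ^+ _) (_%:R) => a b c d.
by nra.
Qed.

Lemma det_lipschitz n (A B : 'M[R]_n) K h : 1 <= K ->
  (forall i j, `|A i j| <= K) -> (forall i j, `|B i j| <= K) ->
  (forall i j, `|A i j - B i j| <= h) ->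
  `|\det A - \det B| <= (n`!%:R * n%:R * K ^+ n) * h.
Proof.
move=> K1 AK BK ABh; rewrite /determinant -sumrB.
apply: le_trans (ler_norm_sum _ _ _) _.
have -> : (n`!%:R * n%:R * K ^+ n) * h = \sum_(s : 'S_n) (n%:R * K ^+ n * h).
  by rewrite sumr_const card_Sn -[RHS]mulr_natl !mulrA.
apply: ler_sum => s _; rewrite -mulrBr normrM normrX normrN1 expr1n mul1r.
have sz : size (index_enum 'I_n) = n.
  by rewrite -[RHS](card_ord n) cardE enumT.
by have := @prod_seq_lipschitz _ (index_enum 'I_n) (fun i => A i (s i)) (fun i => B i (s i))
  K h K1 (fun i => AK i _) (fun i => BK i _) (fun i => ABh i _); rewrite sz.
Qed.

End det_lipschitz.

Section det_lower_bound.
Context {R : realType} {n : nat}.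
Variables (c0 C0 q M c r0 L D e : R).
Hypothesis c00 : 0 < c0.
Hypothesis C00 : 0 < C0.
Hypothesis cgt0 : 0 < c.
Hypothesis r0_gt0 : 0 < r0.
Hypothesis r0_lt1 : r0 < 1.
Hypothesis L0 : 0 <= L.
Hypothesis e0 : 0 < e.
Hypothesis q0 : 0 < q.
Hypothesis qe : n%:R <= q * e.

(* Here F stands for the energy density and G for the continuous representative
   of the deformation gradient. *)
Record controlled (U V : set 'rV[R]_n) (F : 'rV[R]_n -> \bar R)
    (G : 'rV[R]_n -> 'M[R]_n) : Prop := {
  ctl_measurable : measurable U ;
  ctl_sub : U `<=` V ;
  ctl_neq0 : U !=set0 ;
  ctl_diam : forall x y, V x -> V y -> `|x - y| <= D ;
  ctl_dense : forall x (r : R), U x -> 0 < r <= r0 ->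
    ((c * r ^+ n)%:E <= leb (U `&` annulus x r))%E ;
  ctl_holder : forall x y i j, V x -> V y ->
    `|G x i j - G y i j| <= L * `|x - y| `^ e ;
  ctl_det : forall x, U x -> 0 < \det (G x) ;
  ctl_ge0 : forall x, U x -> (0 <= F x)%E ;
  ctl_lower : {ae leb, forall x, U x ->
    ((c0 * (frob (G x) ^+ 2 + \det (G x) `^ (- q)) - C0)%:E <= F x)%E} ;
  ctl_int : (\int[leb]_(x in U) F x <= M%:E)%E
}.

(** A gradient large at all points of U would make the energy on one annulus exceed M. So the
    gradient is bounded at some point of U, and Hölder continuity carries the bound over the
    diameter D. *)
Lemma controlled_grad_bound : exists2 K : R, 1 <= K &
  forall U V F G, controlled U V F G -> forall x i j, V x -> `|G x i j| <= K.
Proof.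
(* Chosen so that T c r0^n > M: an energy density of at least T on the annulus of radius r0 is
   excluded. *)
pose T := `|M| / (c * r0 ^+ n) + 1.
have cr0 : 0 < c * r0 ^+ n by rewrite mulr_gt0 ?exprn_gt0.
have T0 : 0 <= T by rewrite addr_ge0// divr_ge0// ltW.
pose K1 := Num.sqrt ((T + C0) / c0).
exists (1 + K1 + L * D `^ e) => [|U V F G X x i j Vx].
  by rewrite -addrA lerDl addr_ge0 ?sqrtr_ge0// mulr_ge0 ?powR_ge0.
have [x0 Ux0] := ctl_neq0 X.
have [y Uy yT] : exists2 y, U y & c0 * frob (G y) ^+ 2 - C0 < T.
  apply: contrapT => nT.
  have hT y : U y -> T <= c0 * frob (G y) ^+ 2 - C0.
    by move=> Uy; rewrite leNgt; apply/negP => h; apply: nT; exists y.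
  pose S (k : nat) : set 'rV[R]_n := if k == 0%N then U `&` annulus x0 r0 else set0.
  have mUA : measurable (U `&` annulus x0 r0).
    by apply: measurableI; [exact: ctl_measurable X|exact: measurable_annulus].
  have : (\sum_(k < 1) T%:E * leb (S k) <= \int[leb]_(x in U) F x)%E.
    apply: (@sum_le_integral _ _ _ _ S (fun=> T)) => //.
    - exact: ctl_measurable X.
    - by move=> k; rewrite /S; case: ifP.
    - by move=> k; rewrite /S; case: ifP => // _ z [].
    - by apply/trivIsetP => -[|a] [|b] _ _ //= _; rewrite ?setI0 ?set0I.
    - exact: ctl_ge0 X.
    - apply: filterS (ctl_lower X) => z hz -[|k]//= [Uz _]; apply: le_trans (hz Uz).
      rewrite lee_fin; apply: le_trans (hT z Uz) _.
      by rewrite mulrDr -addrA lerD2l lerDr mulr_ge0 ?powR_ge0// ltW.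
  rewrite big_ord1/= => /le_trans/(_ (ctl_int X)).
  apply/negP; rewrite -ltNge.
  apply: (@lt_le_trans _ _ (T%:E * (c * r0 ^+ n)%:E)%E); last first.
    apply: lee_wpmul2l; first by rewrite lee_fin.
    by apply: ctl_dense X _ _ Ux0 _; rewrite r0_gt0 lexx.
  rewrite -EFinM lte_fin /T mulrDl divfK ?gt_eqF// mul1r.
  by have := ler_norm M; lra.
have yK : frob (G y) <= K1.
  rewrite -[leLHS]ger0_norm ?frob_ge0// -sqrtr_sqr; apply: ler_wsqrtr.
  by rewrite ler_pdivlMr// mulrC; lra.
have Gy := le_trans (frob_entry (G y) i j) yK.
have H := ctl_holder X i j Vx (ctl_sub X Uy).
have D' : L * `|x - y| `^ e <= L * D `^ e.
  apply: ler_wpM2l => //; apply: ge0_ler_powR; rewrite ?nnegrE ?(ltW e0)//.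
    by apply: le_trans (ctl_diam X Vx (ctl_sub X Uy)).
  exact: ctl_diam X _ _ Vx (ctl_sub X Uy).
rewrite -(subrK (G y i j) (G x i j)); apply: le_trans (ler_normD _ _) _.
lra.
Qed.

Lemma controlled_det_holder : exists2 L' : R, 1 <= L' &
  forall U V F G, controlled U V F G -> forall x y, V x -> V y ->
    `|\det (G x) - \det (G y)| <= L' * `|x - y| `^ e.
Proof.
have [K K1 HK] := controlled_grad_bound.
exists (Num.max 1 (n`!%:R * n%:R * K ^+ n * L)) => [|U V F G X x y Vx Vy].
  by rewrite le_max lexx.
have := det_lipschitz K1 (fun i j => HK _ _ _ _ X x i j Vx)
  (fun i j => HK _ _ _ _ X y i j Vy) (fun i j => ctl_holder X i j Vx Vy).
move=> /le_trans; apply; rewrite mulrA; apply: ler_wpM2r; first exact: powR_ge0.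
by rewrite le_max lexx orbT.
Qed.

(* Around a point where the determinant is below kappa, N dyadic annuli each
   contribute at least c2 to the integral of det^-q, because q e >= n. *)
Lemma controlled_det_lower : exists2 kappa : R, 0 < kappa &
  forall U V F G, controlled U V F G -> forall x, U x -> kappa <= \det (G x).
Proof.
have [L' L'1 HL] := controlled_det_holder.
have L'0 : 0 < L' by lra.
(* For a determinant of at most s, the term c0 det^-q is at least 2 C0, so half of it survives the
   subtraction of C0. The radius r1 keeps the upper bounds 2 L' r^e for the determinant below s. *)
pose s := (c0 / (2 * C0)) `^ q^-1.
have sq : s `^ q = c0 / (2 * C0).
  by rewrite -powRrM mulVf ?gt_eqF// powRr1// divr_ge0 ?mulr_ge0// ltW.
have s0 : 0 < s by rewrite powR_gt0// divr_gt0 ?mulr_gt0.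
pose r1 := Num.min r0 ((s / (2 * L')) `^ e^-1).
have r10 : 0 < r1 by rewrite lt_min r0_gt0 powR_gt0// divr_gt0// mulr_gt0.
have r1r0 : r1 <= r0 by rewrite ge_min lexx.
have r1s : 2 * L' * r1 `^ e <= s.
  rewrite mulrC -ler_pdivlMr ?mulr_gt0//.
  apply: (@le_trans _ _ (((s / (2 * L')) `^ e^-1) `^ e)).
    apply: ge0_ler_powR; rewrite ?nnegrE ?(ltW e0) ?(ltW r10) ?powR_ge0//.
    by rewrite ge_min lexx orbT.
  by rewrite -powRrM mulVf ?gt_eqF// powRr1// divr_ge0 ?mulr_ge0// ltW.
pose r k := r1 / 2 ^+ k.
have rk0 k : 0 < r k by rewrite divr_gt0// exprn_gt0.
have rS k : r k.+1 = r k / 2 by rewrite /r exprS invfM; ring.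
have rle j k : (j <= k)%N -> r k <= r j.
  move=> jk; apply: ler_wpM2l; first exact: ltW.
  by rewrite lef_pV2 ?posrE ?exprn_gt0// ler_eXn2l// ltr1n.
have rr1 k : r k <= r1 by have := rle 0%N k isT; rewrite {2}/r expr0 divr1.
(* A lower bound, free of r, for the energy on one annulus: the density is at least c0/2 (2 L'
   r^e)^-q and the measure at least c r^n. N such contributions exceed M. *)
pose c2 := c0 / 2 * (2 * L') `^ (- q) * c.
have c20 : 0 < c2 by rewrite !mulr_gt0// ?powR_gt0 ?mulr_gt0// invr_gt0.
pose N := (Num.trunc (`|M| / c2)).+1.
have NM : M < c2 * N%:R.
  rewrite mulrC -ltr_pdivrMr//; apply: le_lt_trans (_ : `|M| / c2 < _); last first.
    by apply: truncnS_gt.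
  by apply: ler_wpM2r; rewrite ?invr_ge0 ?(ltW c20)// ler_norm.
(* If the determinant at x is below this value, it is at most L' r_N^e + L' r_k^e <= 2 L' r_k^e on
   the k-th annulus, for each k < N; [S'] keeps only these annuli. *)
exists (L' * r N `^ e) => [|U V F G X x Ux]; first by rewrite mulr_gt0// powR_gt0.
rewrite leNgt; apply/negP => dlt.
pose S k := U `&` annulus x (r k).
pose t k := c0 / 2 * (2 * L' * r k `^ e) `^ (- q).
have Lr k : 0 < 2 * L' * r k `^ e by rewrite !mulr_gt0// powR_gt0.
have mS k : measurable (S k).
  by apply: measurableI; [exact: ctl_measurable X|exact: measurable_annulus].
have t_ge0 k : 0 <= t k by rewrite mulr_ge0 ?powR_ge0// divr_ge0// ltW.
pose S' k := if (k < N)%N then S k else set0.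
have : (\sum_(k < N) (t k)%:E * leb (S' k) <= \int[leb]_(x in U) F x)%E.
  apply: sum_le_integral => //.
  - exact: ctl_measurable X.
  - by move=> k; rewrite /S'; case: ifP.
  - by move=> k; rewrite /S'; case: ifP => _ //; exact: subIsetl.
  - apply: (@sub_trivIset _ _ setT setT) => //.
    have tr j k z : (j < k)%N -> S j z -> S k z -> False.
      move=> jk [_ /andP[zj _]] [_ /andP[_ zk]].
      by have := rle _ _ jk; rewrite rS; lra.
    move=> j k _ _ [z []]; rewrite /S'; case: ifP => // _ Sj; case: ifP => // _ Sk.
    by case: (ltngtP j k) => // h; exfalso; [exact: (tr j k z)|exact: (tr k j z)].
  - exact: ctl_ge0 X.
  - apply: filterS (ctl_lower X) => z hz k; rewrite /S'; case: ifP => // kN [Uz].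
    move=> /andP[_ zk]; apply: le_trans (hz Uz); rewrite lee_fin.
    have dz : \det (G z) <= 2 * L' * r k `^ e.
      have h1 : r N `^ e <= r k `^ e.
        by apply: ge0_ler_powR; rewrite ?nnegrE ?(ltW e0) ?(ltW (rk0 _))// rle// ltnW.
      have h2 : `|z - x| `^ e <= r k `^ e.
        by apply: ge0_ler_powR; rewrite ?nnegrE ?(ltW e0) ?(ltW (rk0 _))//; exact: ltW.
      have := HL _ _ _ _ X z x (ctl_sub X Uz) (ctl_sub X Ux).
      rewrite ler_norml => /andP[_].
      move: h1 h2 dlt; move: (r N `^ e) (r k `^ e) (`|z - x| `^ e) => a b d h1 h2 h3 h4.
      have h5 : L' * a <= L' * b by rewrite ler_pM2l.
      have h6 : L' * d <= L' * b by rewrite ler_pM2l.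
      lra.
    have d0 := ctl_det X Uz.
    have h1 : (2 * L' * r k `^ e) `^ (- q) <= \det (G z) `^ (- q).
      rewrite !powRN lef_pV2 ?posrE ?powR_gt0//; apply: ge0_ler_powR => //;
        rewrite ?nnegrE; exact: ltW.
    have h2 : 2 * C0 <= c0 * (2 * L' * r k `^ e) `^ (- q).
      rewrite powRN ler_pdivlMr ?powR_gt0// mulrC -ler_pdivlMr ?mulr_gt0// -sq.
      apply: ge0_ler_powR; rewrite ?nnegrE ?(ltW q0) ?(ltW (Lr k)) ?(ltW s0)//.
      apply: le_trans r1s; apply: ler_wpM2l; first by rewrite mulr_ge0// ltW.
      by apply: ge0_ler_powR; rewrite ?nnegrE ?(ltW e0) ?(ltW (rk0 _)) ?(ltW r10).
    have h3 : 0 <= frob (G z) ^+ 2 by exact: sqr_ge0.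
    move: h1 h2 h3; rewrite /t; move: ((2 * L' * _) `^ _) (\det _ `^ _) (_ ^+ 2) => a b d h1 h2 h3.
    have h4 : c0 * a <= c0 * b by rewrite ler_pM2l.
    have h5 : 0 <= c0 * d by rewrite mulr_ge0// ltW.
    lra.
move=> /le_trans/(_ (ctl_int X)); apply/negP; rewrite -ltNge.
apply: (@lt_le_trans _ _ (\sum_(k < N) c2%:E)%E).
  by rewrite sumEFin lte_fin sumr_const card_ord -[ltRHS]mulr_natr.
apply: lee_sum => k _; rewrite /S' ltn_ord.
apply: (@le_trans _ _ ((t k)%:E * (c * r k ^+ n)%:E)%E); last first.
  apply: lee_wpmul2l; first by rewrite lee_fin.
  by apply: ctl_dense X _ _ Ux _; rewrite rk0/= (le_trans (rr1 _)).
rewrite -EFinM lee_fin /t /c2 [(2 * L' * _) `^ _]powRM ?powR_ge0 ?mulr_ge0 ?(ltW L'0)//.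
rewrite -powRrM -powR_mulrn ?(ltW (rk0 _))//.
(* The exponent n - q e is nonpositive and the radius is at most 1. *)
have h : 1 <= r k `^ (e * - q) * r k `^ n%:R.
  rewrite -powRD; last by apply/implyP => _; rewrite gt_eqF.
  rewrite -[leLHS](powRr0 (r k)); apply: ger_powR.
  - by rewrite rk0 (le_trans (rr1 _))// (le_trans r1r0)// ltW.
  - by have := qe; lra.
have h' : 0 <= c0 / 2 * (2 * L') `^ (- q) * c by exact: ltW.
move: h h'; move: (_ `^ (e * _)) (_ `^ n%:R) (_ `^ (- q)) => a b d h h'.
have -> : c0 / 2 * (d * a) * (c * b) = c0 / 2 * d * c * (a * b) by ring.
by rewrite ler_peMr.
Qed.

End det_lower_bound.

(** * Energy bounds and conclusion *)

Section matrix_continuity.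
Context {R : realType}.

Lemma within_continuous_mx (T : topologicalType) m n (V : set T)
    (G : T -> 'M[R]_(m, n)) :
  (forall i j, {within V, continuous (fun x => G x i j)}) ->
  {within V, continuous G}.
Proof.
move=> cG; apply/subspace_continuousP => x Vx; apply/cvgrPdist_le => d d0.
have h (i : 'I_m) (j : 'I_n) :
    \forall y \near within V (nbhs x), `|G x i j - G y i j| <= d.
  by have /subspace_continuousP/(_ x Vx)/cvgrPdist_le/(_ d d0) := cG i j.
have h' : \forall y \near within V (nbhs x), forall i j, `|G x i j - G y i j| <= d.
  apply: (@filter_forall _ _ (fun i y => forall j, `|G x i j - G y i j| <= d)) => i.
  exact: (@filter_forall _ _ (fun j y => `|G x i j - G y i j| <= d)).
apply: filterS h' => y hy; rewrite [`|_|]mx_normrE; apply/bigmax_leP; split.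
  exact: ltW.
by move=> [i j] _ /=; rewrite !mxE.
Qed.

Lemma within_continuous_entry (T : topologicalType) m n (V : set T)
    (G : T -> 'M[R]_(m, n)) i j :
  {within V, continuous G} -> {within V, continuous (fun x => G x i j)}.
Proof.
move=> /subspace_continuousP cG; apply/subspace_continuousP => x Vx.
apply: (@cvg_comp _ _ _ G (fun A : 'M[R]_(m, n) => A i j) _ _ _ (cG x Vx)).
exact: coord_continuous.
Qed.

End matrix_continuity.

Section energy_bounds.
Context {R : realType} {n : nat}.
Variables (c0 C0 p q M : R).
Variables (W : 'rV[R]_n -> 'M[R]_n -> R) (H : 'rV[R]_n -> 'M[R]_(n, n * n) -> R).
Hypothesis c00 : 0 < c0.
Hypothesis n0 : (0 < n)%N.
Hypothesis np : n%:R < p.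
Hypothesis EW : elastic_energy c0 C0 q W.
Hypothesis EH : hyperstress_energy c0 C0 p H.

Let p1 : 1 < p. Proof. by apply: le_lt_trans np; rewrite ler1n. Qed.
Let p0 : 0 < p. Proof. exact: lt_trans p1. Qed.

Lemma elastic_density_ge0 y F : (0 <= elastic_density W y F)%E.
Proof.
rewrite /elastic_density; case: ifP => // dF; rewrite lee_fin.
exact: (elastic_ge0 EW).
Qed.

Lemma frob_mxvec_row m k l (A : 'I_m -> 'M[R]_(k, l)) (i : 'I_m) :
  frob (A i) <= frob (\matrix_(i < m) mxvec (A i)).
Proof.
apply: le_frob_sum; rewrite [leRHS](bigD1 i)//=; apply: ler_wpDr.
  by apply: sumr_ge0 => j _; apply: sumr_ge0 => j' _; exact: sqr_ge0.
rewrite [leRHS](reindex _ (curry_mxvec_bij _ _))/= pair_bigA/=.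
rewrite le_eqVlt; apply/orP; left; apply/eqP; apply: eq_bigr => -[j j'] _ /=.
by rewrite mxE mxvecE.
Qed.

(** As the elastic part is nonnegative, the energy density dominates c0 times the p-th power of the
    norm of the Hessian of each component, pointwise. *)
Lemma hess_bound (e : R) (U : set 'rV[R]_n) v m : measurable U -> 0 < M ->
  (forall i, W2 p U (coordf v i)) -> (mechanical_energy W H e U v <= M%:E)%E ->
  (Lpnorm p U (fun x => frob (whess U (coordf v m) x)) <= ((M / c0) `^ p^-1)%:E)%E.
Proof.
move=> mU M0 v2 vM; rewrite LpnormE// -poweR_EFin.
have f0 (x : 'rV[R]_n) : U x -> (0 <= (`|frob (whess U (coordf v m) x)| `^ p)%:E)%E.
  by rewrite lee_fin powR_ge0.
apply: gt0_ler_poweR.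
- by rewrite invr_ge0 ltW.
- by rewrite in_itv/= leey andbT; exact: integral_ge0.
- by rewrite in_itv/= leey andbT lee_fin divr_ge0// ltW.
have -> : (M / c0)%:E = (c0^-1%:E * M%:E)%E by rewrite -EFinM mulrC.
rewrite -[leLHS]mul1e -[X in (X%:E * _)%E](mulVf (lt0r_neq0 c00)) EFinM -muleA.
apply: lee_wpmul2l; first by rewrite lee_fin invr_ge0 ltW.
apply: le_trans vM; rewrite -ge0_integralZl_EFin//; last 2 first.
- apply/measurable_EFinP; apply: (@measurableT_comp _ _ _ _ _ _ (fun y : R => y `^ p)).
    exact: measurable_powR.
  apply: (@measurableT_comp _ _ _ _ _ _ (@Num.norm R R)) => //.
  apply: measurable_frob => i j; under eq_fun do rewrite mxE.
  by have [_ /(_ i)[_ /(_ j)[_ []]]] := v2 m.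
- exact: ltW.
apply: ge0_le_integral_nomeas => x Ux.
  by rewrite mule_ge0// lee_fin ?powR_ge0// ltW.
rewrite -EFinM; apply: (@le_trans _ _ (H (e^-1 *: x) (vhess U v x))%:E); last first.
  by rewrite leeDr// elastic_density_ge0.
rewrite lee_fin; apply: le_trans (hyper_lower EH _ _).
apply: ler_wpM2l; first exact: ltW.
rewrite (ger0_norm (frob_ge0 _)); apply: ge0_ler_powR; rewrite ?nnegrE ?frob_ge0 ?(ltW p0)//.
exact: (frob_mxvec_row (fun i => whess U (coordf v i) x)).
Qed.

Lemma energy_lower (e : R) (U : set 'rV[R]_n) v x (F : 'M[R]_n) :
  vgrad U v x = F -> 0 < \det F ->
  ((c0 * (frob F ^+ 2 + \det F `^ (- q)) - C0)%:E <=
   elastic_density W (e^-1 *: x) (vgrad U v x) + (H (e^-1 *: x) (vhess U v x))%:E)%E.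
Proof.
move=> -> dF; rewrite /elastic_density dF -EFinD lee_fin.
apply: ler_wpDr; first exact: (hyper_ge0 EH).
exact: (elastic_coercive EW).
Qed.

Variables (A B : 'rV[R]_n) (eps : nat -> R) (U : nat -> set 'rV[R]_n).
Variable E : nat -> ('rV[R]_n -> R) -> 'rV[R]_n -> R.
Hypothesis AB : forall i, 1 <= B 0 i - A 0 i.
Hypothesis oU : forall k, open (U k).
Hypothesis UV : forall k, U k `<=` obox A B.
Hypothesis EE : extension_operator p eps U (obox A B) E.

(** Morrey's inequality is applied to each first derivative of each extended component: its gradient
    is a row of a Hessian, bounded in L^p by the energy through the extension bound, with a constant
    that does not depend on k. *)
Lemma grad_extension : 0 < M -> exists2 L : R, 0 <= L & forall k v,
  (forall i, W2 p (U k) (coordf v i)) ->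
  (mechanical_energy W H (eps k) (U k) v <= M%:E)%E ->
  exists G : 'rV[R]_n -> 'M[R]_n,
    [/\ forall x y i j, obox A B x -> obox A B y ->
          `|G x i j - G y i j| <= L * `|x - y| `^ @holder_exp R n p,
        {within obox A B, continuous G} &
        forall i j, weak_pderiv (obox A B) j (E k (coordf v i)) (fun x => G x i j)].
Proof.
move=> M0; have [Cm Cm0 HM] := morrey_box n0 np AB.
have [Ce HE] := ext_W2_bounds EE.
pose N := Num.max Ce 0 * (M / c0) `^ p^-1.
have N0 : 0 <= N by rewrite mulr_ge0 ?powR_ge0// le_max lexx orbT.
exists (Cm * N) => [|k v v2 vM]; first exact: mulr_ge0.
have mU : measurable (U k) by exact: rV_open_measurable.
have ex (ij : 'I_n * 'I_n) : exists r : 'rV[R]_n -> R,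
    [/\ forall x y, obox A B x -> obox A B y ->
          `|r x - r y| <= Cm * N * `|x - y| `^ @holder_exp R n p,
        {within obox A B, continuous r} &
        {ae leb, forall x, obox A B x -> wD (obox A B) ij.2 (E k (coordf v ij.1)) x = r x}].
  have [_ W22] := ext_W2 EE (v2 ij.1).
  apply: (HM _ (fun j => wD (obox A B) j (wD (obox A B) ij.2 (E k (coordf v ij.1))))).
    by move=> j; have [_ /(_ j)[]] := W22 ij.2.
  move=> j; have [_ _ HH] := HE k _ (v2 ij.1).
  apply: (@le_trans _ _ (Lpnorm p (obox A B)
      (fun x => frob (whess (obox A B) (E k (coordf v ij.1)) x)))).
    apply: Lpnorm_mono => // x _; rewrite [leRHS]ger0_norm ?frob_ge0//.
    by have := frob_entry (whess (obox A B) (E k (coordf v ij.1)) x) ij.2 j; rewrite mxE.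
  apply: le_trans HH _; rewrite /N EFinM.
  apply: (@le_trans _ _ ((Num.max Ce 0)%:E *
      Lpnorm p (U k) (fun x => frob (whess (U k) (coordf v ij.1) x)))%E).
    by apply: lee_wpmul2r; [exact: Lnorm_ge0|rewrite lee_fin le_max lexx].
  apply: lee_wpmul2l; first by rewrite lee_fin le_max lexx orbT.
  exact: hess_bound vM.
have [r rP] := choice ex.
exists (fun x => \matrix_(i, j) r (i, j) x); split.
- by move=> x y i j Vx Vy; rewrite !mxE; have [h _ _] := rP (i, j); exact: h.
- apply: within_continuous_mx => i j; under eq_fun do rewrite mxE.
  by have [_ h _] := rP (i, j).
move=> i j; under eq_fun do rewrite mxE; have [_ cr ae] := rP (i, j).
have [[_ /(_ j)[w _]] _] := ext_W2 EE (v2 i).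
have oV := @open_obox R n A B; have mV := rV_open_measurable oV.
apply: (weak_pderiv_ae oV w _ _ _ ae).
- by have [[]] := w.
- exact: rV_within_measurable.
- by apply: aeW.
Qed.

(** Weak derivatives restrict to open subsets, and on U k the extension is u almost everywhere. *)
Lemma extension_weak_pderiv k u g i : W2 p (U k) u ->
  weak_pderiv (obox A B) i (E k u) g -> weak_pderiv (U k) i u g.
Proof.
move=> u2 w; have w' := weak_pderiv_sub (@oU k) (@open_obox R n A B) (@UV k) w.
have mU := rV_open_measurable (@oU k).
apply: (weak_pderiv_ae (@oU k) w').
- by have [[[]]] := u2.
- by have [_ []] := w'.
- by have [h _] := u2; exact: (ext_extends EE (ltW p1) h).
- by apply: aeW.
Qed.

End energy_bounds.

Theorem lemma6p5 (R : realType) (n : nat) (a b : 'rV[int]_n)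
    (eps : nat -> R) (Ys GD GN : set 'rV[R]_n) (c0 C0 p q : R)
    (W : 'rV[R]_n -> 'M[R]_n -> R) (H : 'rV[R]_n -> 'M[R]_(n, n * n) -> R)
    (E : nat -> ('rV[R]_n -> R) -> 'rV[R]_n -> R) (M : R) :
  (2 <= n)%N ->
  (forall i, a 0 i < b 0 i) ->
  (forall k, 0 < eps k) ->
  (forall k, exists m : nat, (eps k)^-1 = m%:R) ->
  eps @ \oo --> (0 : R) ->
  reference_cell Ys ->
  (forall k, perforated_domain (box a b) Ys (eps k)) ->
  boundary_splitting a b eps GD GN ->
  0 < c0 -> 0 < C0 ->
  n%:R < p ->
  p * n%:R / (p - n%:R) <= q ->
  elastic_energy c0 C0 q W ->
  hyperstress_energy c0 C0 p H ->
  extension_operator p eps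
    (fun k => perforated (box a b) Ys (eps k)) (box a b) E ->
  0 < M ->
  exists kappa : R,
    [/\ 0 < kappa,
        forall k v,
          energy_sublevel p W H M (eps k)
            (perforated (box a b) Ys (eps k)) GD v ->
          grad_everywhere (perforated (box a b) Ys (eps k)) v
            (fun F => kappa <= \det F) &
        exists2 eps0 : R, 0 < eps0 &
          forall k, eps k < eps0 ->
          forall v,
            energy_sublevel p W H M (eps k)
              (perforated (box a b) Ys (eps k)) GD v ->
            grad_everywhere (box a b) (extend_componentwise (E k) v)
              (fun F => kappa / 2 <= \det F)].
Proof.
move=> n2 ab eps0 epsm epsc RC PD _ c00 C00 np qp EW EH EE0 M0.
have n0 : (0 < n)%N by exact: ltnW.
pose A : 'rV[R]_n := map_mx intr a; pose B : 'rV[R]_n := map_mx intr b.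
pose U k := perforated (box a b) Ys (eps k).
have VE : box a b = obox A B :> set 'rV[R]_n by exact: boxE.
have EE : extension_operator p eps U (obox A B) E by rewrite -VE.
have oYs := cell_open RC; have Ysub := cell_sub RC; have Y0 := cell_nonempty RC.
have UV k : U k `<=` obox A B by rewrite -VE; exact: (perforated_sub Ysub).
have oU k : open (U k) by exact: open_interior.
have AB i : 1 <= B 0 i - A 0 i by exact: box_width.
have p0 : 0 < p by apply: lt_trans np; rewrite ltr0n.
pose e := @holder_exp R n p.
have e0 : 0 < e by exact: holder_exp_gt0.
have pn0 : 0 < p - n%:R by rewrite subr_gt0.
have q0 : 0 < q.
  by apply: lt_le_trans qp; rewrite divr_gt0// mulr_gt0// ltr0n.
(* Since e = (p - n) / p, equality holds at the smallest admissible q. *)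
have qe : n%:R <= q * e.
  have <- : p * n%:R / (p - n%:R) * e = n%:R.
    by rewrite /e /holder_exp; field; rewrite !gt_eqF.
  by apply: ler_wpM2r => //; exact: ltW.
have [c c_gt0 Hc] := measure_density n0 np AB oU UV EE.
have [r0 /andP[r00 r01] Hr] := perforated_sphere ab oYs Ysub n0 Y0.
have [L L0 HL] := grad_extension c00 n0 np EW EH AB oU EE M0.
pose D := `|B - A|.
have [kappa kappa0 Hkappa] :=
  @controlled_det_lower R n c0 C0 q M c r0 L D e c00 C00 c_gt0 r00 r01 L0 e0 q0 qe.
have [L' L'1 HL'] :=
  @controlled_det_holder R n c0 C0 q M c r0 L D e c00 c_gt0 r00 L0 e0.
have main k v : energy_sublevel p W H M (eps k) (U k) GD v ->
  exists G : 'rV[R]_n -> 'M[R]_n,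
    [/\ {within obox A B, continuous G},
        forall i j, weak_pderiv (obox A B) j (E k (coordf v i)) (fun x => G x i j),
        forall i j, weak_pderiv (U k) j (coordf v i) (fun x => G x i j) &
        controlled c0 C0 q M c r0 L D e (U k) (obox A B)
          (fun x => elastic_density W ((eps k)^-1 *: x) (vgrad (U k) v x) +
                    (H ((eps k)^-1 *: x) (vhess (U k) v x))%:E)%E G].
  move=> [[v2 _ [G0 [cG0 wG0 dG0]]] vM].
  have [G [hG cG wG]] := HL k v v2 vM.
  have wU i j := extension_weak_pderiv n0 np oU UV EE (v2 i) (wG i j).
  exists G; split=> //.
  (* Positivity of the determinant is known for the representative [G0] given by admissibility, the
     Hölder bound for [G]; by continuity they coincide on U k. *)
  have GG0 x : U k x -> G x = G0 x.
    move=> Ux; apply/matrixP => i j; move: x Ux; apply: (continuous_ae_eq (oU k)).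
    - by apply: within_continuous_entry; exact: continuous_subspaceW (@UV k) cG.
    - exact: within_continuous_entry.
    - exact: weak_pderiv_unique (oU k) (wU i j) (wG0 i j).
  have [m em] := epsm k.
  split=> //.
  - exact: rV_open_measurable.
  - have [d _ Hd] := perforated_far ab oYs Ysub n0 Y0.
    by have [z1 [_ [Uz1 _ _]]] := Hd _ _ (eps0 k) em; exists z1.
  - move=> x y Vx Vy; apply: rV_norm_le => [|i]; first exact: normr_ge0.
    have := rV_norm_coord (B - A) i; rewrite mxE [(- A) 0 i]mxE -/D => H1.
    rewrite mxE [(- y) 0 i]mxE; have := ler_norm (B 0 i - A 0 i).
    by have := Vx i; have := Vy i; rewrite ler_norml; lra.
  - move=> x r Ux /[dup] rr /andP[r_gt0 _].
    have [z Uz zx] := Hr _ _ (eps0 k) em (perforated_connected (PD k)) x r Ux rr.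
    exact: Hc Ux Uz r_gt0 zx.
  - by move=> x Ux; rewrite GG0//; exact: dG0.
  - move=> x _; apply: adde_ge0; first exact: (elastic_density_ge0 EW).
    by rewrite lee_fin; exact: (hyper_ge0 EH).
  - have h : {ae leb, forall x, forall i j, U k x -> wD (U k) j (coordf v i) x = G x i j}.
      apply: (@filter_forall _ _ (fun i x => forall j, U k x -> wD (U k) j (coordf v i) x = G x i j)).
      move=> i; apply: (@filter_forall _ _ (fun j x => U k x -> wD (U k) j (coordf v i) x = G x i j)).
      by move=> j; exact: weak_pderiv_unique (oU k) (weak_wD (wU i j)) (wU i j).
    apply: filterS h => x hx Ux; apply: (energy_lower EW EH).
      by apply/matrixP => i j; rewrite mxE hx.
    by rewrite GG0//; exact: dG0.
exists kappa; split=> //.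
  move=> k v /main[G [cG wG wU X]]; exists G; split=> //.
    exact: continuous_subspaceW (@UV k) cG.
  exact: Hkappa X.
(* With this threshold L' eps^e <= kappa/2: the passage from a point of U k to a point of the box
   within eps of it costs at most half of kappa. *)
exists ((kappa / (2 * L')) `^ e^-1).
  by rewrite powR_gt0// divr_gt0// mulr_gt0//; lra.
move=> k ek v /main[G [cG wG wU X]]; rewrite VE; exists G; split=> //.
  move=> i j; rewrite (_ : coordf _ i = E k (coordf v i))//.
  by apply/funext => x; rewrite /coordf /extend_componentwise mxE.
move=> x Vx; have [m em] := epsm k.
have [|y Uy xy] := @perforated_near R n a b Ys oYs Ysub (eps k) m x (eps0 k) em Y0.
  by rewrite VE.
have := Hkappa _ _ _ _ X y Uy.
have := HL' _ _ _ _ X x y Vx (UV k y Uy).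
have L'e : L' * `|x - y| `^ e <= kappa / 2.
  have L'0 : 0 < L' by lra.
  have -> : kappa / 2 = L' * (kappa / (2 * L')) by field; rewrite gt_eqF.
  apply: ler_wpM2l; first exact: ltW.
  have -> : kappa / (2 * L') = ((kappa / (2 * L')) `^ e^-1) `^ e.
    by rewrite -powRrM mulVf ?gt_eqF// powRr1// divr_ge0 ?mulr_ge0// ltW.
  apply: ge0_ler_powR; rewrite ?nnegrE ?powR_ge0 ?(ltW e0)//.
  by apply: le_trans xy _; exact: ltW.
rewrite ler_norml => /andP[h _]; lra.
Qed.
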